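(* Let $\{\vec\xi(j)\}_{j\in\mathbb Z}$ and $\{\vec\eta(j)\}_{j\in\mathbb Z}$ be uncorrelated $T$-dimensional stationary sequences with spectral densities $F(\lambda)$ and $G(\lambda)$ satisfying the minimality condition $\int_{-\pi}^{\pi}(F(\lambda)+G(\lambda))^{-1}d\lambda<\infty$. Then the spectral characteristic $h(e^{i\lambda})$ and the mean square error $\Delta(F,G)=E|A\vec\xi-\hat A\vec\xi|^2$ of the optimal linear estimate $\hat A\vec\xi$ of the functional $A\vec\xi=\sum_{j\in Z^S}\vec a(j)^\top\vec\xi(-j)$ based on observations of $\vec\xi(j)+\vec\eta(j)$ at the points $j\in\mathbb Z_-\setminus S$ are given by $$(h(e^{i\lambda}))^\top=(A(e^{i\lambda}))^\top F(\lambda)(F(\lambda)+G(\lambda))^{-1}-(C(e^{i\lambda}))^\top(F(\lambda)+G(\lambda))^{-1},\qquad C(e^{i\lambda})=\sum_{k\in U}(\mathbf B^{-1}\mathbf R\vec{\mathbf a})(k)e^{ik\lambda},$$ $$\Delta(F,G)=\frac1{2\pi}\int_{-\pi}^{\pi}(r_G(\lambda))^\top F(\lambda)\overline{r_G(\lambda)}\,d\lambda+\frac1{2\pi}\int_{-\pi}^{\pi}(r_F(\lambda))^\top G(\lambda)\overline{r_F(\lambda)}\,d\lambda=\langle\mathbf R\vec{\mathbf a},\mathbf B^{-1}\mathbf R\vec{\mathbf a}\rangle+\langle\mathbf Q\vec{\mathbf a},\vec{\mathbf a}\rangle,$$ where $$(r_F(\lambda))^\top=\big((A(e^{i\lambda}))^\top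 F(\lambda)-(C(e^{i\lambda}))^\top\big)(F(\lambda)+G(\lambda))^{-1},\qquad (r_G(\lambda))^\top=\big((A(e^{i\lambda}))^\top G(\lambda)+(C(e^{i\lambda}))^\top\big)(F(\lambda)+G(\lambda))^{-1}.$$
   Context: Index sets: $s\ge1$ and integers $M_l\ge1$, $N_l\ge0$ with $M_l+N_l<M_{l+1}$ are given; $\mathbb Z_-=\{-1,-2,\ldots\}$; $S=\bigcup_{l=1}^s\{-(M_l+N_l),\ldots,-M_l\}$ (missing observations); $S^+=\bigcup_{l=1}^s\{M_l,\ldots,M_l+N_l\}$; $Z^S=\{1,2,\ldots\}\setminus S^+$; $U=S\cup\{0,1,2,\ldots\}$. Sequences: $\vec\xi(j),\vec\eta(j)$ are mean-zero $\mathbb C^T$-valued with finite second moments, mutually uncorrelated, with $E\vec\xi(j+n)\vec\xi(j)^*=\frac1{2\pi}\int_{-\pi}^{\pi}e^{in\lambda}F(\lambda)d\lambda$, $E\vec\eta(j+n)\vec\eta(j)^*=\frac1{2\pi}\int_{-\pi}^{\pi}e^{in\lambda}G(\lambda)d\lambda$, where $F,G$ are integrable functions with nonnegative Hermitian $T\times T$ matrix values. Spectral representations: $\vec\xi(j)=\int_{-\pi}^{\pi}e^{ij\lambda}Z_\xi(d\lambda)$, $\vec\eta(j)=\int_{-\pi}^{\pi}e^{ij\lambda}Z_\eta(d\lambda)$ with orthogonal stochastic measures $Z_\xi,Z_\eta$. The minimality condition means that $F+G$ is invertible a.e. and $(F+G)^{-1}$ has integrable entries. Functional: coefficients $\vec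 a(j)\in\mathbb C^T$ satisfy $\sum_{j\in Z^S}\sum_{k=1}^T|a_k(j)|<\infty$; $A(e^{i\lambda})=\sum_{j\in Z^S}\vec a(j)e^{-ij\lambda}$. Optimal estimate: $\hat A\vec\xi$ is the orthogonal projection of $A\vec\xi$, in the Hilbert space of mean-zero square-integrable random variables with $(\xi,\eta)=E\xi\overline\eta$, onto the closed linear span of $\{\xi_k(j)+\eta_k(j):j\in\mathbb Z_-\setminus S,\ 1\le k\le T\}$. Let $L_2(F+G)$ be the Hilbert space of $\mathbb C^T$-valued functions $\vec b$ with $\int_{-\pi}^{\pi}\vec b(\lambda)^\top(F(\lambda)+G(\lambda))\overline{\vec b(\lambda)}d\lambda<\infty$, and $L_2^s(F+G)$ its closed subspace generated by $e^{in\lambda}\delta_k$, $n\in\mathbb Z_-\setminus S$, $k=1,\ldots,T$ ($\delta_k$ the standard basis vectors). The spectral characteristic of $\hat A\vec\xi$ is the $h\in L_2^s(F+G)$ with $\hat A\vec\xi=\int_{-\pi}^{\pi}(h(e^{i\lambda}))^\top(Z_\xi(d\lambda)+Z_\eta(d\lambda))$. Operators: $\vec{\mathbf a}=(\vec{\mathbf a}(k))_{k\in U}$ with $\vec{\mathbf a}(k)=\vec a(k)$ for $k\in Z^S$ and $\vec{\mathbf a}(k)=\vec0$ for $k\in S\cup\{0\}\cup S^+$. $\mathbf B,\mathbf R,\mathbf Q$ are the linear operators on $\ell_2=\ell_2(U;\mathbb C^T)$ defined by the block matrices (acting as $(\mathbf B\vec{\mathbf c})(k)=\sum_{j\in U}B(k,j)\vec{\mathbf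 c}(j)$, etc.), for $k,j\in U$, $$B(k,j)=\frac1{2\pi}\int_{-\pi}^{\pi}[(F+G)^{-1}]^\top e^{-i(k-j)\lambda}d\lambda,\quad R(k,j)=\frac1{2\pi}\int_{-\pi}^{\pi}[F(F+G)^{-1}]^\top e^{-i(k+j)\lambda}d\lambda,\quad Q(k,j)=\frac1{2\pi}\int_{-\pi}^{\pi}[F(F+G)^{-1}G]^\top e^{i(k-j)\lambda}d\lambda.$$ These are taken to be well-defined operators on $\ell_2$, with $\mathbf B$ invertible and inverse $\mathbf B^{-1}$. The inner product is $\langle x,y\rangle=\sum_{k\in U}x(k)^\top\overline{y(k)}$. *)

(* Defs.v *)
From HB Require Import structures.
From mathcomp Require Export all_boot all_order all_algebra.
From mathcomp Require Export all_classical all_reals all_analysis.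
From mathcomp Require Export complex.

Set Implicit Arguments.
Unset Strict Implicit.
Unset Printing Implicit Defensive.

Import Order.TTheory GRing.Theory Num.Theory.
Import numFieldNormedType.Exports.
Import ComplexField.Normc.

Local Open Scope classical_set_scope.
Local Open Scope ring_scope.
Local Open Scope complex_scope.

Section ComplexIntegration.
Context {d : measure_display} {X : measurableType d} {R : realType}.
Implicit Types (m : {measure set X -> \bar R}) (D : set X) (f : X -> R[i]).

Definition cmeasurable D f : Prop :=
  measurable_fun D (fun x => complex.Re (f x)) /\ measurable_fun D (fun x => complex.Im (f x)).

Definition cintegrable m D f : Prop :=
  m.-integrable D (fun x => (complex.Re (f x))%:E) /\
  m.-integrable D (fun x => (complex.Im (f x))%:E).

Definition cintegral m D f : R[i] :=
  Rintegral m D (fun x => complex.Re (f x)) +i* Rintegral m D (fun x => complex.Im (f x)).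

End ComplexIntegration.

Section ComplexVectors.
Context {R : realType} {T : nat}.
Implicit Types (z : R[i]) (x : 'cV[R[i]]_T) (H : 'M[R[i]]_T).

Definition nsq z : R := normc z ^+ 2.

Definition conj_mx m n (A : 'M[R[i]]_(m, n)) : 'M[R[i]]_(m, n) :=
  map_mx Num.conj A.

Definition qform H x : R[i] := (x^T *m H *m conj_mx x) 0 0.

(* [0 <= z] in R[i] says that z is real and nonnegative. *)
Definition nonneg_hermitian H : Prop :=
  (conj_mx H)^T = H /\ forall x, 0 <= qform H x.

Definition cis (t : R) : R[i] := cos t +i* sin t.

Definition delta (k : 'I_T) : 'cV[R[i]]_T := delta_mx k 0.

End ComplexVectors.

(* V is a space carrying the squared seminorm N, and L is its subset of
   elements of finite norm. *)
Definition linspan (K : pzRingType) (V : lmodType K) (G : set V) : set V :=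
  [set v | exists (n : nat) (c : 'I_n -> K) (g : 'I_n -> V),
     (forall i, G (g i)) /\ v = \sum_(i < n) c i *: g i].

Definition closed_span (R : realType) (K : pzRingType) (V : lmodType K)
    (L : set V) (N : V -> \bar R) (G : set V) : set V :=
  [set v | L v /\
     forall e : R, 0 < e -> exists y, linspan G y /\ (N (v - y)%R < e%:E)%E].

Section SeriesOverIntegers.
Context {R : realType}.
Implicit Types (D : set int) (f : int -> R[i]).

Definition zrange (n : nat) : seq int :=
  [seq (i%:Z - n%:Z)%R | i <- iota 0 (2 * n).+1].

Definition psum (V : nmodType) D (f : int -> V) (n : nat) : V :=
  \sum_(j <- zrange n | j \in D) f j.

Definition abs_summable D f : Prop :=
  (\esum_(j in D) (normc (f j))%:E < +oo)%E.

(* Only meaningful for absolutely summable families. *)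
Definition csum D f : R[i] :=
  limn (fun n => complex.Re (psum D f n)) +i* limn (fun n => complex.Im (psum D f n)).

End SeriesOverIntegers.

Section IndexSets.
Variables (s : nat) (M N : nat -> nat).

Definition missing : set int :=
  [set j | exists l, [/\ (1 <= l)%N, (l <= s)%N,
     - (M l + N l)%N%:Z <= j & j <= - (M l)%:Z]].

Definition missing_pos : set int :=
  [set j | exists l, [/\ (1 <= l)%N, (l <= s)%N,
     (M l)%:Z <= j & j <= (M l + N l)%N%:Z]].

Definition Zneg : set int := [set j | j < 0].

Definition observed : set int := Zneg `\` missing.

Definition ZS : set int := [set j | 0 < j] `\` missing_pos.

Definition Uset : set int := missing `|` [set j | 0 <= j].

End IndexSets.

(* l2(U; C^T) is realized by the families on Z that vanish outside U. *)
Section BlockOperators.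
Context {R : realType} {T : nat}.
Variable U : set int.
Implicit Types (x y : int -> 'cV[R[i]]_T) (A : int -> int -> 'M[R[i]]_T).

Definition l2 : set (int -> 'cV[R[i]]_T) :=
  [set x | (forall k, ~ U k -> x k = 0) /\
     (\esum_(k in U) (\sum_(i < T) nsq (x k i 0))%R%:E < +oo)%E].

Definition block_op A x : int -> 'cV[R[i]]_T := fun k =>
  if k \in U then \col_i csum U (fun j => (A k j *m x j) i 0) else 0.

Definition defined_on_l2 A : Prop := forall x, l2 x ->
  (forall k, U k -> forall i, abs_summable U (fun j => (A k j *m x j) i 0)) /\
  l2 (block_op A x).

(* A two-sided inverse on l2(U; C^T); values off l2 are irrelevant. *)
Definition inverse_on_l2 A (Ainv : (int -> 'cV[R[i]]_T) -> int -> 'cV[R[i]]_T)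
  : Prop :=
  (forall x, l2 x -> Ainv (block_op A x) = x) /\
  (forall y, l2 y -> l2 (Ainv y) /\ block_op A (Ainv y) = y).

Definition l2_inner x y : R[i] := csum U (fun k => ((x k)^T *m conj_mx (y k)) 0 0).

End BlockOperators.

Section SpectralDomain.
Context {R : realType} {T : nat}.
Implicit Types (H : R -> 'M[R[i]]_T) (b h : R -> 'cV[R[i]]_T).

Definition circ : set R := `[- pi, pi].

Local Notation leb := (@lebesgue_measure R).

Definition circ_ae (Q : R -> Prop) : Prop :=
  {ae leb, forall t, circ t -> Q t}.

(* 1/(2 pi) times the integral over [-pi, pi] *)
Definition cmean (f : R -> R[i]) : R[i] :=
  ((2 * pi)^-1)%:C * cintegral leb circ f.

Definition mean_mx H : 'M[R[i]]_T := \matrix_(k, l) cmean (fun t => H t k l).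

Definition integrable_mx H : Prop :=
  forall k l, cintegrable leb circ (fun t => H t k l).

Definition spectral_density H : Prop :=
  integrable_mx H /\ forall t, circ t -> nonneg_hermitian (H t).

Definition minimality H : Prop :=
  circ_ae (fun t => H t \in unitmx) /\ integrable_mx (fun t => invmx (H t)).

Definition measurable_vec b : Prop :=
  forall k, cmeasurable circ (fun t => b t k 0).

(* For a nonnegative Hermitian H the form is real, so Re discards nothing. *)
Definition wnorm H b : \bar R := (\int[leb]_(t in circ) (complex.Re (qform (H t) (b t)))%:E)%E.

Definition L2w H : set (R -> 'cV[R[i]]_T) :=
  [set b | measurable_vec b /\ (wnorm H b < +oo)%E].

Definition char_fun (n : int) (k : 'I_T) : R -> 'cV[R[i]]_T :=
  fun t => cis (n%:~R * t) *: delta k.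

Definition L2w_sub H (D : set int) : set (R -> 'cV[R[i]]_T) :=
  closed_span (L2w H) (wnorm H)
    [set b | exists n k, D n /\ b = char_fun n k].

(* The series sum_(k in D) c(k) e^{ikt}, for square summable c, converges to f
   in L2([-pi, pi]; C^T); f is thereby determined almost everywhere. *)
Definition is_fourier_series (D : set int) (c : int -> 'cV[R[i]]_T)
    (f : R -> 'cV[R[i]]_T) : Prop :=
  measurable_vec f /\
  (fun n => wnorm (fun=> 1%:M)
     (fun t => f t - psum D (fun k => cis (k%:~R * t) *: c k) n)) @ \oo --> 0%E.

End SpectralDomain.

Section RandomVectors.
Context {R : realType} {d : measure_display} {Omega : measurableType d}.
Variable P : probability Omega R.
Context {T : nat}.
Implicit Types (X Y : Omega -> R[i]) (V W : Omega -> 'cV[R[i]]_T).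
Implicit Types (xi eta : int -> Omega -> 'cV[R[i]]_T).
Implicit Types (Z : set R -> Omega -> 'cV[R[i]]_T) (F H : R -> 'M[R[i]]_T).

Definition cE X : R[i] := cintegral P setT X.

Definition msq X : \bar R := (\int[P]_w (nsq (X w))%:E)%E.

Definition L2rv : set (Omega -> R[i]) :=
  [set X | [/\ cmeasurable setT X, (msq X < +oo)%E & cE X = 0]].

Definition rv_inner X Y : R[i] := cE (fun w => X w * Num.conj (Y w)).

Definition ms_cvg (Xn : nat -> Omega -> R[i]) X : Prop :=
  (fun n => msq (fun w => Xn n w - X w)) @ \oo --> 0%E.

Definition comp V (k : 'I_T) : Omega -> R[i] := fun w => V w k 0.

(* E V W^* *)
Definition cov_mx V W : 'M[R[i]]_T :=
  \matrix_(k, l) rv_inner (comp V k) (comp W l).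

Definition stationary_with_density xi F : Prop :=
  (forall j k, L2rv (comp (xi j) k)) /\
  forall j n, cov_mx (xi (j + n)) (xi j) =
              mean_mx (fun t => cis (n%:~R * t) *: F t).

Definition uncorrelated xi eta : Prop :=
  forall j n, cov_mx (xi j) (eta n) = 0.

(* Orthogonal stochastic measure on the Borel subsets of [-pi, pi] with
   structure matrix F(t) dt / (2 pi). *)
Definition orthogonal_stochastic_measure Z F : Prop :=
  [/\ forall A k, measurable A -> A `<=` circ -> L2rv (comp (Z A) k),
      forall A : nat -> set R, (forall i, measurable (A i)) ->
        (forall i, A i `<=` circ) -> trivIset setT A ->
        forall k, ms_cvg (fun n w => \sum_(i < n) comp (Z (A i)) k w)
                         (comp (Z (\bigcup_i A i)) k)
    & forall A B, measurable A -> measurable B -> A `<=` circ -> B `<=` circ ->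
        cov_mx (Z A) (Z B) = mean_mx (fun t => (\1_(A `&` B) t)%:C *: F t)].

Definition simple_fun (p : seq (set R * 'cV[R[i]]_T)) : R -> 'cV[R[i]]_T :=
  fun t => \sum_(q <- p) (\1_(q.1) t)%:C *: q.2.

Definition simple_int Z (p : seq (set R * 'cV[R[i]]_T)) : Omega -> R[i] :=
  fun w => \sum_(q <- p) ((q.2)^T *m Z q.1 w) 0 0.

(* X = int_{-pi}^{pi} h(t)^T Z(dt) for h in L2(H): X is the mean square limit of
   integrals of simple functions converging to h in L2(H), where H dt / (2 pi)
   is the structure matrix of Z; X is thereby determined almost surely. *)
Definition is_stochastic_integral Z H (h : R -> 'cV[R[i]]_T) X : Prop :=
  [/\ L2w H h, L2rv X
    & exists p : nat -> seq (set R * 'cV[R[i]]_T),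
      [/\ forall n i, (i < size (p n))%N ->
            measurable (nth (set0, 0) (p n) i).1 /\
            (nth (set0, 0) (p n) i).1 `<=` circ,
          (fun n => wnorm H (fun t => simple_fun (p n) t - h t)) @ \oo --> 0%E
        & ms_cvg (fun n => simple_int Z (p n)) X]].

Definition spectral_representation xi Z F : Prop :=
  orthogonal_stochastic_measure Z F /\
  forall j k, is_stochastic_integral Z F (char_fun j k) (comp (xi j) k).

Definition obs_span (zeta : int -> Omega -> 'cV[R[i]]_T) (D : set int)
    : set (Omega -> R[i]^o) :=
  closed_span (L2rv : set (Omega -> R[i]^o)) msq
    [set X | exists j k, D j /\ X = comp (zeta j) k].

Definition is_projection (L : set (Omega -> R[i]^o)) X Xhat : Prop :=
  L Xhat /\ forall Y, L Y -> rv_inner (fun w => X w - Xhat w) Y = 0.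

Definition is_functional (D : set int) (a : int -> 'cV[R[i]]_T) xi X : Prop :=
  L2rv X /\
  ms_cvg (fun n w => psum D (fun j => ((a j)^T *m xi (- j) w) 0 0) n) X.

Definition is_spectral_characteristic H (D : set int) Zxi Zeta
    (h : R -> 'cV[R[i]]_T) Xhat : Prop :=
  L2w_sub H D h /\
  is_stochastic_integral (fun A w => Zxi A w + Zeta A w) H h Xhat.

End RandomVectors.

Section Formulas.
Context {R : realType} {T : nat}.
Implicit Types (F G : R -> 'M[R[i]]_T) (a : int -> 'cV[R[i]]_T).

Definition Bblock F G (k j : int) : 'M[R[i]]_T :=
  mean_mx (fun t => cis (- ((k - j)%:~R * t)) *: (invmx (F t + G t))^T).

Definition Rblock F G (k j : int) : 'M[R[i]]_T :=
  mean_mx (fun t =>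
    cis (- ((k + j)%:~R * t)) *: (F t *m invmx (F t + G t))^T).

Definition Qblock F G (k j : int) : 'M[R[i]]_T :=
  mean_mx (fun t =>
    cis ((k - j)%:~R * t) *: (F t *m invmx (F t + G t) *m G t)^T).

Definition ext0 (D : set int) a : int -> 'cV[R[i]]_T :=
  fun k => if k \in D then a k else 0.

(* A(e^{it}) *)
Definition Afun (D : set int) a (t : R) : 'cV[R[i]]_T :=
  \col_k csum D (fun j => a j k 0 * cis (- (j%:~R * t))).

Definition hT F G (A C : R -> 'cV[R[i]]_T) (t : R) : 'rV[R[i]]_T :=
  (A t)^T *m F t *m invmx (F t + G t) - (C t)^T *m invmx (F t + G t).

Definition rF F G (A C : R -> 'cV[R[i]]_T) (t : R) : 'cV[R[i]]_T :=
  (((A t)^T *m F t - (C t)^T) *m invmx (F t + G t))^T.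

Definition rG F G (A C : R -> 'cV[R[i]]_T) (t : R) : 'cV[R[i]]_T :=
  (((A t)^T *m G t + (C t)^T) *m invmx (F t + G t))^T.

End Formulas.

(* Main.v *)
(** Write H = F + G and P = H^-1. The spectral representations turn the error
    E|A xi - sum_q c_q (xi + eta)_q|^2 of a finite linear estimate into
    |A - e|_F^2 + |e|_G^2, where e is the trigonometric polynomial with the same
    coefficients, whose frequencies are the observed points. The function h0 with
    h0^T = (A^T F - C^T) P satisfies <h0, g>_H = <A, g>_F - <C, g>_1, and the
    equation B c = R a for the coefficients c of C says that the Fourier
    coefficients of h0 at the unobserved frequencies vanish. Hence C is orthogonal
    to h0 - e and the error equals e0 + |h0 - e|_H^2 with e0 independent of e;
    letting e tend to h0 identifies e0 as the mean square error and h0 as the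
    spectral characteristic.

    That h0 is a limit of such e in L2(H) needs H and P to be essentially bounded.
    This comes from B being defined and onto on all of l2(U): since U contains the
    nonnegative integers, trigonometric polynomials shifted far to the right have
    frequencies in U and become almost orthogonal for P, and a gliding hump shows
    that |.|_P and |.|_1 are equivalent on trigonometric polynomials. These being
    dense in every weighted space, test functions supported on small sets give the
    pointwise bounds. *)

From HB Require Import structures.
Require Import Defs.
From mathcomp Require Import ring lra zify measurable_realfun.

Set Implicit Arguments.
Unset Strict Implicit.
Unset Printing Implicit Defensive.

Import Order.TTheory GRing.Theory Num.Theory.
Import numFieldNormedType.Exports.
Import ComplexField.Normc.

Local Open Scope classical_set_scope.
Local Open Scope ring_scope.
Local Open Scope complex_scope.

(** All seminorms here may be degenerate, and neither completeness nor the existence of a projection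
    is ever used. The estimate is given; the argument only compares squared distances to finite
    combinations with observed frequencies. A family that comes arbitrarily close both to h0 and to
    the estimate, with distances on the two sides differing by a constant, determines the error and
    the characteristic.

    The k-th Fourier coefficient of h0 is <A, P^T e_k>_F - <C, e_k>_P = (R a)(k) - (B c)(k), which
    is how B c = R a enters. A has frequency -j at the coefficient a(j); this reflection turns
    Toeplitz matrices into the entries with k + j of R.

    The two essential bounds have different tasks. Boundedness of P puts C in L2(P) and gives 1 <= K
    H, so that elements of L2(H) have Fourier coefficients. Boundedness of H turns approximation in
    L2 by observed frequencies into approximation in L2(H). The first bound needs only that B is
    defined on all of l2(U); the second also needs that B is onto. *)

Local Notation Re := complex.Re.
Local Notation Im := complex.Im.

(** * Complex scalars and real null sequences *)

Section ComplexScalars.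
Context {R : realType}.
Implicit Types x y z : R[i].

Lemma conjE x : Num.conj x = conjc x. Proof. by []. Qed.

Lemma complex_eqP x y : Re x = Re y -> Im x = Im y -> x = y.
Proof. by case: x y => a b [c d] /= -> ->. Qed.

Lemma cReD x y : Re (x + y) = Re x + Re y.
Proof. by case: x y => a b []. Qed.
Lemma cImD x y : Im (x + y) = Im x + Im y.
Proof. by case: x y => a b []. Qed.
Lemma cReN x : Re (- x) = - Re x. Proof. by case: x. Qed.
Lemma cImN x : Im (- x) = - Im x. Proof. by case: x. Qed.
Lemma cReB x y : Re (x - y) = Re x - Re y.
Proof. by rewrite cReD cReN. Qed.
Lemma cImB x y : Im (x - y) = Im x - Im y.
Proof. by rewrite cImD cImN. Qed.
Lemma cReM x y : Re (x * y) =
  Re x * Re y - Im x * Im y.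
Proof. by case: x y => a b []. Qed.
Lemma cImM x y : Im (x * y) =
  Re x * Im y + Im x * Re y.
Proof. by case: x y => a b []. Qed.
Lemma cReJ x : Re (Num.conj x) = Re x. Proof. by case: x. Qed.
Lemma cImJ x : Im (Num.conj x) = - Im x. Proof. by case: x. Qed.
Lemma cRe_sum I (r : seq I) Q (f : I -> R[i]) :
  Re (\sum_(i <- r | Q i) f i) = \sum_(i <- r | Q i) Re (f i).
Proof. by apply: (big_morph _ cReD). Qed.
Lemma cIm_sum I (r : seq I) Q (f : I -> R[i]) :
  Im (\sum_(i <- r | Q i) f i) = \sum_(i <- r | Q i) Im (f i).
Proof. by apply: (big_morph _ cImD). Qed.

Lemma conjD x y : Num.conj (x + y) = Num.conj x + Num.conj y.
Proof. exact: rmorphD. Qed.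
Lemma conjN x : Num.conj (- x) = - Num.conj x. Proof. exact: rmorphN. Qed.
Lemma conjB x y : Num.conj (x - y) = Num.conj x - Num.conj y.
Proof. exact: rmorphB. Qed.
Lemma conjM x y : Num.conj (x * y) = Num.conj x * Num.conj y.
Proof. exact: rmorphM. Qed.
Lemma conj0 : Num.conj (0 : R[i]) = 0. Proof. exact: rmorph0. Qed.
Lemma conj1 : Num.conj (1 : R[i]) = 1. Proof. exact: rmorph1. Qed.
Lemma conjKc x : Num.conj (Num.conj x) = x. Proof. exact: conjCK. Qed.
Lemma conjR (r : R) : Num.conj r%:C = r%:C. Proof. by rewrite conjE conjc_real. Qed.
Lemma conj_sum I (r : seq I) (Q : pred I) (f : I -> R[i]) :
  Num.conj (\sum_(i <- r | Q i) f i) = \sum_(i <- r | Q i) Num.conj (f i).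
Proof. exact: rmorph_sum. Qed.

Definition ReImE := (cReB, cImB, cReD, cImD, cReN, cImN, cReM, cImM, cReJ, cImJ).

Lemma nsqE x : nsq x = Re x ^+ 2 + Im x ^+ 2.
Proof. by case: x => a b; rewrite /nsq /= sqr_sqrtr ?addr_ge0 ?sqr_ge0. Qed.

Lemma nsq_ge0 x : 0 <= nsq x. Proof. exact: sqr_ge0. Qed.
Lemma nsqM x y : nsq (x * y) = nsq x * nsq y.
Proof. by rewrite /nsq normcM exprMn. Qed.
Lemma nsqJ x : nsq (Num.conj x) = nsq x.
Proof. by rewrite !nsqE !ReImE; ring. Qed.
Lemma nsqN x : nsq (- x) = nsq x.
Proof. by rewrite !nsqE !ReImE; ring. Qed.
Lemma nsq0 : nsq (0 : R[i]) = 0. Proof. by rewrite nsqE /= expr0n addr0. Qed.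
Lemma nsq_eq0 x : nsq x = 0 -> x = 0.
Proof. by move/eqP; rewrite sqrf_eq0 => /eqP /eq0_normc. Qed.
Lemma nsqD_le x y : nsq (x + y) <= 2 * nsq x + 2 * nsq y.
Proof.
rewrite -subr_ge0 (_ : _ - _ = nsq (x - y)) ?nsq_ge0//.
by rewrite !nsqE !ReImE; ring.
Qed.
Lemma Re_sqr_le x : Re x ^+ 2 <= nsq x.
Proof. by rewrite nsqE lerDl sqr_ge0. Qed.
Lemma Im_sqr_le x : Im x ^+ 2 <= nsq x.
Proof. by rewrite nsqE lerDr sqr_ge0. Qed.
Lemma normc_ge0 x : 0 <= normc x. Proof. by case: x => a b; exact: sqrtr_ge0. Qed.
Lemma Re_le_normc x : `|Re x| <= normc x.
Proof.
rewrite -(ler_pXn2r (n:=2)) ?nnegrE ?normc_ge0//.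
by rewrite real_normK ?num_real// Re_sqr_le.
Qed.
Lemma Im_le_normc x : `|Im x| <= normc x.
Proof.
rewrite -(ler_pXn2r (n:=2)) ?nnegrE ?normc_ge0//.
by rewrite real_normK ?num_real// Im_sqr_le.
Qed.
Lemma ge0_complexP x : 0 <= x -> x = (Re x)%:C /\ 0 <= Re x.
Proof. by case: x => a b; rewrite lecE /= => /andP[/eqP -> ->]. Qed.
Lemma ge0_Re x : 0 <= x -> 0 <= Re x.
Proof. by case/ge0_complexP. Qed.
Lemma conj_mulE x : Num.conj x * x = (nsq x)%:C.
Proof. by apply: complex_eqP; rewrite !ReImE ?nsqE /=; ring. Qed.
Lemma mul_conjE x : x * Num.conj x = (nsq x)%:C.
Proof. by rewrite mulrC conj_mulE. Qed.
Lemma cReZ (r : R) x : Re (r%:C * x) = r * Re x.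
Proof. by rewrite cReM /=; ring. Qed.
Lemma cImZ (r : R) x : Im (r%:C * x) = r * Im x.
Proof. by rewrite cImM /=; ring. Qed.
Lemma nsqZ (r : R) : nsq r%:C = r ^+ 2.
Proof. by rewrite nsqE /= expr0n addr0. Qed.

End ComplexScalars.

Section RealSequences.
Context {R : realType}.
Implicit Types u v : nat -> R.

Lemma cvg0P u : u @ \oo --> (0 : R) <->
  forall e : R, 0 < e -> exists n0, forall n, (n0 <= n)%N -> `|u n| < e.
Proof.
rewrite cvgr0Pnorm_lt; split => h e e0.
  by have [n0 _ hn] := h e e0; exists n0 => n /hn.
by have [n0 hn] := h e e0; exists n0 => // n /= /hn.
Qed.

Lemma cvg0_le u v : (forall n, 0 <= u n <= v n) -> v @ \oo --> (0 : R) ->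
  u @ \oo --> (0 : R).
Proof.
move=> h /cvg0P v0; apply/cvg0P => e /v0[n0 hn]; exists n0 => n /hn.
have /andP[u_ge0 uv] := h n; rewrite !ger0_norm//; last exact: le_trans uv.
exact: le_lt_trans.
Qed.

End RealSequences.

(* A possibly degenerate inner product on the subspace L of V. *)
Record prehilbert (R : realType) (V : lmodType R[i]) (L : set V)
    (ip : V -> V -> R[i]) : Prop := Prehilbert {
  ph_lin : forall c x y, L x -> L y -> L (c *: x + y);
  ph_ipl : forall c x y z, L x -> L y -> L z ->
    ip (c *: x + y) z = c * ip x z + ip y z;
  ph_ipC : forall x y, L x -> L y -> ip x y = Num.conj (ip y x);
  ph_ge0 : forall x, L x -> 0 <= ip x x }.

(** * Degenerate inner product spaces *)

Section Prehilbert.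
Context {R : realType} {V : lmodType R[i]} {L : set V} {ip : V -> V -> R[i]}.
Hypothesis ph : prehilbert L ip.
Implicit Types (x y z : V) (c : R[i]).

(** Squared seminorms are kept throughout; the triangle inequality is replaced by [n2D_le], at the
    price of a factor 2. *)
Definition n2 (ip : V -> V -> R[i]) x : R := Re (ip x x).
Local Notation N := (n2 ip).

Lemma phD x y : L x -> L y -> L (x + y).
Proof. by move=> Lx Ly; rewrite -[x]scale1r; exact: (ph_lin ph). Qed.
Lemma ph0 x : L x -> L 0.
Proof. by move=> Lx; rewrite -(addNr x) -scaleN1r; exact: (ph_lin ph). Qed.
Lemma phZ c x : L x -> L (c *: x).
Proof. by move=> Lx; rewrite -[_ *: _]addr0; apply: (ph_lin ph) => //; exact: ph0 Lx. Qed.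
Lemma phN x : L x -> L (- x).
Proof. by rewrite -scaleN1r; exact: phZ. Qed.
Lemma phB x y : L x -> L y -> L (x - y).
Proof. by move=> Lx Ly; apply: phD => //; exact: phN. Qed.
Lemma ph_sum I (r : seq I) (Q : pred I) (f : I -> V) : L 0 ->
  (forall i, Q i -> L (f i)) -> L (\sum_(i <- r | Q i) f i).
Proof. by move=> L0 Lf; elim/big_ind : _ => // x y; exact: phD. Qed.

Lemma ipDl x y z : L x -> L y -> L z -> ip (x + y) z = ip x z + ip y z.
Proof.
by move=> Lx Ly Lz; rewrite -[in LHS](scale1r x) (ph_ipl ph) // mul1r.
Qed.
Lemma ip0l z : L z -> ip 0 z = 0.
Proof.
by move=> Lz; apply: (addrI (ip 0 z)); rewrite addr0 -ipDl ?addr0//; exact: ph0 Lz.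
Qed.
Lemma ipZl c x z : L x -> L z -> ip (c *: x) z = c * ip x z.
Proof.
move=> Lx Lz; rewrite -[_ *: _]addr0 (ph_ipl ph) ?ip0l ?addr0//.
exact: ph0 Lz.
Qed.
Lemma ipNl x z : L x -> L z -> ip (- x) z = - ip x z.
Proof. by move=> Lx Lz; rewrite -scaleN1r ipZl // mulN1r. Qed.
Lemma ipBl x y z : L x -> L y -> L z -> ip (x - y) z = ip x z - ip y z.
Proof. by move=> Lx Ly Lz; rewrite ipDl ?ipNl//; exact: phN. Qed.
Lemma ip_suml I (r : seq I) (Q : pred I) (f : I -> V) z : L z -> (forall i, Q i -> L (f i)) ->
  ip (\sum_(i <- r | Q i) f i) z = \sum_(i <- r | Q i) ip (f i) z.
Proof.
move=> Lz Lf; elim: r => [|i r ih]; first by rewrite !big_nil ip0l.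
rewrite !big_cons; case: ifP => // Qi.
rewrite ipDl ?ih//; first exact: Lf.
by apply: ph_sum => //; exact: ph0 Lz.
Qed.
Lemma ipDr x y z : L x -> L y -> L z -> ip z (x + y) = ip z x + ip z y.
Proof.
move=> Lx Ly Lz; rewrite (ph_ipC ph) ?ipDl//; last exact: phD.
by rewrite conjD -!(ph_ipC ph).
Qed.
Lemma ipZr c x z : L x -> L z -> ip z (c *: x) = Num.conj c * ip z x.
Proof.
move=> Lx Lz; rewrite (ph_ipC ph) ?ipZl//; last exact: phZ.
by rewrite conjM -(ph_ipC ph).
Qed.
Lemma ipNr x z : L x -> L z -> ip z (- x) = - ip z x.
Proof. by move=> Lx Lz; rewrite -scaleN1r ipZr// conjN conj1 mulN1r. Qed.
Lemma ipBr x y z : L x -> L y -> L z -> ip z (x - y) = ip z x - ip z y.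
Proof. by move=> Lx Ly Lz; rewrite ipDr ?ipNr//; exact: phN. Qed.
Lemma ip0r z : L z -> ip z 0 = 0.
Proof. by move=> Lz; rewrite (ph_ipC ph) ?ip0l ?conj0//; exact: ph0 Lz. Qed.
Lemma ip_sumr I (r : seq I) (Q : pred I) (f : I -> V) z : L z -> (forall i, Q i -> L (f i)) ->
  ip z (\sum_(i <- r | Q i) f i) = \sum_(i <- r | Q i) ip z (f i).
Proof.
move=> Lz Lf; rewrite (ph_ipC ph) ?ip_suml ?conj_sum//.
  by apply: eq_bigr => i Qi; rewrite -(ph_ipC ph)//; exact: Lf.
by apply: ph_sum => //; exact: ph0 Lz.
Qed.

Lemma n2_ge0 x : L x -> 0 <= N x.
Proof. by move=> /(ph_ge0 ph); exact: ge0_Re. Qed.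
Lemma n2E x : L x -> ip x x = (N x)%:C.
Proof. by move=> /(ph_ge0 ph) /ge0_complexP[]. Qed.
Lemma Re_ipC x y : L x -> L y -> Re (ip x y) = Re (ip y x).
Proof. by move=> Lx Ly; rewrite (ph_ipC ph)// cReJ. Qed.
Lemma n2D x y : L x -> L y ->
  N (x + y) = N x + 2 * Re (ip x y) + N y.
Proof.
move=> Lx Ly; rewrite /n2 ipDl ?ipDr//; last exact: phD.
rewrite !cReD (Re_ipC Ly Lx); ring.
Qed.
Lemma n2N x : L x -> N (- x) = N x.
Proof. by move=> Lx; rewrite /n2 ipNl ?ipNr ?opprK//; exact: phN. Qed.
Lemma n2B x y : L x -> L y ->
  N (x - y) = N x - 2 * Re (ip x y) + N y.
Proof.
by move=> Lx Ly; rewrite n2D ?n2N ?ipNr ?cReN ?mulrN//; exact: phN.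
Qed.
Lemma n2Z c x : L x -> N (c *: x) = nsq c * N x.
Proof.
move=> Lx; rewrite /n2 ipZl ?ipZr//; last exact: phZ.
by rewrite mulrA mul_conjE cReZ.
Qed.
Lemma n2_0 x : L x -> N 0 = 0.
Proof. by move=> Lx; rewrite /n2 ip0l//; exact: ph0 Lx. Qed.
Lemma n2C x y : L x -> L y -> N (x - y) = N (y - x).
Proof. by move=> Lx Ly; rewrite -opprB n2N//; exact: phB. Qed.

Lemma ip_CS x y : L x -> L y -> nsq (ip x y) <= N x * N y.
Proof.
move=> Lx Ly.
have key c : 0 <= N x - 2 * Re (Num.conj c * ip x y) + nsq c * N y.
  rewrite -n2Z// -ipZr// -n2B//; last exact: phZ.
  by apply: n2_ge0; apply: phB => //; exact: phZ.
(* The form may be degenerate. If y is null but not orthogonal to x, the multiple below would give x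
   - c y the squared norm -1. *)
have [y0|y0] := eqVneq (N y) 0.
  rewrite y0 mulr0 leNgt; apply/negP => i0.
  have := key (((N x + 1) / (2 * nsq (ip x y)))%:C * ip x y).
  rewrite y0 mulr0 addr0 conjM -mulrA conj_mulE.
  rewrite conjR cReZ /= (_ : N x - _ = -1); last by field; rewrite gt_eqF.
  by move=> ?; lra.
have y_gt0 : 0 < N y by rewrite lt_neqAle eq_sym y0 n2_ge0.
(* The coefficient of the orthogonal projection of x on y. *)
have := key (((N y)^-1)%:C * ip x y).
rewrite conjM -mulrA conj_mulE.
rewrite conjR cReZ /= nsqM nsqZ => h.
rewrite -subr_ge0 (_ : _ - _ = N y * (N x - 2 * ((N y)^-1 * nsq (ip x y)) + (N y)^-1 ^+ 2 * nsq (ip x y) * N y)).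
  by rewrite mulr_ge0// ltW.
by field.
Qed.

(** Weaker than Cauchy-Schwarz but additive: applied pointwise, it yields an integrable majorant for
    a product of two square integrable functions. *)
Lemma normc_ip_le x y : L x -> L y -> normc (ip x y) <= N x + N y.
Proof.
move=> Lx Ly; rewrite -(ler_pXn2r (n:=2)) ?nnegrE ?normc_ge0 ?addr_ge0 ?n2_ge0//.
apply: (le_trans (ip_CS Lx Ly)); have := n2_ge0 Lx; have := n2_ge0 Ly.
move: (N x) (N y) => a b b0 a0; rewrite sqrrD -subr_ge0.
have -> : a ^+ 2 + a * b *+ 2 + b ^+ 2 - a * b = a ^+ 2 + a * b + b ^+ 2 by ring.
by rewrite !addr_ge0// ?sqr_ge0// mulr_ge0.
Qed.

Lemma n2D_le x y : L x -> L y -> N (x + y) <= 2 * N x + 2 * N y.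
Proof.
move=> Lx Ly; rewrite -subr_ge0 (_ : _ - _ = N (x - y)) ?n2_ge0//; first exact: phB.
by rewrite n2D// n2B//; ring.
Qed.
Lemma n2B_le3 x y z : L x -> L y -> L z ->
  N (x - z) <= 2 * N (x - y) + 2 * N (y - z).
Proof.
move=> Lx Ly Lz; have -> : x - z = (x - y) + (y - z) by rewrite addrA subrK.
by apply: n2D_le; exact: phB.
Qed.

Definition ncvg (ip : V -> V -> R[i]) (u : nat -> V) x :=
  (fun n => n2 ip (u n - x)) @ \oo --> (0 : R).

(** Complex convergence is stated through squared moduli, so that Cauchy-Schwarz in the form [ip_CS]
    applies directly. *)
Definition ccvg (u : nat -> R[i]) (l : R[i]) :=
  (fun n => nsq (u n - l)) @ \oo --> (0 : R).

Lemma ncvg_ip u x y : L x -> L y -> (forall n, L (u n)) -> ncvg ip u x ->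
  ccvg (fun n => ip (u n) y) (ip x y).
Proof.
move=> Lx Ly Lu ux; apply: (@cvg0_le _ _ (fun n => n2 ip (u n - x) * N y)).
  by move=> n; rewrite nsq_ge0 -ipBl// ip_CS//; exact: phB.
by rewrite -(mul0r (N y)); apply: cvgM => //; exact: cvg_cst.
Qed.

Lemma ncvg_n2 u x : L x -> (forall n, L (u n)) -> ncvg ip u x ->
  (fun n => N (u n)) @ \oo --> N x.
Proof.
move=> Lx Lu ux.
(* Expanding N (u n - x) gives N (u n) = N (u n - x) + 2 v n + N x, and v tends to 0 by
   [ncvg_ip]. *)
pose v n : R := Re (ip (u n) x) - Re (ip x x).
have E : (fun n => N (u n)) = (fun n => N (u n - x) + 2 * v n + N x).
  by apply/funext => n; rewrite n2B// /v /n2; ring.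
rewrite E.
suff h1 : v @ \oo --> (0 : R).
  have := cvgD (cvgD ux (cvgM (cvg_cst (2 : R)) h1)) (cvg_cst (N x)).
  by rewrite mulr0 !add0r; exact.
have /cvg0P h0 := ncvg_ip Lx Lx Lu ux.
apply/cvg0P => e e0; have [n0 hn] := h0 _ (exprn_gt0 2 e0); exists n0 => n /hn.
rewrite ger0_norm ?nsq_ge0// => h.
rewrite -(ltr_pXn2r (n:=2)) ?nnegrE// ?ltW// real_normK ?num_real// /v -cReB.
exact: le_lt_trans (Re_sqr_le _) h.
Qed.

End Prehilbert.

(** * Complex-valued integrals *)

Section ComplexIntegration.
Context {d : measure_display} {X : measurableType d} {R : realType}.
Variables (m : {measure set X -> \bar R}) (D : set X).
Hypothesis mD : measurable D.
Implicit Types (f g : X -> R[i]) (h : X -> R) (c : R[i]).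

Lemma cmeasurable_cst c : cmeasurable D (fun=> c : R[i]).
Proof. by split; exact: measurable_cst. Qed.
Lemma cmeasurableD f g : cmeasurable D f -> cmeasurable D g ->
  cmeasurable D (fun x => f x + g x).
Proof.
by move=> [f1 f2] [g1 g2]; split; under eq_fun do rewrite ReImE;
  exact: measurable_funD.
Qed.
Lemma cmeasurableM f g : cmeasurable D f -> cmeasurable D g ->
  cmeasurable D (fun x => f x * g x).
Proof.
move=> [f1 f2] [g1 g2]; split; under eq_fun do rewrite ReImE.
  by apply: measurable_funB; exact: measurable_funM.
by apply: measurable_funD; exact: measurable_funM.
Qed.
Lemma cmeasurableJ f : cmeasurable D f -> cmeasurable D (fun x => Num.conj (f x)).
Proof.
move=> [f1 f2]; split; first by under eq_fun do rewrite cReJ.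
by under eq_fun do rewrite cImJ; exact: measurable_funN f2.
Qed.
Lemma cmeasurable_sum I (r : seq I) (f : I -> X -> R[i]) :
  (forall i, cmeasurable D (f i)) -> cmeasurable D (fun x => \sum_(i <- r) f i x).
Proof.
move=> mf; elim: r => [|i r ih].
  by under eq_fun do rewrite big_nil; exact: cmeasurable_cst.
by under eq_fun do rewrite big_cons; exact: cmeasurableD.
Qed.
Lemma cmeasurable_real h : measurable_fun D h -> cmeasurable D (fun x => (h x)%:C).
Proof. by move=> mh; split => //=; exact: measurable_cst. Qed.
Lemma measurable_nsq f : cmeasurable D f -> measurable_fun D (fun x => nsq (f x)).
Proof.
move=> [f1 f2]; under eq_fun do rewrite nsqE.
by apply: measurable_funD; exact: measurable_funX.
Qed.
Lemma eq_cmeasurable f g : (forall x, D x -> f x = g x) -> cmeasurable D f ->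
  cmeasurable D g.
Proof.
by move=> fg [f1 f2]; split; [apply: eq_measurable_fun f1|apply: eq_measurable_fun f2];
  move=> x /set_mem /fg ->.
Qed.

Lemma cintegrable_meas f : cintegrable m D f -> cmeasurable D f.
Proof.
by move=> [/integrableP[f1 _] /integrableP[f2 _]]; split; exact/measurable_EFinP.
Qed.

Lemma cintegrable_le f h : cmeasurable D f ->
  (forall x, D x -> normc (f x) <= h x) -> m.-integrable D (EFin \o h) ->
  cintegrable m D f.
Proof.
move=> [f1 f2] fh ih; split; apply: le_integrable ih => //.
- exact/measurable_EFinP.
- move=> x Dx; rewrite /= lee_fin; apply: (le_trans (Re_le_normc _)).
  by apply: (le_trans (fh _ Dx)); exact: ler_norm.
- exact/measurable_EFinP.
- move=> x Dx; rewrite /= lee_fin; apply: (le_trans (Im_le_normc _)).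
  by apply: (le_trans (fh _ Dx)); exact: ler_norm.
Qed.

Lemma integrable_real_lin (a b : R) (f1 f2 : X -> R) :
  m.-integrable D (EFin \o f1) -> m.-integrable D (EFin \o f2) ->
  m.-integrable D (EFin \o (fun x => a * f1 x + b * f2 x)).
Proof.
move=> i1 i2; have := integrableD mD (integrableZl mD a i1) (integrableZl mD b i2).
by apply: eq_integrable => // x _; rewrite /= EFinD !EFinM.
Qed.

Lemma Rintegral_lin (a b : R) (f1 f2 : X -> R) :
  m.-integrable D (EFin \o f1) -> m.-integrable D (EFin \o f2) ->
  Rintegral m D (fun x => a * f1 x + b * f2 x) =
  a * Rintegral m D f1 + b * Rintegral m D f2.
Proof.
move=> i1 i2; rewrite RintegralD ?RintegralZl//.
- by have := integrableZl mD a i1; apply: eq_integrable.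
- by have := integrableZl mD b i2; apply: eq_integrable.
Qed.

Lemma cintegrableD f g : cintegrable m D f -> cintegrable m D g ->
  cintegrable m D (fun x => f x + g x).
Proof.
move=> [f1 f2] [g1 g2]; split.
  have := integrableD mD f1 g1.
  by apply: eq_integrable => // x _; rewrite cReD.
have := integrableD mD f2 g2.
by apply: eq_integrable => // x _; rewrite cImD.
Qed.

Lemma cintegrableZ c f : cintegrable m D f -> cintegrable m D (fun x => c * f x).
Proof.
move=> [f1 f2]; split.
  have := integrable_real_lin (Re c) (- Im c) f1 f2.
  by apply: eq_integrable => // x _; congr EFin; rewrite cReM mulNr.
have := integrable_real_lin (Re c) (Im c) f2 f1.
by apply: eq_integrable => // x _; congr EFin; rewrite cImM.
Qed.

Lemma cintegralD f g : cintegrable m D f -> cintegrable m D g ->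
  cintegral m D (fun x => f x + g x) = cintegral m D f + cintegral m D g.
Proof.
move=> [f1 f2] [g1 g2]; apply: complex_eqP; rewrite ReImE /=.
  by rewrite -RintegralD//; apply: eq_Rintegral => x _; rewrite cReD.
by rewrite -RintegralD//; apply: eq_Rintegral => x _; rewrite cImD.
Qed.

Lemma cintegralZ c f : cintegrable m D f ->
  cintegral m D (fun x => c * f x) = c * cintegral m D f.
Proof.
move=> [f1 f2]; apply: complex_eqP; rewrite ReImE /=.
  by rewrite -mulNr -Rintegral_lin//; apply: eq_Rintegral => x _; rewrite cReM mulNr.
by rewrite -Rintegral_lin//; apply: eq_Rintegral => x _; rewrite cImM.
Qed.

Lemma cintegralJ f : cintegrable m D f ->
  cintegral m D (fun x => Num.conj (f x)) = Num.conj (cintegral m D f).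
Proof.
move=> [f1 f2]; apply: complex_eqP; rewrite ReImE /=.
  by apply: eq_Rintegral => x _; rewrite cReJ.
rewrite -mulN1r -RintegralZl//; apply: eq_Rintegral => x _.
by rewrite cImJ mulN1r.
Qed.

Lemma eq_cintegral f g : (forall x, D x -> f x = g x) ->
  cintegral m D f = cintegral m D g.
Proof.
by move=> fg; apply: complex_eqP; apply: eq_Rintegral => x /set_mem /fg ->.
Qed.

Lemma eq_cintegrable f g : (forall x, D x -> f x = g x) ->
  cintegrable m D f -> cintegrable m D g.
Proof.
move=> fg [f1 f2]; split; [apply: eq_integrable f1|apply: eq_integrable f2] => // x;
by move=> /set_mem /fg ->.
Qed.

Lemma ae_eq_cintegral f g : cmeasurable D f -> cmeasurable D g ->
  {ae m, forall x, D x -> f x = g x} -> cintegral m D f = cintegral m D g.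
Proof.
move=> [f1 f2] [g1 g2] fg; apply: complex_eqP; rewrite /= /Rintegral; congr fine;
  apply: ae_eq_integral => //; try exact/measurable_EFinP;
  by apply: filterS fg => x fg Dx; rewrite fg.
Qed.

Lemma cintegral_ge0 f : (forall x, D x -> 0 <= f x) -> 0 <= cintegral m D f.
Proof.
move=> f0; rewrite lecE /=; apply/andP; split.
  rewrite (@eq_Rintegral _ _ _ _ _ (cst 0)); last first.
    by move=> x /set_mem /f0 /ge0_complexP[-> _].
  by rewrite Rintegral_cst// mul0r.
by apply: Rintegral_ge0 => x /f0 /ge0_Re.
Qed.

End ComplexIntegration.

(** * Sesquilinear forms of nonnegative Hermitian matrices *)

Section BilinearForm.
Context {R : realType} {T : nat}.
Implicit Types (x y : 'cV[R[i]]_T) (W : 'M[R[i]]_T).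

Definition bform W x y : R[i] := (x^T *m W *m conj_mx y) 0 0.

Lemma bformE W x y : bform W x y =
  \sum_l (\sum_k x k 0 * W k l) * Num.conj (y l 0).
Proof.
rewrite /bform mxE; apply: eq_bigr => l _; rewrite !mxE; congr (_ * _).
by apply: eq_bigr => k _; rewrite !mxE.
Qed.

Lemma conj_mxD m n (A B : 'M[R[i]]_(m, n)) :
  conj_mx (A + B) = conj_mx A + conj_mx B.
Proof. by apply/matrixP => i j; rewrite !mxE conjD. Qed.
Lemma conj_mxZ m n c (A : 'M[R[i]]_(m, n)) :
  conj_mx (c *: A) = Num.conj c *: conj_mx A.
Proof. by apply/matrixP => i j; rewrite !mxE conjM. Qed.
Lemma conj_mxM m n p (A : 'M[R[i]]_(m, n)) (B : 'M[R[i]]_(n, p)) :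
  conj_mx (A *m B) = conj_mx A *m conj_mx B.
Proof.
by apply/matrixP => i j; rewrite !mxE conj_sum; apply: eq_bigr => k _; rewrite !mxE conjM.
Qed.
Lemma conj_mxT m n (A : 'M[R[i]]_(m, n)) : conj_mx A^T = (conj_mx A)^T.
Proof. by apply/matrixP => i j; rewrite !mxE. Qed.
Lemma conj_mxK m n (A : 'M[R[i]]_(m, n)) : conj_mx (conj_mx A) = A.
Proof. by apply/matrixP => i j; rewrite !mxE conjKc. Qed.
Lemma conj_mx1 : conj_mx 1%:M = 1%:M :> 'M[R[i]]_T.
Proof.
by apply/matrixP => i j; rewrite !mxE; case: (i == j); rewrite ?mulr1n ?mulr0n ?conj1 ?conj0.
Qed.

Lemma bformlin W c x y z :
  bform W (c *: x + y) z = c * bform W x z + bform W y z.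
Proof.
by rewrite /bform linearD linearZ /= !mulmxDl -!scalemxAl !mxE.
Qed.

Lemma bformC W x y : (conj_mx W)^T = W -> bform W x y = Num.conj (bform W y x).
Proof.
move=> hW; rewrite /bform -[in LHS]hW.
have -> : x^T *m (conj_mx W)^T *m conj_mx y = ((conj_mx y)^T *m conj_mx W *m x)^T.
  by rewrite !trmx_mul trmxK mulmxA.
rewrite mxE; transitivity ((conj_mx (y^T *m W *m conj_mx x)) 0 0); last by rewrite mxE.
by rewrite !conj_mxM conj_mxK conj_mxT.
Qed.

Lemma ph_bform W : nonneg_hermitian W ->
  prehilbert [set: 'cV[R[i]]_T] (bform W).
Proof.
move=> [hW W0]; split=> // [c x y z _ _ _|x y _ _|x _]; first exact: bformlin.
  exact: bformC.
exact: W0.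
Qed.

Lemma bform_add W1 W2 x y : bform (W1 + W2) x y = bform W1 x y + bform W2 x y.
Proof. by rewrite /bform mulmxDr mulmxDl mxE. Qed.

Lemma normc_bform_le W x y : nonneg_hermitian W ->
  normc (bform W x y) <= Re (qform W x) + Re (qform W y).
Proof.
move=> hW; exact: (normc_ip_le (ph_bform hW) (I : setT x) (I : setT y)).
Qed.

Lemma qform_entry W x : qform W x = bform W x x. Proof. by []. Qed.

Lemma nonneg_hermitianD W1 W2 : nonneg_hermitian W1 -> nonneg_hermitian W2 ->
  nonneg_hermitian (W1 + W2).
Proof.
move=> [h1 p1] [h2 p2]; split; first by rewrite conj_mxD linearD /= h1 h2.
by move=> x; rewrite qform_entry bform_add; apply: addr_ge0; [exact: p1|exact: p2].
Qed.

Lemma nonneg_hermitian1 : nonneg_hermitian (1%:M : 'M[R[i]]_T).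
Proof.
split; first by rewrite conj_mx1 trmx1.
move=> x; rewrite /qform mulmx1 mxE sumr_ge0// => k _.
by rewrite !mxE mul_conjE ler0c nsq_ge0.
Qed.

Lemma bform1 x y : bform 1%:M x y = \sum_k x k 0 * Num.conj (y k 0).
Proof. by rewrite /bform mulmx1 mxE; apply: eq_bigr => k _; rewrite !mxE. Qed.

Lemma qform1 x : Re (qform 1%:M x) = \sum_k nsq (x k 0).
Proof.
rewrite qform_entry bform1 cRe_sum; apply: eq_bigr => k _.
by rewrite mul_conjE.
Qed.

Lemma nonneg_hermitian_inv W : nonneg_hermitian W -> nonneg_hermitian (invmx W).
Proof.
(* [invmx] returns a singular matrix unchanged, so that case is trivial. *)
move=> [hW pW]; have [uW|nW] := boolP (W \in unitmx); last first.
  by rewrite /invmx (negbTE nW).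
have hV : (conj_mx (invmx W))^T = invmx W.
  have h : (conj_mx (invmx W))^T *m W = 1%:M.
    by rewrite -[in X in _ *m X]hW -trmx_mul -conj_mxM mulmxV// conj_mx1 trmx1.
  by rewrite -[LHS]mulmx1 -(mulmxV uW) mulmxA h mul1mx.
split => // x.
(* The inverse is congruent to W: evaluating the form of W at this vector gives the form of the
   inverse at x. *)
have := pW ((invmx W)^T *m x); rewrite /qform trmx_mul trmxK conj_mxM conj_mxT hV.
by rewrite mulmxKV// mulmxA.
Qed.

End BilinearForm.

(* Locked, since unification would otherwise unfold Lebesgue integrals. *)
HB.lock Definition ipw (R : realType) (T : nat) (W : R -> 'M[R[i]]_T)
    (f g : R -> 'cV[R[i]]_T) : R[i] :=
  cmean (fun t => bform (W t) (f t) (g t)).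
Arguments ipw {R T}.

Lemma ipwE (R : realType) (T : nat) (W : R -> 'M[R[i]]_T) f g :
  ipw W f g = cmean (fun t => bform (W t) (f t) (g t)).
Proof. by rewrite ipw.unlock. Qed.

(** * The weighted spaces L2(W) of vector functions *)

Section WeightedSpace.
Context {R : realType} {T : nat}.
Implicit Types (f g h : R -> 'cV[R[i]]_T) (W : R -> 'M[R[i]]_T).
Local Notation leb := (@lebesgue_measure R).
Local Notation circ := (@circ R).

(* R carries two convertible Borel structures with different displays: the
   default one and the one on which Lebesgue measure is defined. *)
Lemma measurable_lebE (D : set R) :
  measurable D = measurable (D : set (measurableTypeR R)).
Proof. by []. Qed.
Lemma measurable_fun_lebE (D : set R) (f : R -> R) :
  measurable_fun D f = measurable_fun (D : set (measurableTypeR R)) f.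
Proof. by []. Qed.
Lemma cmeasurable_lebE (D : set R) (f : R -> R[i]) :
  cmeasurable D f = cmeasurable (D : set (measurableTypeR R)) f.
Proof. by []. Qed.

Lemma measurable_circ : measurable (circ : set (measurableTypeR R)).
Proof. exact: measurable_itv. Qed.
Hint Resolve measurable_circ : core.

(** Integrability of the entries is kept apart: the space L2(W) and its inner product exist without
    it, and it serves to place bounded functions in the space. *)
Definition weight W : Prop :=
  (forall k l, cmeasurable circ (fun t => W t k l)) /\
  (forall t, circ t -> nonneg_hermitian (W t)).

Lemma cmeasurable_bform W f g : (forall k l, cmeasurable circ (fun t => W t k l)) ->
  measurable_vec f -> measurable_vec g ->
  cmeasurable circ (fun t => bform (W t) (f t) (g t)).
Proof.
move=> mW mf mg; apply: eq_cmeasurable.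
  by move=> t _; rewrite bformE.
apply: cmeasurable_sum => // l; apply: cmeasurableM => //; last exact: cmeasurableJ.
by apply: cmeasurable_sum => // k; exact: cmeasurableM.
Qed.

Lemma measurable_vec_lin c f g : measurable_vec f -> measurable_vec g ->
  measurable_vec (c *: f + g).
Proof.
move=> mf mg k.
apply: (@eq_cmeasurable _ _ _ _ (fun t => c * f t k 0 + g t k 0)).
  by move=> t _; rewrite !mxE.
by apply: cmeasurableD => //; apply: cmeasurableM => //; exact: cmeasurable_cst.
Qed.

Lemma qform_Re_ge0 W t x : weight W -> circ t -> 0 <= Re (qform (W t) x).
Proof. by move=> [_ hW] ct; apply: ge0_Re; exact: (hW t ct).2. Qed.

Lemma qform_lin_le W t c x y : weight W -> circ t ->
  Re (qform (W t) (c *: x + y)) <=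
  2 * nsq c * Re (qform (W t) x) + 2 * Re (qform (W t) y).
Proof.
move=> [_ hW] ct; have ph := ph_bform (hW t ct).
have := n2D_le ph (I : setT (c *: x)) (I : setT y).
by rewrite (n2Z ph) // mulrA.
Qed.

Lemma measurable_qform W f : weight W -> measurable_vec f ->
  measurable_fun circ (fun t => Re (qform (W t) (f t))).
Proof. by move=> [mW _] mf; exact: (cmeasurable_bform mW mf mf).1. Qed.

Lemma L2wP W f : weight W -> measurable_vec f ->
  L2w W f <-> leb.-integrable circ (fun t => (Re (qform (W t) (f t)))%:E).
Proof.
move=> hW mf.
have E : (\int[leb]_(t in circ) `|(Re (qform (W t) (f t)))%:E|)%E = wnorm W f.
  by apply: eq_integral => t /set_mem ct; rewrite gee0_abs// lee_fin qform_Re_ge0.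
split => [[_ fl]|/integrableP[_ il]].
  apply/integrableP; split; first by apply/measurable_EFinP; rewrite -measurable_fun_lebE; exact: measurable_qform.
  by rewrite E.
by split => //; rewrite -E.
Qed.

Lemma L2w_integrable W f : weight W -> L2w W f ->
  leb.-integrable circ (fun t => (Re (qform (W t) (f t)))%:E).
Proof. by move=> hW hf; apply/(L2wP hW) => //; case: hf. Qed.

Lemma L2w_bform W f g : weight W -> L2w W f -> L2w W g ->
  cintegrable leb circ (fun t => bform (W t) (f t) (g t)).
Proof.
move=> hW hf hg.
apply: (cintegrable_le (m:=leb) measurable_circ (h:=
  fun t => Re (qform (W t) (f t)) + Re (qform (W t) (g t)))) => //.
- by rewrite -cmeasurable_lebE; apply: cmeasurable_bform; [exact: hW.1|exact: hf.1|exact: hg.1].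
- by move=> t ct; apply: normc_bform_le; exact: hW.2.
- have := integrableD measurable_circ (L2w_integrable hW hf) (L2w_integrable hW hg).
  by apply: eq_integrable.
Qed.

Lemma ph_w W : weight W -> prehilbert (L2w W) (ipw W).
Proof.
move=> hW; split.
- move=> c f g hf hg; apply/(L2wP hW).
    by apply: measurable_vec_lin; [exact: hf.1|exact: hg.1].
  apply: (@le_integrable _ _ _ _ _ measurable_circ _ (EFin \o (fun t =>
    (2 * nsq c) * Re (qform (W t) (f t)) + 2 * Re (qform (W t) (g t))))).
  + apply/measurable_EFinP; rewrite -measurable_fun_lebE; apply: (measurable_qform hW).
    by apply: measurable_vec_lin; [exact: hf.1|exact: hg.1].
  + move=> t ct; rewrite /= lee_fin ger0_norm ?qform_Re_ge0//.
    by apply: (le_trans (qform_lin_le _ _ _ hW ct)); exact: ler_norm.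
  + by apply: integrable_real_lin => //; exact: L2w_integrable.
- move=> c f g h hf hg hh; rewrite !ipwE /cmean mulrCA -mulrDr; congr (_ * _).
  have i1 := L2w_bform hW hf hh; have i2 := L2w_bform hW hg hh.
  rewrite -(cintegralZ measurable_circ c i1).
  rewrite -(cintegralD measurable_circ (cintegrableZ measurable_circ c i1) i2).
  by apply: eq_cintegral => t _; rewrite bformlin.
- move=> f g hf hg; rewrite !ipwE /cmean conjM conjR; congr (_ * _).
  rewrite -(cintegralJ measurable_circ (L2w_bform hW hg hf)).
  by apply: eq_cintegral => t ct; rewrite bformC//; exact: (hW.2 t ct).1.
- move=> f hf; rewrite !ipwE /cmean mulr_ge0//.
    by rewrite ler0c invr_ge0 mulr_ge0// pi_ge0.
  by apply: cintegral_ge0 => // t ct; exact: (hW.2 t ct).2.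
Qed.

Lemma two_pi_gt0 : 0 < 2 * pi :> R. Proof. by rewrite mulr_gt0// pi_gt0. Qed.

(** [wnorm] integrates while [ipw] takes the mean, the normalization that makes the exponentials
    orthonormal; hence the factor. *)
Lemma wnormE W f : weight W -> L2w W f -> wnorm W f = (2 * pi * n2 (ipw W) f)%:E.
Proof.
move=> hW hf; rewrite /n2 ipwE /cmean cReZ mulrA divff ?gt_eqF ?two_pi_gt0// mul1r /=.
rewrite /Rintegral fineK//.
by apply: integrable_fin_num => //; exact: L2w_integrable.
Qed.

Lemma weightD W1 W2 : weight W1 -> weight W2 -> weight (fun t => W1 t + W2 t).
Proof.
move=> [m1 p1] [m2 p2]; split.
  move=> k l; apply: eq_cmeasurable; first by move=> t _; rewrite mxE.
  exact: cmeasurableD.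
by move=> t ct; apply: nonneg_hermitianD; [exact: p1|exact: p2].
Qed.

Lemma weight1 : weight (fun=> 1%:M).
Proof.
split => [k l|t _]; last exact: nonneg_hermitian1.
exact: cmeasurable_cst.
Qed.

Lemma circ_aeS (P Q : R -> Prop) : (forall t, circ t -> P t -> Q t) ->
  circ_ae P -> circ_ae Q.
Proof.
rewrite /circ_ae => PQ aP.
apply: (@filterS _ _ (ae_filter_ringOfSetsType leb) _ _ _ aP) => t Pt ct.
by apply: PQ => //; exact: Pt.
Qed.

Lemma circ_aeT (P : R -> Prop) : (forall t, circ t -> P t) -> circ_ae P.
Proof. by move=> h; rewrite /circ_ae; apply: aeW => t; exact: h. Qed.

Lemma circ_aeI (P Q : R -> Prop) : circ_ae P -> circ_ae Q ->
  circ_ae (fun t => P t /\ Q t).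
Proof.
rewrite /circ_ae => aP aQ.
apply: (@filterS2 _ _ (ae_filter_ringOfSetsType leb) _ _ _ _ aP aQ) => t Pt Qt ct.
by split; [exact: Pt|exact: Qt].
Qed.

Lemma circ_aeN (D : set R) : circ_ae (fun t => ~ D t) <->
  leb.-negligible (circ `&` D).
Proof.
rewrite /circ_ae /almost_everywhere /prop_near1 /nbhs /=.
rewrite (_ : ~` _ = circ `&` D)//; apply/seteqP; split => t /=.
  by move=> /not_implyP[ct /contrapT Dt].
by move=> [ct Dt] /(_ ct).
Qed.

Lemma cmean_ae (f g : R -> R[i]) : cmeasurable circ f -> cmeasurable circ g ->
  circ_ae (fun t => f t = g t) -> cmean f = cmean g.
Proof.
move=> mf mg; rewrite /circ_ae /cmean => fg; congr (_ * _).
exact: (ae_eq_cintegral measurable_circ).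
Qed.

Lemma ipw_ae W f1 f2 g1 g2 : (forall k l, cmeasurable circ (fun t => W t k l)) ->
  measurable_vec f1 -> measurable_vec f2 -> measurable_vec g1 -> measurable_vec g2 ->
  circ_ae (fun t => f1 t = f2 t) -> circ_ae (fun t => g1 t = g2 t) ->
  ipw W f1 g1 = ipw W f2 g2.
Proof.
move=> mW mf1 mf2 mg1 mg2 ef eg; rewrite !ipwE; apply: cmean_ae.
- exact: cmeasurable_bform.
- exact: cmeasurable_bform.
- by apply: circ_aeS (circ_aeI ef eg) => t _ [-> ->].
Qed.

End WeightedSpace.
#[global] Hint Resolve measurable_circ : core.

(** * Square integrable random variables *)

Section SquareIntegrableVariables.
Context {R : realType} {d : measure_display} {Omega : measurableType d}.
Variable P : probability Omega R.
Implicit Types (X Y : Omega -> R[i]^o).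
Local Notation LP := (L2rv P : set (Omega -> R[i]^o)).

Lemma normc_le_1nsq (z : R[i]) : normc z <= 1 + nsq z.
Proof.
rewrite /nsq -subr_ge0; have := sqr_ge0 (normc z - 1); have := normc_ge0 z; nra.
Qed.

Lemma normcM_le (x y : R[i]) : normc (x * Num.conj y) <= nsq x + nsq y.
Proof.
rewrite normcM -[X in _ <= _ + X]nsqJ /nsq; move: (normc_ge0 x) (normc_ge0 (Num.conj y)).
by move: (normc x) (normc _) => a b a0 b0; have := sqr_ge0 (a - b); nra.
Qed.

Lemma nsq_integrable X : cmeasurable setT X -> (msq P X < +oo)%E ->
  P.-integrable setT (fun w => (nsq (X w))%:E).
Proof.
move=> mX fX; apply/integrableP; split; first by apply/measurable_EFinP; exact: measurable_nsq.
rewrite (_ : integral _ _ _ = msq P X)//.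
by apply: eq_integral => w _; rewrite gee0_abs// lee_fin nsq_ge0.
Qed.

Lemma L2rv_integrable X Y : cmeasurable setT X -> (msq P X < +oo)%E ->
  cmeasurable setT Y -> (msq P Y < +oo)%E ->
  cintegrable P setT (fun w => X w * Num.conj (Y w)).
Proof.
move=> mX fX mY fY.
apply: (cintegrable_le (m := P) measurableT (h := fun w => nsq (X w) + nsq (Y w))).
- by apply: cmeasurableM => //; exact: cmeasurableJ.
- by move=> w _; exact: normcM_le.
- have := integrableD measurableT (nsq_integrable mX fX) (nsq_integrable mY fY).
  by apply: eq_integrable.
Qed.

Lemma L2rv_cintegrable X : cmeasurable setT X -> (msq P X < +oo)%E ->
  cintegrable P setT X.
Proof.
move=> mX fX.
apply: (cintegrable_le (m := P) measurableT (h := fun w => 1 + nsq (X w))) => //.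
  by move=> w _; exact: normc_le_1nsq.
have := integrableD measurableT (finite_measure_integrable_cst P 1 measurableT) (nsq_integrable mX fX).
by apply: eq_integrable.
Qed.

Lemma ph_rv : prehilbert LP (rv_inner P).
Proof.
split.
- move=> c X Y [mX fX cX] [mY fY cY].
  have mXY : cmeasurable setT (c *: X + Y).
    by apply: cmeasurableD => //; apply: cmeasurableM => //; exact: cmeasurable_cst.
  split => //.
  + rewrite /msq; set I := integral _ _ _.
    suff : P.-integrable setT (fun w => (nsq ((c *: X + Y) w))%:E).
      move=> /integrableP[_]; rewrite (_ : integral _ _ _ = I)//.
      by apply: eq_integral => w _; rewrite gee0_abs// lee_fin nsq_ge0.
    apply: (@le_integrable _ _ _ _ _ measurableT _ (EFin \o (fun w =>
       2 * nsq c * nsq (X w) + 2 * nsq (Y w)))).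
    * by apply/measurable_EFinP; exact: measurable_nsq.
    * move=> w _; rewrite /= lee_fin ger0_norm ?nsq_ge0//.
      apply: (le_trans (nsqD_le _ _)); rewrite nsqM mulrA; exact: ler_norm.
    * by apply: integrable_real_lin => //; exact: nsq_integrable.
  + have iX := L2rv_cintegrable mX fX; have iY := L2rv_cintegrable mY fY.
    rewrite /cE cintegralD//; last exact: cintegrableZ.
    by rewrite cintegralZ// -/(cE P X) -/(cE P Y) cX cY mulr0 addr0.
- move=> c X Y Z [mX fX cX] [mY fY cY] [mZ fZ cZ].
  have iX := L2rv_integrable mX fX mZ fZ; have iY := L2rv_integrable mY fY mZ fZ.
  rewrite /rv_inner /cE -cintegralZ// -cintegralD//; last exact: cintegrableZ.
  by apply: eq_cintegral => w _; rewrite [in LHS]/GRing.scale/= mulrDl mulrA.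
- move=> X Y [mX fX cX] [mY fY cY].
  rewrite /rv_inner /cE -cintegralJ//; last exact: L2rv_integrable.
  by apply: eq_cintegral => w _; rewrite conjM conjKc mulrC.
- move=> X _; apply: cintegral_ge0 => // w _.
  by rewrite mul_conjE ler0c nsq_ge0.
Qed.

Lemma msqE X : LP X -> msq P X = (n2 (rv_inner P) X)%:E.
Proof.
move=> [mX fX cX]; rewrite /n2 /rv_inner /cE /= /Rintegral.
under [X in fine X]eq_integral do rewrite mul_conjE /=.
rewrite fineK//; apply: integrable_fin_num => //; exact: nsq_integrable.
Qed.

End SquareIntegrableVariables.

(** * Finite linear combinations and closures *)

Section Combinations.
Context {R : realType} {I : Type}.
Implicit Types (p q : seq (R[i] * I)).

(** A combination is stored as a list of coefficients and indices, so that one list can be evaluated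
    both on exponentials and on the observed random variables. *)
Definition comb (V : lmodType R[i]) (x : I -> V) p : V := \sum_(r <- p) r.1 *: x r.2.

Lemma comb_cat (V : lmodType R[i]) (x : I -> V) p q :
  comb x (p ++ q) = comb x p + comb x q.
Proof. by rewrite /comb big_cat. Qed.

Definition scaleseq (c : R[i]) p := [seq (c * r.1, r.2) | r <- p].

Lemma comb_scale (V : lmodType R[i]) (x : I -> V) c p :
  comb x (scaleseq c p) = c *: comb x p.
Proof.
by rewrite /comb big_map scaler_sumr; apply: eq_bigr => r _; rewrite scalerA.
Qed.

Lemma comb_sub (V : lmodType R[i]) (x : I -> V) p q :
  comb x (p ++ scaleseq (-1) q) = comb x p - comb x q.
Proof. by rewrite comb_cat comb_scale scaleN1r. Qed.

Lemma comb1 (V : lmodType R[i]) (x : I -> V) i : comb x [:: (1, i)] = x i.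
Proof. by rewrite /comb big_seq1 scale1r. Qed.

Lemma comb_add (V : lmodType R[i]) (x y : I -> V) p :
  comb (fun i => x i + y i) p = comb x p + comb y p.
Proof.
by rewrite /comb -big_split; apply: eq_bigr => r _; rewrite scalerDr.
Qed.

Lemma linspan_comb (V : lmodType R[i]) (x : I -> V) (D : set I) v :
  linspan [set w | exists i, D i /\ w = x i] v ->
  exists p, all (fun r => `[< D r.2 >]) p /\ v = comb x p.
Proof.
move=> [n [c [g [hg ->]]]]; have [f hf] := choice hg.
exists [seq (c i, f i) | i <- enum 'I_n]; split.
  by rewrite all_map; apply/allP => i _ /=; apply/asboolP; exact: (hf i).1.
rewrite /comb big_map big_enum; apply: eq_bigr => i _.
by rewrite (hf i).2.
Qed.

Lemma comb_linspan (V : lmodType R[i]) (x : I -> V) (D : set I) p :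
  all (fun r => `[< D r.2 >]) p ->
  linspan [set w | exists i, D i /\ w = x i] (comb x p).
Proof.
move=> hp; exists (size p), (fun i => (tnth (in_tuple p) i).1),
  (fun i => x (tnth (in_tuple p) i).2); split.
  move=> i; exists (tnth (in_tuple p) i).2; split => //; apply/asboolP.
  by rewrite (tnth_nth (tnth (in_tuple p) i)); move/(all_nthP _) : hp; apply.
by rewrite /comb big_tnth.
Qed.

Lemma comb_L (V : lmodType R[i]) (L : set V) ip (ph : prehilbert L ip) (x : I -> V) p :
  L 0 -> (forall i, L (x i)) -> L (comb x p).
Proof. by move=> L0 Lx; apply: (ph_sum ph) => // r _; exact: (phZ ph). Qed.

(** Families with equal Gram matrices span isometric spaces. This is the passage between random
    variables and functions on the circle. *)
Lemma ip_comb (V V' : lmodType R[i]) (L : set V) (L' : set V') ip ip'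
    (ph : prehilbert L ip) (ph' : prehilbert L' ip') (x y : I -> V) (x' y' : I -> V') p q :
  L 0 -> L' 0 ->
  (forall i, L (x i)) -> (forall i, L (y i)) ->
  (forall i, L' (x' i)) -> (forall i, L' (y' i)) ->
  (forall i j, ip (x i) (y j) = ip' (x' i) (y' j)) ->
  ip (comb x p) (comb y q) = ip' (comb x' p) (comb y' q).
Proof.
move=> L0 L0' Lx Ly Lx' Ly' h.
rewrite /comb (ip_suml ph); last 2 first.
- exact: (comb_L ph).
- by move=> r _; exact: (phZ ph).
rewrite (ip_suml ph'); last 2 first.
- exact: (comb_L ph').
- by move=> r _; exact: (phZ ph').
apply: eq_bigr => r _.
rewrite (ipZl ph) ?(ipZl ph')//; [|exact: (comb_L ph')|exact: (comb_L ph)].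
rewrite (ip_sumr ph)//; last by move=> u _; exact: (phZ ph).
rewrite (ip_sumr ph')//; last by move=> u _; exact: (phZ ph').
congr (_ * _); apply: eq_bigr => u _.
by rewrite (ipZr ph) ?(ipZr ph')// h.
Qed.

End Combinations.

Section Closure.
Context {R : realType} {V : lmodType R[i]} {L : set V} {ip : V -> V -> R[i]}.
Hypothesis ph : prehilbert L ip.
Variable S : set V.
Hypothesis S0 : S 0.
Hypothesis SL : forall x, S x -> L x.
Hypothesis Slin : forall c x y, S x -> S y -> S (c *: x + y).

Definition ncl (L : set V) (ip : V -> V -> R[i]) (S : set V) : set V :=
  [set x | L x /\ forall e : R, 0 < e -> exists y, S y /\ n2 ip (x - y) < e].

Local Notation cl := (ncl L ip S).

Lemma subset_ncl x : S x -> cl x.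
Proof.
move=> Sx; split; first exact: SL.
by move=> e e0; exists x; split => //; rewrite subrr (n2_0 ph (SL Sx)).
Qed.

Lemma ncl_ncl x : L x ->
  (forall e : R, 0 < e -> exists y, cl y /\ n2 ip (x - y) < e) -> cl x.
Proof.
move=> Lx h; split => // e e0.
have e4 : 0 < e / 4 by rewrite divr_gt0.
have [y [[Ly cy] xy]] := h _ e4; have [z [Sz yz]] := cy _ e4.
exists z; split => //; apply: (le_lt_trans (n2B_le3 ph Lx Ly (SL Sz))).
by move: xy yz; move: (n2 _ _) (n2 _ _) => a b; lra.
Qed.

Lemma ncl_lin c x y : cl x -> cl y -> cl (c *: x + y).
Proof.
move=> [Lx cx] [Ly cy]; split; first exact: (ph_lin ph).
move=> e e0; have c0 := nsq_ge0 c.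
(* The summand 1 covers c = 0; the 4 is the factor 2 of [n2D_le] times the two summands. *)
have e1 : 0 < e / (4 * (nsq c + 1)) by rewrite divr_gt0// mulr_gt0// ltr_wpDl.
have e2 : 0 < e / 4 by rewrite divr_gt0.
have [x' [Sx' xx]] := cx _ e1; have [y' [Sy' yy]] := cy _ e2.
exists (c *: x' + y'); split; first exact: Slin.
have -> : c *: x + y - (c *: x' + y') = c *: (x - x') + (y - y').
  by rewrite scalerBr opprD addrACA.
have Lxx := phB ph Lx (SL Sx'); have Lyy := phB ph Ly (SL Sy').
apply: (le_lt_trans (n2D_le ph (phZ ph c Lxx) Lyy)); rewrite (n2Z ph)//.
move: xx yy (n2_ge0 ph Lxx); move: (n2 _ _) (n2 _ _) => a b.
rewrite ltr_pdivlMr; last by rewrite mulr_gt0// ltr_wpDl.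
move: (nsq c) c0 => k k0 h1 h2 a0; nra.
Qed.

Lemma ncl_lim (u : nat -> V) x : L x -> (forall n, cl (u n)) ->
  ncvg ip u x -> cl x.
Proof.
move=> Lx hu /cvg0P ux; apply: ncl_ncl => // e e0.
have [n0 /(_ _ (leqnn n0)) h] := ux _ e0; exists (u n0); split => //.
by rewrite (n2C ph)//; [exact: le_lt_trans (ler_norm _) h|exact: (hu _).1].
Qed.

Lemma ncl0 : cl 0. Proof. exact: subset_ncl. Qed.

Lemma ncl_sum I (r : seq I) (Q : pred I) (f : I -> V) :
  (forall i, Q i -> cl (f i)) -> cl (\sum_(i <- r | Q i) f i).
Proof.
move=> hf; elim/big_ind : _ => [|x y hx hy|//]; first exact: ncl0.
by rewrite -[x]scale1r; exact: ncl_lin.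
Qed.

Lemma nclZ c x : cl x -> cl (c *: x).
Proof. by move=> hx; rewrite -[_ *: _]addr0; apply: ncl_lin => //; exact: ncl0. Qed.

End Closure.

Section WeightedLimits.
Context {R : realType} {T : nat}.
Implicit Types (f g h : R -> 'cV[R[i]]_T) (W : R -> 'M[R[i]]_T) (phi : R -> R).
Local Notation leb := (@lebesgue_measure R).
Local Notation circ := (@circ R).

Lemma n2_ipwE W f : n2 (ipw W) f =
  (2 * pi)^-1 * Rintegral leb circ (fun t => Re (qform (W t) (f t))).
Proof. by rewrite /n2 ipwE /cmean cReZ. Qed.

(** Dominated convergence in L2(W); the majorant bounds the quadratic form of the difference, not
    the functions themselves. *)
Lemma ncvg_w W (u : nat -> R -> 'cV[R[i]]_T) f (G : R -> R) : weight W ->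
  measurable_vec f -> (forall n, measurable_vec (u n)) ->
  leb.-integrable circ (EFin \o G) ->
  (forall n t, circ t -> Re (qform (W t) (u n t - f t)) <= G t) ->
  circ_ae (fun t => (fun n => Re (qform (W t) (u n t - f t))) @ \oo --> (0 : R)) ->
  ncvg (ipw W) u f.
Proof.
move=> hW mf mu iG uG u0.
pose v n t := Re (qform (W t) (u n t - f t)).
have mv n : measurable_fun (circ : set (measurableTypeR R)) (v n).
  rewrite -measurable_fun_lebE; apply: (measurable_qform hW).
  rewrite (_ : (fun t => _) = (-1) *: f + u n); first exact: measurable_vec_lin.
  by apply/funext => t; rewrite scaleN1r addrC.
have v_ge0 n t : circ t -> 0 <= v n t by move=> ct; exact: qform_Re_ge0.
have A1 n : measurable_fun (circ : set (measurableTypeR R)) (fun t => (v n t)%:E).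
  exact/measurable_EFinP.
have A3 : {ae leb, forall t, circ t -> (fun n => (v n t)%:E) @ \oo --> (cst 0%E t : \bar R)}.
  apply: (@filterS _ _ (ae_filter_ringOfSetsType leb) _ _ _ u0) => t h ct.
  by apply: cvg_EFin; [near=> n|exact: h].
have A4 : {ae leb, forall t n, circ t -> (`|(v n t)%:E| <= (EFin \o G) t)%E}.
  by apply: aeW => t n ct; rewrite gee0_abs ?lee_fin ?v_ge0// uG.
have [_ _ h] := @dominated_convergence _ _ _ leb circ measurable_circ
  (fun n t => (v n t)%:E) (cst 0%E) (EFin \o G) A1 (measurable_cst _) A3 iG A4.
rewrite /ncvg.
have -> : (fun n => n2 (ipw W) (u n - f)) =
  (fun n => (2 * pi)^-1 * fine (\int[leb]_(t in circ) (v n t)%:E)%E).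
  by apply/funext => n; rewrite n2_ipwE.
rewrite -(mulr0 (2 * pi)^-1); apply: cvgM; first exact: cvg_cst.
rewrite integral0 in h.
exact: (fine_cvg h).
Unshelve. all: by end_near. Qed.
End WeightedLimits.

(** * Multipliers of a subspace of L2(W) *)

Section Multipliers.
Context {R : realType} {T : nat}.
Implicit Types (f g h p : R -> 'cV[R[i]]_T) (phi psi : R -> R) (A B : set R).
Local Notation leb := (@lebesgue_measure R).
Local Notation circ := (@circ R).

Lemma n2_sum_le (V : lmodType R[i]) (L : set V) ip (ph : prehilbert L ip) I (r : seq I)
    (f : I -> V) : L 0 -> (forall i, L (f i)) ->
  n2 ip (\sum_(i <- r) f i) <= 2 ^+ size r * \sum_(i <- r) n2 ip (f i).
Proof.
move=> L0 Lf; elim: r => [|i r ih]; first by rewrite !big_nil mulr0 (n2_0 ph L0).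
have Ls : L (\sum_(i <- r) f i) by exact: (ph_sum ph).
rewrite !big_cons; apply: (le_trans (n2D_le ph (Lf i) Ls)).
rewrite /= exprS -mulrA mulrDr -!mulrDr; apply: ler_wpM2l => //.
rewrite mulrDr lerD// ler_peMl ?(n2_ge0 ph)// exprn_ege1//; lra.
Qed.

(** Expand x in the standard basis and apply the crude inequality [n2_sum_le]. The constant is far
    from sharp, but only its finiteness matters. *)
Lemma qform_le_diag (W : 'M[R[i]]_T) x : nonneg_hermitian W ->
  Re (qform W x) <= 2 ^+ T * \sum_k nsq (x k 0) * Re (W k k).
Proof.
move=> hW; have ph := ph_bform hW.
have -> : x = \sum_k x k 0 *: delta k.
  apply/colP => l; rewrite summxE (bigD1 l)//= big1 ?addr0.
    by rewrite !mxE !eqxx mulr1.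
  by move=> k kl; rewrite !mxE eq_sym (negbTE kl) mulr0.
apply: (le_trans (n2_sum_le ph _ _ _)) => //.
rewrite [X in 2 ^+ X](_ : _ = T); last by rewrite -[RHS]card_ord cardE enumT.
apply: ler_wpM2l; first by rewrite exprn_ge0.
apply: ler_sum => k _; rewrite (n2Z ph)//.
have -> : (\sum_k0 x k0 0 *: delta k0) k 0 = x k 0.
  rewrite summxE (bigD1 k)//= big1 ?addr0.
    by rewrite !mxE !eqxx mulr1.
  by move=> l kl; rewrite !mxE eq_sym (negbTE kl) mulr0.
rewrite /n2 /bform; apply: ler_wpM2l; first exact: nsq_ge0.
rewrite (_ : conj_mx (delta k) = delta_mx k 0) ?trmx_delta -?rowE -?colE ?mxE//.
by apply/matrixP => i j; rewrite !mxE; case: (_ && _); rewrite ?conj1 ?conj0.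
Qed.

Variable W : R -> 'M[R[i]]_T.
Hypothesis hW : weight W.
Hypothesis iW : integrable_mx W.
Let ph := ph_w hW.

Lemma L2w_bounded f (M : R) : measurable_vec f ->
  (forall t, circ t -> forall k, nsq (f t k 0) <= M) -> L2w W f.
Proof.
move=> mf fM; apply/(L2wP hW) => //.
apply: (@le_integrable _ _ _ _ _ measurable_circ _
  (EFin \o (fun t => \sum_(k <- index_enum 'I_T) (2 ^+ T * M) * Re (W t k k)))).
- apply/measurable_EFinP; rewrite -measurable_fun_lebE; exact: measurable_qform.
- move=> t ct; rewrite /= lee_fin ger0_norm ?qform_Re_ge0//.
  apply: (le_trans (qform_le_diag _ (hW.2 t ct))).
  apply: (le_trans _ (ler_norm _)); rewrite mulr_sumr; apply: ler_sum => k _.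
  rewrite mulrA; apply: ler_wpM2r; last by apply: ler_wpM2l (fM t ct k).
  have := (hW.2 t ct).2 (delta k).
  move=> /ge0_Re; rewrite /qform.
  rewrite (_ : conj_mx (delta k) = delta_mx k 0) ?trmx_delta -?rowE -?colE ?mxE//.
  by apply/matrixP => i j; rewrite !mxE; case: (_ && _); rewrite ?conj1 ?conj0.
- elim: (index_enum _) => [|k r ih].
    by under [X in _.-integrable _ X]eq_fun do rewrite /= big_nil; exact: integrable0.
  have := integrableD measurable_circ (integrableZl measurable_circ (2 ^+ T * M) (iW k k).1) ih.
  by apply: eq_integrable => // t _; rewrite /= big_cons.
Qed.

Lemma L2w0 : L2w W 0.
Proof.
apply: (@L2w_bounded _ 0) => [k|t _ k]; last by rewrite mxE nsq0.
by apply: eq_cmeasurable (cmeasurable_cst _ 0) => t _; rewrite mxE.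
Qed.

Definition mulv phi f : R -> 'cV[R[i]]_T := fun t => (phi t)%:C *: f t.

Lemma qform_mulv phi f t : Re (qform (W t) (mulv phi f t)) =
  phi t ^+ 2 * Re (qform (W t) (f t)).
Proof.
rewrite /qform /mulv linearZ conj_mxZ conjR -scalemxAr -!scalemxAl !mxE.
by rewrite mulrA -rmorphM cReZ -expr2.
Qed.

Lemma measurable_mulv phi f : measurable_fun circ phi -> measurable_vec f ->
  measurable_vec (mulv phi f).
Proof.
move=> mphi mf k; apply: (@eq_cmeasurable _ _ _ _ (fun t => (phi t)%:C * f t k 0)).
  by move=> t _; rewrite mxE.
by apply: cmeasurableM => //; exact: cmeasurable_real.
Qed.

Definition bmeas phi (M : R) : Prop :=
  measurable_fun circ phi /\ forall t, circ t -> `|phi t| <= M.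

Lemma bmeas_sqr phi M t : bmeas phi M -> circ t -> phi t ^+ 2 <= M ^+ 2.
Proof.
move=> [_ h] ct; rewrite -[phi t ^+ 2]real_normK ?num_real//.
by rewrite ler_pXn2r// ?nnegrE//; [exact: h|exact: le_trans (h t ct)].
Qed.

Lemma L2w_mulv phi M f : bmeas phi M -> L2w W f -> L2w W (mulv phi f).
Proof.
move=> bp hf; apply/(L2wP hW); first exact: measurable_mulv bp.1 hf.1.
apply: (@le_integrable _ _ _ _ _ measurable_circ _
  (EFin \o (fun t => M ^+ 2 * Re (qform (W t) (f t))))).
- apply/measurable_EFinP; rewrite -measurable_fun_lebE; apply: measurable_qform => //.
  exact: measurable_mulv bp.1 hf.1.
- move=> t ct; rewrite /= lee_fin ger0_norm ?qform_Re_ge0// qform_mulv.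
  apply: (le_trans _ (ler_norm _)); apply: ler_wpM2r; first exact: qform_Re_ge0.
  exact: bmeas_sqr ct.
- have := integrableZl measurable_circ (M ^+ 2) (L2w_integrable hW hf).
  by apply: eq_integrable.
Qed.

Lemma n2_mulv_le phi M f : bmeas phi M -> L2w W f ->
  n2 (ipw W) (mulv phi f) <= M ^+ 2 * n2 (ipw W) f.
Proof.
move=> bp hf; rewrite !n2_ipwE mulrCA; apply: ler_wpM2l.
  by rewrite invr_ge0 ltW// two_pi_gt0.
have iM : leb.-integrable circ (EFin \o (fun t => M ^+ 2 * Re (qform (W t) (f t)))).
  have := integrableZl measurable_circ (M ^+ 2) (L2w_integrable hW hf).
  by apply: eq_integrable.
rewrite -(RintegralZl (M ^+ 2) measurable_circ (L2w_integrable hW hf)).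
apply: (le_Rintegral measurable_circ _ iM) => [|t ct].
  exact: L2w_integrable hW (L2w_mulv bp hf).
rewrite qform_mulv; apply: ler_wpM2r; first exact: qform_Re_ge0.
exact: bmeas_sqr ct.
Qed.

Lemma mulvB phi f g : mulv phi (f - g) = mulv phi f - mulv phi g.
Proof. by apply/funext => t; rewrite /mulv scalerBr. Qed.

Variable S : set (R -> 'cV[R[i]]_T).
Hypothesis S0 : S 0.
Hypothesis SL : forall f, S f -> L2w W f.
Hypothesis Slin : forall c f g, S f -> S g -> S (c *: f + g).
Local Notation cl := (ncl (L2w W) (ipw W) S).

(* The multipliers form an algebra that is closed under bounded pointwise limits. *)
Definition multiplier phi : Prop :=
  (exists M, bmeas phi M) /\ forall f, S f -> cl (mulv phi f).

(** Multiplication by a bounded function is Lipschitz for the seminorm. This extension from S to its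
    closure is what makes products of multipliers multipliers. *)
Lemma multiplier_cl phi f : multiplier phi -> cl f -> cl (mulv phi f).
Proof.
move=> [[M bp] hp] [hf cf]; apply: (ncl_ncl ph SL).
  exact: L2w_mulv bp hf.
move=> e e0; have M1 : 0 < M ^+ 2 + 1 by rewrite ltr_wpDl ?sqr_ge0.
have [g [Sg fg]] := cf _ (divr_gt0 e0 M1).
exists (mulv phi g); split; first exact: hp.
have hfg := phB ph hf (SL Sg).
rewrite -mulvB; apply: (le_lt_trans (n2_mulv_le bp hfg)).
move: fg (n2_ge0 ph hfg); rewrite ltr_pdivlMr//; move: (n2 _ _) => a.
have := sqr_ge0 M; nra.
Qed.

Lemma multiplier_lin (a b : R) phi psi : multiplier phi -> multiplier psi ->
  multiplier (fun t => a * phi t + b * psi t).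
Proof.
move=> [[M [m1 b1]] h1] [[M' [m2 b2]] h2]; split.
  exists (`|a| * M + `|b| * M'); split.
    by apply: measurable_funD; apply: measurable_funM => //; exact: measurable_cst.
  move=> t ct; apply: (le_trans (ler_normD _ _)); rewrite !normrM lerD//.
    by apply: ler_wpM2l => //; exact: b1.
  by apply: ler_wpM2l => //; exact: b2.
move=> f Sf; have -> : mulv (fun t => a * phi t + b * psi t) f =
    a%:C *: mulv phi f + b%:C *: mulv psi f.
  apply/funext => t; rewrite /mulv /GRing.scale/= -/GRing.scale.
  rewrite [LHS](_ : _ = (a%:C * (phi t)%:C + b%:C * (psi t)%:C) *: f t).
    by rewrite scalerDl -!scalerA.
  by rewrite rmorphD !rmorphM.
by apply: (ncl_lin ph SL Slin); [exact: h1|apply: (nclZ ph S0 SL Slin); exact: h2].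
Qed.

Lemma multiplier1 : multiplier (fun=> 1).
Proof.
split; first by exists 1; split => [|t _]; [exact: measurable_cst|rewrite normr1].
move=> f Sf; rewrite (_ : mulv _ f = f); first exact: (subset_ncl ph SL).
by apply/funext => t; rewrite /mulv scale1r.
Qed.

Lemma multiplier_cst (a : R) : multiplier (fun=> a).
Proof.
have := multiplier_lin a 0 multiplier1 multiplier1.
by congr multiplier; apply/funext => t; rewrite mul0r addr0 mulr1.
Qed.

Lemma multiplierM phi psi : multiplier phi -> multiplier psi ->
  multiplier (fun t => phi t * psi t).
Proof.
move=> h1 h2; split.
  have [[M [m1 b1]] _] := h1; have [[M' [m2 b2]] _] := h2.
  exists (M * M'); split; first exact: measurable_funM.
  by move=> t ct; rewrite normrM ler_pM//; [exact: b1|exact: b2].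
move=> f Sf; rewrite (_ : mulv _ f = mulv phi (mulv psi f)).
  by apply: multiplier_cl => //; exact: h2.2.
by apply/funext => t; rewrite /mulv scalerA -rmorphM.
Qed.

Lemma multiplierX phi n : multiplier phi -> multiplier (fun t => phi t ^+ n).
Proof.
move=> h; elim: n => [|n ih]; first exact: multiplier1.
by have := multiplierM h ih; congr multiplier; apply/funext => t; rewrite exprS.
Qed.

Lemma multiplier_lim (phi_ : nat -> R -> R) phi (M : R) :
  (forall n, multiplier (phi_ n)) -> (forall n t, circ t -> `|phi_ n t| <= M) ->
  bmeas phi M -> circ_ae (fun t => (fun n => phi_ n t - phi t) @ \oo --> (0 : R)) ->
  multiplier phi.
Proof.
move=> hn bn bp lim; split; first by exists M.
move=> f Sf; have Lf := SL Sf.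
apply: (@ncl_lim _ _ _ _ ph _ SL (fun n => mulv (phi_ n) f)).
- exact: L2w_mulv bp Lf.
- by move=> n; exact: (hn n).2.
have E n t : mulv (phi_ n) f t - mulv phi f t = mulv (fun t => phi_ n t - phi t) f t.
  by rewrite /mulv rmorphB scalerBl.
(* All functions involved are bounded by M, so differences are bounded by 2 M. *)
apply: (ncvg_w (G := fun t => (2 * M) ^+ 2 * Re (qform (W t) (f t))) hW).
- exact: measurable_mulv bp.1 Lf.1.
- by move=> n; have [[M' [mn _]] _] := hn n; exact: measurable_mulv mn Lf.1.
- have := integrableZl measurable_circ ((2 * M) ^+ 2) (L2w_integrable hW Lf).
  by apply: eq_integrable.
- move=> n t ct; rewrite E qform_mulv; apply: ler_wpM2r; first exact: qform_Re_ge0.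
  rewrite -[_ ^+ 2]real_normK ?num_real// ler_pXn2r// ?nnegrE//.
    by apply: (le_trans (ler_normB _ _)); rewrite mulr2n mulrDl !mul1r lerD//; [exact: bn|exact: bp.2].
  by rewrite mulr_ge0//; apply: le_trans (bp.2 t ct).
- apply: circ_aeS lim => t ct h.
  have -> : (fun n => Re (qform (W t) (mulv (phi_ n) f t - mulv phi f t))) =
    (fun n => (phi_ n t - phi t) * (phi_ n t - phi t) * Re (qform (W t) (f t))).
    by apply/funext => n; rewrite E qform_mulv expr2.
  have := cvgM (cvgM h h) (cvg_cst (Re (qform (W t) (f t)))).
  by rewrite !mul0r; exact.
Qed.

Definition mset : set (set R) :=
  [set A | measurable A /\ multiplier (fun t => \1_A t)].

Lemma mset_sigma_algebra : sigma_algebra setT mset.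
Proof.
have msetC A : mset A -> mset (~` A).
  move=> [mA hA]; split; first exact: measurableC.
  have := multiplier_lin 1 (-1) multiplier1 hA.
  congr multiplier; apply/funext => t; rewrite mul1r mulN1r !indicE in_setC.
  by case: (t \in A); rewrite /= ?subrr ?subr0.
have mset0 : mset set0.
  split => //; have := multiplier_cst 0.
  by congr multiplier; apply/funext => t; rewrite indic0.
have msetI A B : mset A -> mset B -> mset (A `&` B).
  move=> [mA hA] [mB hB]; split; first exact: measurableI.
  by have := multiplierM hA hB; congr multiplier; apply/funext => t; rewrite indicI.
have msetU A B : mset A -> mset B -> mset (A `|` B).
  by move=> hA hB; rewrite -[_ `|` _]setCK setCU; apply/msetC/msetI; exact/msetC.
split; [exact: mset0|by move=> A hA; rewrite setTD; exact/msetC|move=> A hA].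
have mU : measurable (\bigcup_k A k) by apply: bigcupT_measurable => k; exact: (hA k).1.
(* The indicators of finite unions converge pointwise to that of the countable union, so closure
   under bounded pointwise limits suffices. *)
pose B n := \big[setU/set0]_(k < n) A k.
have hB n : mset (B n).
  elim: n => [|n ih]; first by rewrite /B big_ord0.
  by rewrite /B big_ord_recr /=; exact (msetU _ _ ih (hA n)).
split; first exact: mU.
apply: (@multiplier_lim (fun n t => \1_(B n) t) _ 1).
- by move=> n; exact: (hB n).2.
- by move=> n t _; rewrite indicE; case: (_ \in _); rewrite ?normr1 ?normr0.
- split; last by move=> t _; rewrite indicE; case: (_ \in _); rewrite ?normr1 ?normr0.
  by apply: measurable_funTS; exact: measurable_indic.
- apply: circ_aeT => t _; apply/cvg0P => e e0.
  have [[k _ Akt]|h] := pselect ((\bigcup_k A k) t); last first.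
    exists 0%N => n _; rewrite !indicE memNset ?memNset ?subr0 ?normr0//.
    by move=> Bt; apply: h; move: Bt; rewrite /B -bigcup_mkord => -[k _ Akt]; exists k.
  exists k.+1 => n kn; rewrite !indicE !mem_set ?subrr ?normr0//; first by exists k.
  by rewrite /B -bigcup_mkord; exists k.
Qed.

Lemma mset_all : (forall x : R, mset `]x, +oo[%classic) ->
  forall A, measurable A -> mset A.
Proof.
move=> h A.
have : (@ocitv R).-sigma.-measurable `<=` mset.
  rewrite RGenOInfty.measurableE; apply: smallest_sub; first exact: mset_sigma_algebra.
  by move=> _ [x ->]; exact: h.
exact.
Qed.

End Multipliers.

(** * Density of trigonometric polynomials *)

Section StepLimit.
Context {R : realType}.
Implicit Types y z : R.

Lemma bernoulli_ge z n : 0 <= z <= 1 -> 1 - n%:R * z <= (1 - z) ^+ n.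
Proof.
move=> /andP[z0 z1]; elim: n => [|n ih]; first by rewrite mul0r subr0 expr0.
rewrite exprS; have h : 0 <= 1 - z by lra.
apply: (le_trans _ (ler_wpM2l h ih)); rewrite -natr1 -subr_ge0.
have -> : (1 - z) * (1 - n%:R * z) - (1 - (n%:R + 1) * z) = n%:R * (z * z) by ring.
by rewrite mulr_ge0// mulr_ge0.
Qed.

(** Induction on n, using (1 - z) (1 + (n + 1) z) <= 1 + n z. *)
Lemma bernoulli_le z n : 0 <= z <= 1 -> (1 - z) ^+ n * (1 + n%:R * z) <= 1.
Proof.
move=> /andP[z0 z1]; elim: n => [|n ih]; first by rewrite mul0r addr0 expr0 mulr1.
apply: (le_trans _ ih); rewrite exprSr -mulrA; apply: ler_wpM2l.
  by apply: exprn_ge0; lra.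
rewrite -natr1 -subr_ge0.
have -> : 1 + n%:R * z - (1 - z) * (1 + (n%:R + 1) * z) = (n%:R + 1) * (z * z) by ring.
by rewrite mulr_ge0// ?mulr_ge0// addr_ge0.
Qed.

(* Composed with [ray_fun x], a polynomial in cos and sin, [step_poly n] tends on
   ]-pi, pi[ to the indicator function of ]x, +oo[. *)
Definition step_poly (n : nat) y : R := (1 - y ^+ n) ^+ (2 ^ n).

Lemma step_poly_itv n y : 0 <= y <= 1 -> 0 <= step_poly n y <= 1.
Proof.
move=> /andP[y0 y1]; have h1 : y ^+ n <= 1 by exact: exprn_ile1.
have h0 : 0 <= y ^+ n by exact: exprn_ge0.
by rewrite /step_poly exprn_ge0 ?exprn_ile1//; lra.
Qed.

(** The threshold 1/2 comes from the exponent 2^n: the two Bernoulli inequalities at z = y^n give 1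
    - [step_poly n y] <= (2 y)^n here and [step_poly n y] <= (2 y)^-n in the next lemma. *)
Lemma step_poly_small y : 0 <= y < 1 / 2 -> (fun n => step_poly n y - 1) @ \oo --> (0 : R).
Proof.
move=> /andP[y0 y1].
suff : (fun n => 1 - step_poly n y) @ \oo --> (0 : R).
  move=> /cvgN; rewrite oppr0; apply: cvg_trans.
  by apply: near_eq_cvg; near=> n => /=; rewrite opprB.
apply: (@cvg0_le _ _ (fun n => (2 * y) ^+ n)); last first.
  by apply: cvg_expr; rewrite ger0_norm; [lra|rewrite mulr_ge0].
move=> n; have /andP[_ h] := @step_poly_itv n y ltac:(apply/andP; split; lra).
rewrite subr_ge0 h /= lerBlDr -lerBlDl exprMn.
have := @bernoulli_ge (y ^+ n) (2 ^ n)%N.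
rewrite natrX; apply; rewrite exprn_ge0//= exprn_ile1//; lra.
Unshelve. all: by end_near. Qed.

Lemma step_poly_large y : 1 / 2 < y <= 1 -> (fun n => step_poly n y - 0) @ \oo --> (0 : R).
Proof.
move=> /andP[y0 y1]; apply: (@cvg0_le _ _ (fun n => ((2 * y)^-1) ^+ n)); last first.
  apply: cvg_expr; rewrite ger0_norm ?invr_ge0; last lra.
  by rewrite invf_lt1; lra.
move=> n; have yI : 0 <= y <= 1 by apply/andP; split; lra.
have /andP[h _] := @step_poly_itv n y yI; rewrite subr0 h /=.
have y2 : 0 < (2 * y) ^+ n by rewrite exprn_gt0//; lra.
rewrite exprVn -[leRHS]mul1r ler_pdivlMr//.
have yn : 0 <= y ^+ n <= 1 by rewrite exprn_ge0 ?exprn_ile1//; lra.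
apply: (le_trans _ (bernoulli_le (2 ^ n)%N yn)); apply: ler_wpM2l => //.
by rewrite exprMn natrX lerDr.
Qed.

End StepLimit.

Section Rays.
Context {R : realType}.
Implicit Types t x : R.

(** A trigonometric polynomial of degree 1 in t that crosses the level 1/2 exactly at x inside ]-pi,
    pi[: in the factored form of [ray_funE] the factor cos (t / 2) is positive there, so the sine
    decides. *)
Definition ray_fun x t : R :=
  1 / 2 + sin (x / 2) / 4 + (sin (x / 2) / 4 * cos t + - cos (x / 2) / 4 * sin t).

Lemma ray_funE x t : ray_fun x t = 1 / 2 + cos (t / 2) * sin ((x - t) / 2) / 2.
Proof.
rewrite /ray_fun.
have -> : (x - t) / 2 = x / 2 - t / 2 by field.
have E : t = t / 2 + t / 2 by field.
rewrite {1 2}E sinD cosD sinB.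
have := cos2Dsin2 (t / 2).
move: (sin (x / 2)) (cos (x / 2)) (sin (t / 2)) (cos (t / 2)) => a b c e h.
apply/eqP; rewrite -subr_eq0; apply/eqP.
transitivity (a / 4 * (1 - (e ^+ 2 + c ^+ 2))); first by field.
by rewrite h subrr mulr0.
Qed.

Lemma ray_fun_itv x t : 0 <= ray_fun x t <= 1.
Proof.
rewrite ray_funE; set u := cos _ * sin _.
have : `|u| <= 1 by rewrite normrM mulr_ile1// ?cos_max ?sin_max.
by rewrite ler_norml => /andP[u1 u2]; apply/andP; split; lra.
Qed.

Lemma ray_fun_lt x t : - pi < t < pi -> - pi < x < pi -> x < t -> ray_fun x t < 1 / 2.
Proof.
move=> /andP[t1 t2] /andP[x1 x2] xt; rewrite ray_funE.
have c0 : 0 < cos (t / 2) by apply: cos_gt0_pihalf; apply/andP; split; lra.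
have s0 : 0 < sin ((t - x) / 2) by apply: sin_gt0_pi; apply/andP; split; lra.
have -> : (x - t) / 2 = - ((t - x) / 2) by field.
rewrite sinN; have := mulr_gt0 c0 s0; rewrite mulrN; lra.
Qed.

Lemma ray_fun_gt x t : - pi < t < pi -> - pi < x < pi -> t < x -> 1 / 2 < ray_fun x t.
Proof.
move=> /andP[t1 t2] /andP[x1 x2] xt; rewrite ray_funE.
have c0 : 0 < cos (t / 2) by apply: cos_gt0_pihalf; apply/andP; split; lra.
have s0 : 0 < sin ((x - t) / 2) by apply: sin_gt0_pi; apply/andP; split; lra.
have := mulr_gt0 c0 s0; lra.
Qed.

Lemma circ_ae_neq a : circ_ae (fun t : R => t <> a).
Proof.
apply/circ_aeN; exists [set a]; split; first exact: measurable_set1.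
  exact: lebesgue_measure_set1.
by move=> t [_ h]; exact: contrapT.
Qed.

End Rays.

Section Density.
Import HBNNSimple.
Context {R : realType} {T : nat}.
Implicit Types (f g h p : R -> 'cV[R[i]]_T) (phi psi : R -> R) (A B : set R).
Local Notation circ := (@circ R).
Variable W : R -> 'M[R[i]]_T.
Hypothesis hW : weight W.
Hypothesis iW : integrable_mx W.
Let ph := ph_w hW.
Variable S : set (R -> 'cV[R[i]]_T).
Hypothesis S0 : S 0.
Hypothesis SL : forall f, S f -> L2w W f.
Hypothesis Slin : forall c f g, S f -> S g -> S (c *: f + g).
Local Notation cl := (ncl (L2w W) (ipw W) S).
Local Notation multiplier := (multiplier W S).

Lemma multiplier_ray x : multiplier cos -> multiplier sin ->
  multiplier (fun t => \1_(`]x, +oo[%classic : set R) t).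
Proof.
move=> hc hs.
have bi : bmeas (fun t => \1_(`]x, +oo[%classic : set R) t) (1 : R).
  split; last by move=> t _; rewrite indicE; case: (_ \in _); rewrite ?normr1 ?normr0.
  by apply: measurable_funTS; exact: measurable_indic.
(* When x lies outside ]-pi, pi[, the indicator is almost everywhere constant on the circle. *)
have cstlim (c : R) : `|c| <= 1 -> circ_ae (fun t => t <> - pi -> t <> pi ->
    \1_(`]x, +oo[%classic : set R) t = c) ->
    multiplier (fun t => \1_(`]x, +oo[%classic : set R) t).
  move=> c1 hx; apply: (multiplier_lim hW SL (phi_ := fun=> cst c) (M := 1)).
  - by move=> n; exact (multiplier_cst hW S0 SL Slin c).
  - by [].
  - exact: bi.
  apply: circ_aeS (circ_aeI hx (circ_aeI (circ_ae_neq (- pi)) (circ_ae_neq pi))).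
  by move=> t ct [h [t1 t2]]; rewrite h// subrr; exact: cvg_cst.
have circE t : circ t -> t <> - pi -> t <> pi -> - pi < t < pi.
  rewrite /Defs.circ /= in_itv /= => /andP[a b] /eqP na /eqP nb.
  by rewrite !lt_neqAle a b eq_sym na nb.
have [x1|x1] := leP x (- pi).
  apply: (cstlim 1); rewrite ?normr1//; apply: circ_aeT => t ct t1 t2.
  have /andP[h _] := circE t ct t1 t2.
  by rewrite indicE mem_set//= in_itv /= andbT (le_lt_trans x1 h).
have [x2|x2] := leP pi x.
  apply: (cstlim 0); rewrite ?normr0//; apply: circ_aeT => t ct t1 t2.
  have /andP[_ h] := circE t ct t1 t2.
  rewrite indicE memNset//= in_itv /= andbT => xt.
  by have := lt_trans (le_lt_trans x2 xt) h; rewrite ltxx.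
have xI : - pi < x < pi by rewrite x1.
have hr : multiplier (ray_fun x).
  have := multiplier_lin hW S0 SL Slin 1 1
    (multiplier_cst hW S0 SL Slin (1 / 2 + sin (x / 2) / 4))
    (multiplier_lin hW S0 SL Slin (sin (x / 2) / 4) (- cos (x / 2) / 4) hc hs).
  by congr multiplier; apply/funext => t; rewrite /ray_fun !mul1r.
apply: (multiplier_lim hW SL (phi_ := fun n t => step_poly n (ray_fun x t)) (M := 1)).
- move=> n; rewrite /step_poly.
  apply: (multiplierX (phi := fun t => 1 - ray_fun x t ^+ n) hW SL (2 ^ n)).
  have := multiplier_lin hW S0 SL Slin 1 (-1)
    (multiplier1 hW SL) (multiplierX hW SL n hr).
  by congr multiplier; apply/funext => t; rewrite mul1r mulN1r.
- move=> n t _; have /andP[h1 h2] := step_poly_itv n (ray_fun_itv x t).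
  by rewrite ger0_norm.
- exact: bi.
- apply: circ_aeS (circ_aeI (circ_ae_neq x)
    (circ_aeI (circ_ae_neq (- pi)) (circ_ae_neq pi))).
  move=> t ct [/eqP tx [t1 t2]]; have tI := circE t ct t1 t2.
  have /andP[r0 r1] := ray_fun_itv x t.
  have [xt|xt|xt] := ltgtP x t; last by rewrite xt eqxx in tx.
    rewrite indicE mem_set/= ?in_itv/= ?xt//; apply: step_poly_small.
    by rewrite r0 ray_fun_lt.
  rewrite indicE memNset/= ?in_itv/= ?andbT; last by apply/negP; rewrite -leNgt ltW.
  by apply: step_poly_large; rewrite r1 ray_fun_gt.
Qed.

Hypothesis hI : forall A, measurable A -> multiplier (fun t => \1_A t).

(** Simple functions increasing to phi are combinations of indicators and inherit the bound of
    phi. *)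
Lemma multiplier_ge0 phi (M : R) : bmeas phi M -> (forall t, circ t -> 0 <= phi t) ->
  multiplier phi.
Proof.
move=> bp p0; have mp := bp.1.
have mE : measurable_fun (circ : set (measurableTypeR R)) (EFin \o phi).
  by apply/measurable_EFinP; rewrite -measurable_fun_lebE.
pose s0 n := nnsfun_approx measurable_circ mE n.
pose s n : R -> R := (s0 n : measurableTypeR R -> R).
have s_le n t : circ t -> s n t <= phi t.
  move=> ct; rewrite -lee_fin /s /s0 nnsfun_approxE.
  by apply: le_approx => // u cu; rewrite lee_fin p0.
have s_ge0 n t : 0 <= s n t by exact: fun_ge0.
apply: (multiplier_lim hW SL (phi_ := s) (M := M)).
- move=> n.
  have [r E] : exists r : seq R,
      s n = fun t => \sum_(y <- r) (y * \1_(s0 n @^-1` [set y]) t).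
    by eexists; apply/funext => t; rewrite /s fimfunE fsbig_finite.
  rewrite E; elim: r {E} => [|y l ih].
    rewrite (_ : (fun t => _) = fun=> 0); first exact (multiplier_cst hW S0 SL Slin 0).
    by apply/funext => t; rewrite big_nil.
  rewrite (_ : (fun t => _) = fun t => y * \1_(s0 n @^-1` [set y]) t +
    1 * \sum_(y <- l) (y * \1_(s0 n @^-1` [set y]) t)).
    apply: (multiplier_lin hW S0 SL Slin _ _ _ ih); apply: hI.
    by rewrite measurable_lebE; apply: measurable_funPTI; exact: measurable_set1.
  by apply/funext => t; rewrite big_cons mul1r.
- move=> n t ct; rewrite ger0_norm//; apply: (le_trans (s_le n t ct)).
  by apply: (le_trans (ler_norm _)); exact: bp.2.
- exact: bp.
- apply: circ_aeT => t ct.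
  have /fine_cvg h : (EFin \o (fun n => s n t)) @ \oo --> (phi t)%:E.
    by apply: (cvg_nnsfun_approx measurable_circ mE) => // u cu; rewrite lee_fin p0.
  rewrite -(subrr (phi t)); apply: cvgB; [exact: h|exact: cvg_cst].
Qed.

Lemma multiplier_bmeas phi (M : R) : bmeas phi M -> multiplier phi.
Proof.
move=> bp.
(* Adding the bound makes phi nonnegative; the constant is subtracted again afterwards. *)
have bp' : bmeas (fun t => phi t + M) (M + M).
  split; first by apply: measurable_funD; [exact: bp.1|exact: measurable_cst].
  move=> t ct; have h := bp.2 t ct; apply: (le_trans (ler_normD _ _)).
  by rewrite lerD// ger0_norm//; apply: le_trans h.
have := multiplier_lin hW S0 SL Slin 1 (- M)
  (multiplier_ge0 bp' _) (multiplier1 hW SL).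
rewrite (_ : (fun t => _) = phi); last by apply/funext => t; rewrite mul1r mulr1 addrK.
apply=> t ct; have := bp.2 t ct; rewrite ler_norml; lra.
Qed.

Hypothesis hS : forall k, cl (fun=> delta k).

Lemma ncl_bounded f (M : R) : measurable_vec f ->
  (forall t, circ t -> forall k, nsq (f t k 0) <= M) -> cl f.
Proof.
move=> mf fM.
(* Multipliers are real-valued, so each coordinate is split into its real and imaginary part. *)
have E : f = \sum_k (mulv (fun t => Re (f t k 0)) (fun=> delta k) +
    'i%C *: mulv (fun t => Im (f t k 0)) (fun=> delta k)).
  apply/funext => t; rewrite fct_sumE; apply/colP => l; rewrite summxE (bigD1 l)//=.
  rewrite big1 ?addr0; last first.
    by move=> k kl; rewrite !mxE eq_sym (negbTE kl) !mulr0 addr0.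
  rewrite !mxE !eqxx !mulr1; exact: complexE.
(* 1 + M replaces the square root of M. *)
have bM (c : R) : nsq (c%:C) <= M -> `|c| <= 1 + M.
  rewrite nsqZ => h; have := sqr_ge0 (`|c| - 1); rewrite -[c ^+ 2]real_normK ?num_real// in h.
  move: h; move: `|c| => a; rewrite !expr2; nra.
rewrite {1}E; apply: (ncl_sum ph S0 SL Slin) => k _.
rewrite -[X in X + _]scale1r; apply: (ncl_lin ph SL Slin); last apply: (nclZ ph S0 SL Slin).
  apply: (multiplier_cl hW SL _ (hS k)); apply: (@multiplier_bmeas _ (1 + M)).
  split; first exact: (mf k).1.
  move=> t ct; apply: bM; rewrite nsqZ; apply: (le_trans (Re_sqr_le _)); exact: fM.
apply: (multiplier_cl hW SL _ (hS k)); apply: (@multiplier_bmeas _ (1 + M)).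
  split; first exact: (mf k).2.
move=> t ct; apply: bM; rewrite nsqZ; apply: (le_trans (Im_sqr_le _)); exact: fM.
Qed.

Lemma ncl_all f : L2w W f -> cl f.
Proof.
move=> hf; pose q t := \sum_k nsq (f t k 0).
have mq : measurable_fun (circ : set (measurableTypeR R)) q.
  rewrite -measurable_fun_lebE; have := (measurable_qform weight1 hf.1).
  by congr measurable_fun; apply/funext => t; rewrite qform1.
have q0 t : 0 <= q t by apply: sumr_ge0 => k _; exact: nsq_ge0.
(* Truncation: f is bounded on E n, and every point of the circle lies in E n for all large n. *)
pose E (n : nat) : set R := circ `&` [set t | q t <= n%:R].
have mE n : measurable (E n).
  rewrite measurable_lebE /E; have := mq measurable_circ `]-oo, n%:R]%classic (measurable_itv _).
  by congr measurable; apply/seteqP; split => t /= [ct]; rewrite in_itv.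
have bE n : bmeas (fun t => \1_(E n) t) (1 : R).
  split; last by move=> t _; rewrite indicE; case: (_ \in _); rewrite ?normr1 ?normr0.
  by apply: measurable_funTS; exact: measurable_indic.
pose u n := mulv (fun t => \1_(E n) t) f.
have Lu n : L2w W (u n) by exact: L2w_mulv (bE n) hf.
have EB n t : u n t - f t = mulv (fun t => \1_(E n) t - 1) f t.
  by rewrite /u /mulv rmorphB scalerBl scale1r.
have hi n t : ((\1_(E n) t - 1) ^+ 2 <= 1 :> R).
  by rewrite indicE; case: (_ \in _); rewrite ?subrr ?sub0r ?sqrrN ?expr1n ?expr0n.
apply: (ncl_lim ph SL (u := u)).
- exact: hf.
- move=> n; apply: (@ncl_bounded _ n%:R); first exact: (Lu n).1.
  move=> t ct k; rewrite /u /mulv mxE nsqM nsqZ indicE.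
  have [[_ /= h]|h] := pselect (E n t).
    rewrite mem_set//= expr1n mul1r; apply: le_trans h.
    by rewrite /q (bigD1 k)//= lerDl; apply: sumr_ge0 => l _; exact: nsq_ge0.
  by rewrite memNset//= expr0n mul0r.
- apply: (ncvg_w (G := fun t => Re (qform (W t) (f t))) hW hf.1).
  + by move=> n; exact: (Lu n).1.
  + exact: L2w_integrable.
  + move=> n t ct; rewrite EB qform_mulv ler_piMl// qform_Re_ge0//.
  + apply: circ_aeT => t ct; apply/cvg0P => e e0.
    exists (Num.truncn (q t)).+1 => n hn; rewrite EB qform_mulv indicE mem_set/=.
      by rewrite subrr expr0n mul0r normr0.
    split => //=; apply: ltW; apply: (lt_le_trans (truncnS_gt _)).
    by rewrite ler_nat.
Qed.

End Density.

Section Trigonometric.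
Context {R : realType} {T : nat}.
Implicit Types (f g h : R -> 'cV[R[i]]_T) (W : R -> 'M[R[i]]_T).
Local Notation circ := (@circ R).

Lemma cisD (x y : R) : cis (x + y) = cis x * cis y.
Proof. by apply: complex_eqP; rewrite !ReImE /= ?cosD ?sinD //; ring. Qed.
Lemma cisN (x : R) : cis (- x) = Num.conj (cis x).
Proof. by apply: complex_eqP; rewrite !ReImE /= ?cosN ?sinN. Qed.
Lemma cis0 : cis (0 : R) = 1.
Proof. by apply: complex_eqP; rewrite /= ?cos0 ?sin0. Qed.
Lemma nsq_cis (x : R) : nsq (cis x) = 1.
Proof. by rewrite nsqE /= cos2Dsin2. Qed.
Lemma cisDn (m n : int) (t : R) : cis ((m + n)%:~R * t) = cis (m%:~R * t) * cis (n%:~R * t).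
Proof. by rewrite intrD mulrDl cisD. Qed.
Lemma cisNn (n : int) (t : R) : cis ((- n)%:~R * t) = Num.conj (cis (n%:~R * t)).
Proof. by rewrite intrN mulNr cisN. Qed.
Lemma cmeasurable_cis (n : int) : cmeasurable circ (fun t => cis (n%:~R * t)).
Proof.
have mn : measurable_fun circ (fun t : R => n%:~R * t).
  by apply: measurable_funM; [exact: measurable_cst|exact: measurable_id].
split => /=; apply: (measurableT_comp _ mn); apply: continuous_measurable_fun;
  [exact: continuous_cos|exact: continuous_sin].
Qed.

Definition chi (i : int * 'I_T) : R -> 'cV[R[i]]_T := char_fun i.1 i.2.

Lemma chiE i t l : chi i t l 0 = cis (i.1%:~R * t) * (l == i.2)%:R.
Proof. by rewrite /chi /char_fun !mxE eqxx andbT. Qed.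

Lemma measurable_chi i : measurable_vec (chi i).
Proof.
move=> l; apply: eq_cmeasurable; first by move=> t _; rewrite chiE.
by apply: cmeasurableM; [exact: cmeasurable_cis|exact: cmeasurable_cst].
Qed.

Lemma nsq_chi i t l : nsq (chi i t l 0) <= 1.
Proof.
by rewrite chiE nsqM nsq_cis mul1r; case: (_ == _); rewrite /= ?nsq0// nsqE /= expr1n expr0n addr0.
Qed.

Lemma L2w_chi W i : weight W -> integrable_mx W -> L2w W (chi i).
Proof.
by move=> hW iW; apply: (L2w_bounded hW iW (measurable_chi i)) => t _ k; exact: nsq_chi.
Qed.

Definition trigs : set (R -> 'cV[R[i]]_T) := [set f | exists p, f = comb chi p].

Lemma trigs_lin c f g : trigs f -> trigs g -> trigs (c *: f + g).
Proof.
by move=> [p ->] [q ->]; exists (scaleseq c p ++ q); rewrite comb_cat comb_scale.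
Qed.

Lemma trigs0 : trigs 0. Proof. by exists [::]; rewrite /comb big_nil. Qed.

Lemma trigs_L2w W f : weight W -> integrable_mx W -> trigs f -> L2w W f.
Proof.
move=> hW iW [p ->]; apply: (comb_L (ph_w hW)); first exact: L2w0.
by move=> i; exact: L2w_chi.
Qed.

Lemma comb_shift n p : comb (fun i => chi (i.1 + n, i.2)) p =
  fun t => cis (n%:~R * t) *: comb chi p t.
Proof.
apply/funext => t; rewrite /comb !fct_sumE scaler_sumr; apply: eq_bigr => r _.
transitivity (r.1 *: (cis ((r.2.1 + n)%:~R * t) *: delta r.2.2)); first by [].
transitivity (cis (n%:~R * t) *: (r.1 *: (cis (r.2.1%:~R * t) *: delta r.2.2))); last by [].
by rewrite cisDn !scalerA; congr (_ *: _); ring.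
Qed.

Lemma trigs_shift n f : trigs f -> trigs (fun t => cis (n%:~R * t) *: f t).
Proof.
move=> [p ->]; rewrite -comb_shift; exists [seq (r.1, (r.2.1 + n, r.2.2)) | r <- p].
by rewrite /comb big_map.
Qed.

Lemma trigs_cos f : trigs f -> trigs (mulv cos f).
Proof.
move=> hf; rewrite (_ : mulv _ _ = (2^-1)%:C *: (fun t => cis (1%:~R * t) *: f t) +
  ((2^-1)%:C *: (fun t => cis ((-1)%:~R * t) *: f t) + 0)).
  by apply: trigs_lin; [exact: trigs_shift|apply: trigs_lin; [exact: trigs_shift|exact: trigs0]].
apply/funext => t; rewrite addr0 /mulv.
rewrite [RHS](_ : _ = ((2^-1)%:C * cis (1%:~R * t) + (2^-1)%:C * cis ((-1)%:~R * t)) *: f t).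
  congr (_ *: _); rewrite cisNn mul1r; apply: complex_eqP; rewrite !ReImE /=; by field.
by rewrite scalerDl -!scalerA.
Qed.

Lemma trigs_sin f : trigs f -> trigs (mulv sin f).
Proof.
move=> hf; rewrite (_ : mulv _ _ = (0 -i* 2^-1) *: (fun t => cis (1%:~R * t) *: f t) +
  ((0 +i* 2^-1) *: (fun t => cis ((-1)%:~R * t) *: f t) + 0)).
  by apply: trigs_lin; [exact: trigs_shift|apply: trigs_lin; [exact: trigs_shift|exact: trigs0]].
apply/funext => t; rewrite addr0 /mulv.
rewrite [RHS](_ : _ = ((0 -i* 2^-1) * cis (1%:~R * t) + (0 +i* 2^-1) * cis ((-1)%:~R * t)) *: f t).
  congr (_ *: _); rewrite cisNn mul1r; apply: complex_eqP; rewrite !ReImE /=; by field.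
by rewrite scalerDl -!scalerA.
Qed.

(** Multiplication by cos and sin only shifts frequencies, so both are multipliers of the
    trigonometric polynomials, and the algebra they generate reaches all indicators. No lower bound
    on W is involved: W may be degenerate. *)
Lemma trigs_dense W f (e : R) : weight W -> integrable_mx W -> L2w W f -> 0 < e ->
  exists p, n2 (ipw W) (f - comb chi p) < e.
Proof.
move=> hW iW hf e0.
have SL g : trigs g -> L2w W g by exact: trigs_L2w.
have hc : multiplier W trigs cos.
  split; last by move=> g hg; apply: (subset_ncl (ph_w hW) SL); exact: trigs_cos.
  exists 1; split; last by move=> t _; exact: cos_max.
  by apply: measurable_funTS; apply: continuous_measurable_fun; exact: continuous_cos.
have hs : multiplier W trigs sin.
  split; last by move=> g hg; apply: (subset_ncl (ph_w hW) SL); exact: trigs_sin.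
  exists 1; split; last by move=> t _; exact: sin_max.
  by apply: measurable_funTS; apply: continuous_measurable_fun; exact: continuous_sin.
have hI A : measurable A -> multiplier W trigs (fun t => \1_A t).
  move=> mA; apply: (@mset_all _ _ W hW trigs trigs0 SL trigs_lin _ A mA).2 => x.
  split; first exact: measurable_itv.
  exact (multiplier_ray hW trigs0 SL trigs_lin x hc hs).
have hS k : ncl (L2w W) (ipw W) trigs (fun=> delta k).
  apply: (subset_ncl (ph_w hW) SL); exists [:: (1, (0, k))]; rewrite comb1.
  by apply/funext => t; rewrite /chi /char_fun /= mul0r cis0 scale1r.
have [_ h] := ncl_all hW trigs0 SL trigs_lin hI hS hf.
by have [_ [[p ->] hp]] := h e e0; exists p.
Qed.

End Trigonometric.

(** * Toeplitz operators on l2(U) *)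

Section IntegerSums.
Context {R : realType}.
Implicit Types (D : set int) (f : int -> R[i]) (g : int -> R).

Lemma mem_zrange (n : nat) (j : int) : (j \in zrange n) = (`|j| <= n)%N.
Proof.
apply/idP/idP => [/mapP[k]|jn].
  by rewrite mem_iota => /andP[_ h] ->; lia.
by apply/mapP; exists `|(j + n%:Z)%R|%N; [rewrite mem_iota; lia|lia].
Qed.

Lemma zrange_uniq n : uniq (zrange n).
Proof.
rewrite map_inj_in_uniq ?iota_uniq// => i j _ _ /= h; lia.
Qed.

Lemma sum_subseq (r1 r2 : seq int) g : uniq r1 -> uniq r2 -> {subset r1 <= r2} ->
  (forall j, j \in r2 -> 0 <= g j) -> \sum_(j <- r1) g j <= \sum_(j <- r2) g j.
Proof.
move=> u1 u2 s12 g0.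
have Hp : perm_eq [seq j <- r2 | j \in r1] r1.
  apply: uniq_perm; rewrite ?filter_uniq// => j.
  by rewrite mem_filter; case: (boolP (j \in r1)) => //= /s12.
rewrite [leRHS](bigID (fun j => j \in r1)) /= -[X in _ <= X + _]big_filter (perm_big _ Hp) /=.
by rewrite lerDl big_seq_cond; apply: sumr_ge0 => j /andP[/g0].
Qed.

Lemma psum_filter (V : nmodType) D (f : int -> V) n :
  psum D f n = \sum_(j <- [seq j <- zrange n | j \in D]) f j.
Proof. by rewrite big_filter. Qed.

Lemma psum_mono D g m n : (forall j, D j -> 0 <= g j) -> (m <= n)%N ->
  psum D g m <= psum D g n.
Proof.
move=> g0 mn; rewrite !psum_filter; apply: sum_subseq; rewrite ?filter_uniq ?zrange_uniq//.
  move=> j; rewrite !mem_filter => /andP[-> ]; rewrite !mem_zrange => h.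
  exact: leq_trans mn.
by move=> j; rewrite mem_filter => /andP[/set_mem /g0].
Qed.

Lemma psum_ge0 D g n : (forall j, D j -> 0 <= g j) -> 0 <= psum D g n.
Proof. by move=> g0; apply: sumr_ge0 => j /set_mem /g0. Qed.

Lemma esum_le_psum D g (M : R) : (forall j, D j -> 0 <= g j) ->
  (forall L, psum D g L <= M) -> (\esum_(j in D) (g j)%:E <= M%:E)%E.
Proof.
move=> g0 gM; apply: ge_ereal_sup => _ [X [fX XD] <-].
rewrite fsbig_finite//= sumEFin lee_fin.
have rX j : j \in finmap.enum_fset (fset_set X) -> j \in X by rewrite -(in_fset_set fX).
(* The sum of the absolute values dominates each of them, so X lies in [zrange L]. *)
pose L := \sum_(j <- finmap.enum_fset (fset_set X)) `|j|%N.
apply: (le_trans _ (gM L)); rewrite psum_filter; apply: sum_subseq.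
- exact: finmap.fset_uniq.
- by rewrite filter_uniq// zrange_uniq.
- move=> j jX; rewrite mem_filter; apply/andP; split.
    by apply/mem_set/XD/set_mem/rX.
  by rewrite mem_zrange /L (big_rem j)//= leq_addr.
- by move=> j; rewrite mem_filter => /andP[/set_mem /g0].
Qed.

Lemma psum_le_esum D g L : (forall j, D j -> 0 <= g j) ->
  (\esum_(j in D) (g j)%:E < +oo)%E -> psum D g L <= fine (\esum_(j in D) (g j)%:E)%E.
Proof.
move=> g0 foo; rewrite -lee_fin fineK; last first.
  by rewrite ge0_fin_numE//; apply: esum_ge0 => j /g0; rewrite lee_fin.
apply: ereal_sup_ubound.
exists [set` [seq j <- zrange L | j \in D]].
  split; first exact: finite_seq.
  move=> j /= jr; have := jr : j \in [seq j <- zrange L | j \in D].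
  by rewrite mem_filter => /andP[/set_mem].
by rewrite -fsbig_seq ?filter_uniq ?zrange_uniq//= sumEFin psum_filter.
Qed.

Lemma psum_cvg_ge0 D g (M : R) : (forall j, D j -> 0 <= g j) ->
  (forall L, psum D g L <= M) -> cvgn (fun n => psum D g n).
Proof.
move=> g0 gM; apply: nondecreasing_is_cvgn; first by move=> m n; exact: psum_mono.
by exists M => _ [n _ <-].
Qed.

Lemma psum_cvg_abs D g h : (forall j, D j -> `|g j| <= h j) ->
  (\esum_(j in D) (h j)%:E < +oo)%E -> cvgn (fun n => psum D g n).
Proof.
move=> gh hoo; have h0 j : D j -> 0 <= h j by move=> /gh; exact: le_trans.
have hM L := psum_le_esum L h0 hoo.
have c1 := psum_cvg_ge0 h0 hM.
(* g is the difference of the nonnegative families h + g <= 2 h and h, whose partial sums are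
   monotone and bounded. *)
have c2 : cvgn (fun n => psum D (fun j => h j + g j) n).
  apply: (@psum_cvg_ge0 _ _ (2 * fine (\esum_(j in D) (h j)%:E)%E)).
    by move=> j /gh; rewrite ler_norml; lra.
  move=> L; apply: (@le_trans _ _ (psum D (fun j => 2 * h j) L)).
    by apply: ler_sum => j /set_mem /gh; rewrite ler_norml; lra.
  by rewrite /psum -mulr_sumr ler_wpM2l//; exact: hM.
have -> : (fun n => psum D g n) =
    (fun n => psum D (fun j => h j + g j) n) - (fun n => psum D h n).
  by apply/funext => n; rewrite /psum !fctE -sumrB; apply: eq_bigr => j _; rewrite addrC addKr.
exact: is_cvgB.
Qed.

Lemma psum_Re D f n : Re (psum D f n) = psum D (fun j => Re (f j)) n.
Proof. exact: cRe_sum. Qed.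
Lemma psum_Im D f n : Im (psum D f n) = psum D (fun j => Im (f j)) n.
Proof. exact: cIm_sum. Qed.

Lemma ccvgP (u : nat -> R[i]) (l : R[i]) : ccvg u l <->
  (fun n => Re (u n)) @ \oo --> Re l /\
  (fun n => Im (u n)) @ \oo --> Im l.
Proof.
split=> [h|[h1 h2]].
  have aux (v : nat -> R) (a : R) : (forall n, (v n - a) ^+ 2 <= nsq (u n - l)) ->
      v @ \oo --> a.
    move=> hv; apply/(@cvg_sub0 _ _ _ _ _ _ (cst a)); last exact: cvg_cst.
    apply/cvg0P => e e0; have /cvg0P/(_ _ (exprn_gt0 2 e0))[n0 hn] := h.
    exists n0 => n /hn; rewrite ger0_norm ?nsq_ge0// => hl.
    rewrite -(ltr_pXn2r (n:=2)) ?nnegrE// ?ltW// real_normK ?num_real//.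
    exact: le_lt_trans (hv n) hl.
  split; apply: aux => n; rewrite -?cReB -?cImB; [exact: Re_sqr_le|exact: Im_sqr_le].
rewrite /ccvg.
have -> : (fun n => nsq (u n - l)) = (fun n =>
   (Re (u n) - Re l) * (Re (u n) - Re l) +
   (Im (u n) - Im l) * (Im (u n) - Im l)).
  by apply/funext => n; rewrite nsqE cReB cImB !expr2.
have d (v : nat -> R) (a : R) : v @ \oo --> a -> (fun n => v n - a) @ \oo --> (0 : R).
  by move=> h; rewrite -(subrr a); apply: cvgB => //; exact: cvg_cst.
have := cvgD (cvgM (d _ _ h1) (d _ _ h1)) (cvgM (d _ _ h2) (d _ _ h2)).
by rewrite mul0r addr0; exact.
Qed.

Lemma csum_cvg D f : abs_summable D f -> ccvg (psum D f) (csum D f).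
Proof.
move=> hf; apply/ccvgP; split => /=.
  have c : cvgn (fun n => Re (psum D f n)).
    under eq_fun do rewrite psum_Re.
    by apply: (psum_cvg_abs _ hf) => j _; exact: Re_le_normc.
  exact: c.
have c : cvgn (fun n => Im (psum D f n)).
  under eq_fun do rewrite psum_Im.
  by apply: (psum_cvg_abs _ hf) => j _; exact: Im_le_normc.
exact: c.
Qed.

Lemma csum_lim D f l : ccvg (psum D f) l -> csum D f = l.
Proof.
by move=> /ccvgP[h1 h2]; apply: complex_eqP => /=; apply/cvg_lim.
Qed.

Lemma ccvg_unique (u : nat -> R[i]) l l' : ccvg u l -> ccvg u l' -> l = l'.
Proof.
move=> /ccvgP[h1 h2] /ccvgP[h1' h2']; apply: complex_eqP.
  exact: cvg_unique h1 h1'.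
exact: cvg_unique h2 h2'.
Qed.

End IntegerSums.

(** * Orthonormal exponentials and partial Fourier sums *)

Section Orthogonality.
Context {R : realType} {T : nat}.
Local Notation leb := (@lebesgue_measure R).
Local Notation circ := (@circ R).

Lemma sin_nat_pi (n : nat) : sin (n%:R * pi) = 0 :> R.
Proof.
elim: n => [|n ih]; first by rewrite mul0r sin0.
by rewrite -natr1 mulrDl mul1r sinD ih sinpi mul0r mulr0 addr0.
Qed.

Lemma sin_int_pi (n : int) : sin (n%:~R * pi) = 0 :> R.
Proof.
case: n => n; first exact: sin_nat_pi.
by rewrite NegzE intrN mulNr sinN sin_nat_pi oppr0.
Qed.

Lemma integral_deriv (f F : R -> R) : (forall t : R, is_derive t (1 : R) F (f t)) ->
  continuous f -> Rintegral leb circ f = F pi - F (- pi).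
Proof.
move=> dF cf; rewrite /Rintegral (@continuous_FTC2 _ f F)//.
- by have := pi_gt0 R; lra.
- exact: continuous_subspaceT.
- have cF t : {for t, continuous F}.
    by apply: differentiable_continuous; apply/derivable1_diffP; exact: ex_derive.
  split; first by move=> t _; exact: ex_derive.
    by apply: cvg_at_right_filter; exact: cF.
  by apply: cvg_at_left_filter; exact: cF.
- by move=> t _; rewrite derive1E; exact: derive_val.
Qed.

Lemma circ_length : leb circ = (2 * pi)%:E.
Proof.
rewrite [LHS]lebesgue_measure_itv/= lte_fin ifT; last by have := pi_gt0 R; lra.
by rewrite -EFinB; congr EFin; ring.
Qed.

Lemma cmean_cst (c : R[i]) : cmean (fun=> c) = c.
Proof.
have E (r : R) : Rintegral leb circ (fun=> r) = 2 * pi * r.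
  by rewrite (Rintegral_cst _ measurable_circ) [X in fine X]circ_length mulrC.
rewrite /cmean; apply: complex_eqP; rewrite ?cReZ ?cImZ /= E mulrA mulVf ?mul1r//;
  by rewrite gt_eqF// two_pi_gt0.
Qed.

Lemma cmean_cis (n : int) : cmean (fun t : R => cis (n%:~R * t)) = (n == 0)%:R.
Proof.
have [->|n0] := eqVneq n 0.
  by under [X in cmean X]eq_fun do rewrite mul0r cis0; exact: cmean_cst.
pose c : R := n%:~R; have c0 : c != 0 by rewrite intr_eq0.
have ccont : continuous (fun t : R => c * t) by exact: mulrl_continuous.
rewrite /cmean; apply: complex_eqP; rewrite ?cReZ ?cImZ /=.
  have dF (t : R) : is_derive t (1 : R) (c^-1 \*: (sin \o (c \*: id))) (cos (c * t)).
    by apply: is_derive_eq; rewrite /GRing.scale /= mulr1 mulrC -mulrA divff// mulr1.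
  rewrite (integral_deriv dF).
    by rewrite /= /GRing.scale /= mulrN sinN sin_int_pi oppr0 mulr0 subrr mulr0.
  by move=> t; apply: continuous_comp; [exact: ccont|exact: continuous_cos].
have dF (t : R) : is_derive t (1 : R) ((- c^-1) \*: (cos \o (c \*: id))) (sin (c * t)).
  apply: is_derive_eq.
  by rewrite /GRing.scale /=; field.
rewrite (integral_deriv dF).
  by rewrite /= /GRing.scale /= mulrN cosN subrr mulr0.
by move=> t; apply: continuous_comp; [exact: ccont|exact: continuous_sin].
Qed.

End Orthogonality.

Lemma col_eq0 (R : realType) T (v : 'cV[R[i]]_T) i : v = 0 -> v i 0 = 0.
Proof. by move=> ->; rewrite mxE. Qed.

Section TrigonometricSums.
Context {R : realType} {T : nat}.
Implicit Types (z x y : int -> 'cV[R[i]]_T) (p q : seq (R[i] * (int * 'I_T))).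
Implicit Types (W : R -> 'M[R[i]]_T).
Local Notation chi := (@chi R T).
Local Notation leb := (@lebesgue_measure R).
Local Notation circ := (@circ R).
Local Notation ip1 := (ipw (fun=> 1%:M : 'M[R[i]]_T)).
Local Notation N1 := (n2 ip1).

Lemma integrable_mx1 : integrable_mx (fun=> 1%:M : 'M[R[i]]_T).
Proof.
move=> k l; apply: (cintegrable_le (m := leb) measurable_circ (h := cst (normc ((1%:M : 'M[R[i]]_T) k l)))).
- exact: cmeasurable_cst.
- by [].
- apply/integrableP; split; first exact/measurable_EFinP/measurable_cst.
  under eq_integral do rewrite /=.
  by rewrite integral_cst ?[X in (_ * X)%E]circ_length -?EFinM ?ltry//; exact: measurable_circ.
Qed.

Let h1 := @weight1 R T.
Let i1 := integrable_mx1.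
Let ph1 := ph_w h1.

Lemma L2w1_chi i : L2w (fun=> 1%:M) (chi i). Proof. exact: L2w_chi. Qed.

Lemma bform_delta (W : 'M[R[i]]_T) l m (a b : R[i]) :
  bform W (a *: delta l) (b *: delta m) = a * W l m * Num.conj b.
Proof.
rewrite /bform /delta linearZ /= conj_mxZ -scalemxAr -!scalemxAl.
rewrite (_ : conj_mx (delta_mx m 0) = delta_mx m 0 :> 'cV[R[i]]_T); last first.
  by apply/matrixP => i j; rewrite !mxE; case: (_ && _); rewrite ?conj1 ?conj0.
by rewrite trmx_delta -rowE -colE !mxE; ring.
Qed.

Lemma ip1_chi i j : ip1 (chi i) (chi j) = (i == j)%:R.
Proof.
rewrite ipwE.
under [X in cmean X]eq_fun do rewrite bform_delta mxE -cisNn mulrAC -cisDn mulrC.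
case: i j => [n k] [m l] /=; have [kl|kl] := eqVneq k l; last first.
  under eq_fun do rewrite mul0r; rewrite cmean_cst.
  by rewrite xpair_eqE (negbTE kl) andbF.
under eq_fun do rewrite mul1r; rewrite cmean_cis subr_eq0 kl.
by rewrite xpair_eqE eqxx andbT.
Qed.

(** The symmetric partial sum of the Fourier series with coefficients z, over all frequencies and
    not only those in U; on sequences vanishing off U the two agree ([psum_Tz]). *)
Definition Tz z (L : nat) : R -> 'cV[R[i]]_T :=
  \sum_(j <- zrange L) \sum_i z j i 0 *: chi (j, i).

Lemma TzE z L t : Tz z L t = \sum_(j <- zrange L) cis (j%:~R * t) *: z j.
Proof.
rewrite /Tz fct_sumE; apply: eq_bigr => j _; rewrite fct_sumE.
apply/colP => l.
have E k : (z j k 0 *: chi (j, k)) t l 0 = z j k 0 * (cis (j%:~R * t) * (l == k)%:R).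
  by rewrite [LHS]mxE; congr (_ * _); exact: (chiE (j, k)).
rewrite summxE (bigD1 l)//= E eqxx mulr1 big1 ?addr0; first by rewrite mulrC mxE.
by move=> k kl; rewrite E eq_sym (negbTE kl) !mulr0.
Qed.

Lemma L2w_Tz W z L : weight W -> integrable_mx W -> L2w W (Tz z L).
Proof.
move=> hW iW; have L0 := L2w0 hW iW.
apply: (ph_sum (ph_w hW)); [exact: L0|move=> j _].
apply: (ph_sum (ph_w hW)); [exact: L0|move=> k _].
by apply: (phZ (ph_w hW)); exact: L2w_chi.
Qed.

Lemma ip_TzE W z L f : weight W -> integrable_mx W -> L2w W f ->
  ipw W (Tz z L) f = \sum_(j <- zrange L) \sum_i z j i 0 * ipw W (chi (j, i)) f.
Proof.
move=> hW iW hf; have L0 := L2w0 hW iW; have ph := ph_w hW.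
have hc i : L2w W (chi i) by exact: L2w_chi.
have hZ j k : L2w W (z j k 0 *: chi (j, k)) by apply: (phZ ph); exact: hc.
have hS j : L2w W (\sum_k z j k 0 *: chi (j, k)).
  by apply: (ph_sum ph); [exact: L0|move=> k _; exact: hZ].
rewrite (ip_suml ph _ hf (fun j _ => hS j)); apply: eq_bigr => j _.
rewrite (ip_suml ph _ hf (fun k _ => hZ j k)); apply: eq_bigr => k _.
exact: (ipZl ph _ (hc _) hf).
Qed.

Lemma ip1_Tz z L (k : int) i : (`|k| <= L)%N -> ip1 (Tz z L) (chi (k, i)) = z k i 0.
Proof.
move=> kL; rewrite (ip_TzE _ _ h1 i1)//; last exact: L2w1_chi.
rewrite (bigD1_seq k) ?mem_zrange ?zrange_uniq//= [X in _ + X]big1 ?addr0; last first.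
  move=> j jk; apply: big1 => l _.
  by rewrite ip1_chi xpair_eqE (negbTE jk) mulr0.
rewrite (bigD1 i)//= big1 ?addr0; first by rewrite ip1_chi eqxx mulr1.
by move=> l li; rewrite ip1_chi xpair_eqE (negbTE li) andbF mulr0.
Qed.

Lemma n2_Tz z L : N1 (Tz z L) = \sum_(j <- zrange L) \sum_i nsq (z j i 0).
Proof.
rewrite /n2 (ip_TzE _ _ h1 i1) ?cRe_sum; last exact: L2w_Tz.
rewrite big_seq [RHS]big_seq; apply: eq_bigr => j jL; rewrite cRe_sum.
apply: eq_bigr => i _; rewrite (ph_ipC ph1); [|exact: L2w1_chi|exact: L2w_Tz].
by rewrite ip1_Tz -?mem_zrange// mul_conjE.
Qed.

Section OnU.
Variable U : set int.

Definition vanish z : Prop := forall k, ~ U k -> z k = 0 :> 'cV[R[i]]_T.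

(* In the definition of l2 the equation z k = 0 is one between functions. *)
Lemma l2_vanish z : l2 U z -> vanish z.
Proof.
move=> [z0 _] k /z0 h; apply/matrixP => i j.
by rewrite mxE; exact: (congr1 (fun f => f i j) h).
Qed.

Lemma psum_Tz z L t : vanish z ->
  psum U (fun k => cis (k%:~R * t) *: z k) L = Tz z L t.
Proof.
move=> z0; rewrite TzE /psum big_mkcond; apply: eq_bigr => j _.
case: ifPn => //; rewrite notin_setE => /z0 ->; by rewrite scaler0.
Qed.

Definition l2norm z : R := fine (\esum_(k in U) (\sum_(i < T) nsq (z k i 0))%R%:E)%E.

Lemma n2_Tz_le z L : l2 U z -> N1 (Tz z L) <= l2norm z.
Proof.
move=> hz; have zoo := hz.2; have z0 := l2_vanish hz; rewrite n2_Tz; apply: (le_trans _ (psum_le_esum L _ zoo)); last first.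
  by move=> j _; apply: sumr_ge0 => i _; exact: nsq_ge0.
rewrite /psum [leRHS]big_mkcond; apply: ler_sum => j _; case: ifPn => //.
rewrite notin_setE => Uj; rewrite big1 ?lexx// => i _.
by rewrite (col_eq0 i (z0 j Uj)) nsq0.
Qed.

(** A bound along arbitrarily large L' is enough by monotonicity; for the glued sequences below, the
    partial sums are computed only at the ends of blocks. *)
Lemma l2_bound z (M : R) : vanish z ->
  (forall L, exists2 L', (L <= L')%N & N1 (Tz z L') <= M) -> l2 U z.
Proof.
move=> z0 zM; split.
  by move=> k /z0 ->; apply/funext => i; apply/funext => j; rewrite mxE.
apply: (@le_lt_trans _ _ M%:E); last exact: ltry.
have g0 j : 0 <= \sum_(i < T) nsq (z j i 0) by apply: sumr_ge0 => i _; exact: nsq_ge0.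
apply: esum_le_psum => // L; have [L' LL' h] := zM L.
apply: (le_trans _ h); apply: (@le_trans _ _ (psum U (fun j => \sum_(i < T) nsq (z j i 0)) L')).
  exact: psum_mono.
rewrite n2_Tz /psum big_mkcond; apply: ler_sum => j _; case: ifPn => // _.
Qed.

Variable W : R -> 'M[R[i]]_T.
Hypothesis hW : weight W.
Hypothesis iW : integrable_mx W.

(* [Bblock F G] is convertible to the Toeplitz matrix of (F + G)^-1. *)
Definition toep (k j : int) : 'M[R[i]]_T :=
  mean_mx (fun t => cis (- ((k - j)%:~R * t)) *: (W t)^T).

(** The Toeplitz matrix is the Gram matrix of the exponentials in L2(W). Hence the image of z under
    it consists of the products in L2(W) of the function with coefficients z with the
    exponentials. *)
Lemma ip_chi j l k m : ipw W (chi (j, l)) (chi (k, m)) = toep k j m l.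
Proof.
rewrite mxE ipwE; congr cmean; apply/funext => t.
by rewrite bform_delta !mxE /= -mulNr -intrN opprB cisDn cisNn; ring.
Qed.

Lemma ip_Tz_chi z L k i : vanish z ->
  ipw W (Tz z L) (chi (k, i)) = psum U (fun j => (toep k j *m z j) i 0) L.
Proof.
move=> z0; rewrite (ip_TzE _ _ hW iW); last exact: L2w_chi.
rewrite /psum [RHS]big_mkcond; apply: eq_bigr => j _.
transitivity ((toep k j *m z j) i 0).
  by rewrite mxE; apply: eq_bigr => l _; rewrite ip_chi mulrC.
case: ifPn => //; rewrite notin_setE => /z0 ->; by rewrite mulmx0 mxE.
Qed.

Hypothesis hB : defined_on_l2 U toep.

Lemma ip_Tz_cvg z k i : l2 U z -> U k ->
  ccvg (fun L => ipw W (Tz z L) (chi (k, i))) (block_op U toep z k i 0).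
Proof.
move=> hz Uk; have [h _] := hB hz.
rewrite /block_op mem_set// mxE.
under [X in ccvg X]eq_fun do rewrite (ip_Tz_chi _ _ _ (l2_vanish hz)).
exact: csum_cvg (h k Uk i).
Qed.

(** The l2 product of z with the Fourier coefficients of the polynomial coded by q; it makes sense
    for any sequence z. *)
Definition pair z q : R[i] := \sum_(r <- q) Num.conj r.1 * z r.2.1 r.2.2 0.

Lemma ccvg_sum I (r : seq I) (c : I -> R[i]) (u : I -> nat -> R[i]) (l : I -> R[i]) :
  all (fun i => `[< ccvg (u i) (l i) >]) r ->
  ccvg (fun n => \sum_(i <- r) c i * u i n) (\sum_(i <- r) c i * l i).
Proof.
elim: r => [_|i r ih /= /andP[/asboolP hi /ih {}ih]].
  rewrite big_nil /ccvg; under eq_fun do rewrite big_nil subrr nsq0.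
  exact: cvg_cst.
rewrite big_cons; apply: (@cvg0_le _ _ (fun n => 2 * (nsq (c i) * nsq (u i n - l i)) +
   2 * nsq (\sum_(i <- r) c i * u i n - \sum_(i <- r) c i * l i))).
  move=> n; rewrite nsq_ge0/= big_cons opprD addrACA -mulrBr -nsqM; exact: nsqD_le.
have := cvgD (cvgM (cvg_cst (2 : R)) (cvgM (cvg_cst (nsq (c i))) hi)) (cvgM (cvg_cst (2 : R)) ih).
by rewrite !mulr0 addr0; exact.
Qed.

Lemma ip_comb_r (W' : R -> 'M[R[i]]_T) f q : weight W' -> integrable_mx W' -> L2w W' f ->
  ipw W' f (comb chi q) = \sum_(r <- q) Num.conj r.1 * ipw W' f (chi r.2).
Proof.
move=> hW' iW' hf; have ph := ph_w hW'; have hc i : L2w W' (chi i) by exact: L2w_chi.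
have hZ (r : R[i] * (int * 'I_T)) : L2w W' (r.1 *: chi r.2) by apply: (phZ ph); exact: hc.
rewrite /comb (ip_sumr ph _ hf (fun r _ => hZ r)); apply: eq_bigr => r _.
exact: (ipZr ph _ (hc _) hf).
Qed.

Lemma pair_ip1 z L q : all (fun r => (`|r.2.1| <= L)%N) q ->
  ip1 (Tz z L) (comb chi q) = pair z q.
Proof.
move=> hq; rewrite ip_comb_r//; last exact: L2w_Tz.
rewrite /pair; elim: q hq => [|r q ih /= /andP[hr hq]]; first by rewrite !big_nil.
rewrite !big_cons ih//; congr (_ * _ + _).
by case: r hr => c [k i] /= hr; rewrite ip1_Tz.
Qed.

Lemma pair_cvg z q : l2 U z -> all (fun r => `[< U r.2.1 >]) q ->
  ccvg (fun L => ipw W (Tz z L) (comb chi q)) (pair (block_op U toep z) q).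
Proof.
move=> hz hq; under [X in ccvg X]eq_fun do rewrite (ip_comb_r _ hW iW (L2w_Tz _ _ hW iW)).
apply: ccvg_sum; elim: q hq => //= r q ih /andP[/asboolP hr /ih ->]; rewrite andbT.
by apply/asboolP; have := ip_Tz_cvg r.2.2 hz hr; case: (r.2).
Qed.

End OnU.
End TrigonometricSums.

(* Shifts s that make the blocks [s n - d n, s n + d n] disjoint and push s n beyond
   s m + r m n. *)
Lemma spread (d : nat -> nat) (r : nat -> nat -> nat) : exists s : nat -> nat,
  (forall n, (d n + n <= s n)%N) /\
  forall m n, (m < n)%N -> (r m n <= s n - s m)%N /\ (s m + d m + d n < s n)%N.
Proof.
(* The gap before the n-th block: it exceeds r m n + d m + 2 d n for every m <= n, and s accumulates
   the gaps. *)
pose rho i := (\sum_(l < i.+1) (r l i + d l) + 2 * d i).+1.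
pose s n := (\sum_(i < n.+1) rho i)%N.
have sS n : s n.+1 = (s n + rho n.+1)%N by rewrite /s big_ord_recr.
have rho_ge m n : (m <= n)%N -> (r m n + d m + 2 * d n < rho n)%N.
  move=> mn; rewrite /rho (bigD1 (Ordinal (mn : (m < n.+1)%N)))//=; lia.
have s_ge n : (rho n <= s n)%N by rewrite /s big_ord_recr leq_addl.
have s_rho m n : (m < n)%N -> (s m + rho n <= s n)%N.
  elim: n => // n ih; rewrite ltnS leq_eqVlt => /orP[/eqP ->|/ih h]; rewrite sS//; lia.
exists s; split.
  elim=> [|n ih]; first by have := s_ge 0%N; have := rho_ge 0%N 0%N isT; lia.
  by rewrite sS; have := rho_ge n.+1 n.+1 (leqnn _); lia.
by move=> m n mn; have := s_rho m n mn; have := rho_ge m n (ltnW mn); lia.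
Qed.

(** * Shifted blocks of frequencies and their sums *)

Section GlidingHump.
Context {R : realType} {T : nat}.
Implicit Types (z x y : int -> 'cV[R[i]]_T) (p q : seq (R[i] * (int * 'I_T))).
Implicit Types (W : R -> 'M[R[i]]_T).
Local Notation chi := (@chi R T).
Local Notation ip1 := (ipw (fun=> 1%:M : 'M[R[i]]_T)).
Local Notation N1 := (n2 ip1).

Let h1 := @weight1 R T.
Let i1 := @integrable_mx1 R T.
Let ph1 := ph_w h1.

Definition inblock q (a b : nat) : bool :=
  all (fun r : R[i] * (int * 'I_T) => (a%:Z <= r.2.1) && (r.2.1 <= b%:Z)) q.
Definition fbound q (L : nat) : bool :=
  all (fun r : R[i] * (int * 'I_T) => (`|r.2.1| <= L)%N) q.
(** A list may repeat a frequency, so its Fourier coefficients are sums over all occurrences. *)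
Definition coef q : int -> 'cV[R[i]]_T :=
  fun j => \col_i \sum_(r <- q | r.2 == (j, i)) r.1.
Definition shiftl (s : nat) q : seq (R[i] * (int * 'I_T)) :=
  [seq (r.1, (r.2.1 + s%:Z, r.2.2)) | r <- q].

Lemma fbound_exists q : exists L, fbound q L.
Proof.
elim: q => [|r q [L h]]; first by exists 0%N.
exists (`|r.2.1| + L)%N; rewrite /fbound/= leq_addr /=.
by apply: sub_all h => u /= h; apply: leq_trans h (leq_addl _ _).
Qed.

Lemma inblock_fbound q a b L : inblock q a b -> (b <= L)%N -> fbound q L.
Proof. by move=> h bL; apply: sub_all h => r /=; lia. Qed.

Lemma inblock_shift q d s : fbound q d -> (d <= s)%N ->
  inblock (shiftl s q) (s - d) (s + d).
Proof. by move=> h ds; rewrite /inblock all_map; apply: sub_all h => r /=; lia. Qed.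

Lemma coef_eq0 q a b j : inblock q a b -> ~~ ((a%:Z <= j) && (j <= b%:Z)) -> coef q j = 0.
Proof.
move=> h hj; apply/matrixP => i k; rewrite !mxE.
elim: q h => [|r q ih /= /andP[hr /ih {}ih]]; first by rewrite big_nil.
rewrite big_cons ih; case: eqP => // rji; move: hj; rewrite -[j]/(j, i).1 -rji.
by rewrite hr.
Qed.

Lemma Tz_coef q L : fbound q L -> Tz (coef q) L = comb chi q.
Proof.
move=> h; apply/funext => t; rewrite TzE.
have E r : cis (r.2.1%:~R * t) *: (r.1 *: delta r.2.2) = (r.1 *: chi r.2) t.
  by rewrite [RHS](_ : _ = r.1 *: (cis (r.2.1%:~R * t) *: delta r.2.2))// !scalerA mulrC.
have D j : coef q j = \sum_(r <- q | r.2.1 == j) r.1 *: delta r.2.2.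
  apply/colP => i; rewrite mxE summxE big_mkcond [RHS]big_mkcond.
  apply: eq_bigr => -[c [k l]] _ /=; rewrite xpair_eqE.
  case: (k == j) => //=.
  by rewrite !mxE eqxx andbT eq_sym; case: (i == l); rewrite /= ?mulr1 ?mulr0.
under eq_bigr do rewrite D scaler_sumr big_mkcond.
rewrite exchange_big /= /comb fct_sumE big_seq [RHS]big_seq.
apply: eq_bigr => r rq; rewrite (bigD1_seq r.2.1) ?zrange_uniq//=; last first.
  by rewrite mem_zrange; move/allP: h; apply.
rewrite eqxx big1 ?addr0; first exact: E.
by move=> j jr; rewrite eq_sym (negbTE jr).
Qed.

Lemma Tz_comb z L : exists q, Tz z L = comb chi q.
Proof.
rewrite /Tz; elim: (zrange L) => [|j l [q hq]].
  by exists [::]; rewrite /comb !big_nil.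
exists ([seq (z j i 0, (j, i)) | i <- enum 'I_T] ++ q).
by rewrite big_cons hq comb_cat; congr (_ + _); rewrite /comb big_map big_enum.
Qed.

Lemma ip1_block p q a b a' b' : inblock p a b -> inblock q a' b' -> (b < a')%N ->
  ip1 (comb chi p) (comb chi q) = 0.
Proof.
move=> hp hq bb; have fp := inblock_fbound hp (leq_maxl b b').
rewrite -(Tz_coef fp) pair_ip1; last exact: inblock_fbound hq (leq_maxr _ _).
rewrite /pair big_seq big1// => r rq.
rewrite (coef_eq0 hp) ?mxE ?mulr0//.
by move/allP: hq => /(_ _ rq); lia.
Qed.

Lemma comb_shiftl s q : comb chi (shiftl s q) =
  fun t => cis (s%:Z%:~R * t) *: comb chi q t.
Proof. by rewrite -comb_shift /comb big_map. Qed.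

(** A common shift multiplies both functions by the same factor of modulus 1, which cancels for
    every W: the invariance behind the Toeplitz structure. *)
Lemma ip_shiftl W s p q :
  ipw W (comb chi (shiftl s p)) (comb chi (shiftl s q)) = ipw W (comb chi p) (comb chi q).
Proof.
rewrite !comb_shiftl !ipwE; congr cmean; apply/funext => t.
rewrite /bform linearZ /= conj_mxZ -scalemxAr -!scalemxAl !mxE mulrA conj_mulE nsq_cis.
by rewrite mul1r.
Qed.

Lemma shiftl_comp a b q : shiftl a (shiftl b q) = shiftl (b + a) q.
Proof.
by rewrite /shiftl -map_comp; apply: eq_map => r /=; rewrite PoszD addrA.
Qed.

Lemma sum_tail0 (V : nmodType) (f : nat -> V) (A B : nat) :
  (forall m, (A <= m)%N -> f m = 0) -> (A <= B)%N -> \sum_(m < B) f m = \sum_(m < A) f m.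
Proof.
move=> f0 AB; rewrite -(big_mkord xpredT f) -(big_mkord xpredT f) (@big_cat_nat _ _ _ A 0 B)//=.
by rewrite [X in _ + X]big_nat_cond [X in _ + X]big1 ?addr0// => m /andP[/andP[/f0]].
Qed.

Section Glue.
Variables (Q : nat -> seq (R[i] * (int * 'I_T))) (a b : nat -> nat) (c : nat -> R[i]).
Hypothesis hQ : forall n, inblock (Q n) (a n) (b n).
Hypothesis a_ge : forall n, (n <= a n)%N.
Hypothesis b_ge : forall n, (n <= b n)%N.
Hypothesis aleb : forall n, (a n <= b n)%N.
Hypothesis ab : forall m n, (m < n)%N -> (b m < a n)%N.

(* The Fourier coefficients of the sum of all [c m *: comb chi (Q m)]: as m <= a m, only
   the terms with m <= |j| contribute to the frequency j. *)
Definition glue : int -> 'cV[R[i]]_T :=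
  fun j => \sum_(m < `|j|.+1) c m *: coef (Q m) j.

(** The sum may be cut at |j| because m <= a m, and equally at L because the blocks after the L-th
    start beyond b L. Extending both by zeros makes them equal. *)
Lemma glueE L j : (`|j| <= b L)%N -> glue j = \sum_(m < L.+1) c m *: coef (Q m) j.
Proof.
move=> jL; pose f m := c m *: coef (Q m) j.
have f1 m : (`|j|.+1 <= m)%N -> f m = 0.
  move=> jm; rewrite /f (coef_eq0 (hQ m)) ?scaler0//; have := a_ge m; lia.
have f2 m : (L.+1 <= m)%N -> f m = 0.
  move=> Lm; rewrite /f (coef_eq0 (hQ m)) ?scaler0//; have := ab Lm; lia.
rewrite /glue -/f -(sum_tail0 f1 (leq_addr L.+1 _)) -(sum_tail0 f2 (leq_addl `|j|.+1 _)).
by [].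
Qed.

(** At the end b L of a block, a partial sum contains the blocks up to L entirely and nothing of the
    later ones. *)
Lemma Tz_glue L : Tz glue (b L) = \sum_(m < L.+1) c m *: comb chi (Q m).
Proof.
apply/funext => t; rewrite TzE fct_sumE.
transitivity (\sum_(m < L.+1) c m *: Tz (coef (Q m)) (b L) t).
  under [RHS]eq_bigr do rewrite TzE scaler_sumr.
  rewrite exchange_big /= big_seq [RHS]big_seq; apply: eq_bigr => j.
  rewrite mem_zrange => /glueE ->; rewrite scaler_sumr; apply: eq_bigr => m _.
  by rewrite !scalerA mulrC.
apply: eq_bigr => -[m /= mL] _; rewrite (Tz_coef (L := b L))//.
apply: (inblock_fbound (hQ m)); move: mL; rewrite ltnS leq_eqVlt => /orP[/eqP ->//|mL].
by rewrite ltnW// (leq_trans (ab mL)).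
Qed.

Lemma glue_vanish (U : set int) : (forall n : nat, U n%:Z) -> vanish U glue.
Proof.
move=> hU j Uj; have j0 : j < 0.
  by rewrite ltNge; apply/negP => j0; apply: Uj; rewrite -(gez0_abs j0).
by apply: big1 => m _; rewrite (coef_eq0 (hQ m)) ?scaler0//; lia.
Qed.

Lemma ip1_QQ m n : m != n -> ip1 (comb chi (Q m)) (comb chi (Q n)) = 0.
Proof.
rewrite neq_ltn => /orP[mn|nm]; first exact: ip1_block (hQ m) (hQ n) (ab mn).
have L1 p : L2w (fun=> 1%:M) (comb chi p) by apply: trigs_L2w => //; exists p.
by rewrite (ph_ipC ph1)// (ip1_block (hQ n) (hQ m) (ab nm)) conj0.
Qed.

(** The blocks are orthogonal, so squared norms add, and 2 - 2^-L is the sum of 2^-m over m <= L. *)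
Lemma n2_glue L : (forall m, N1 (comb chi (Q m)) <= 1) ->
  (forall m, nsq (c m) <= 2^-1 ^+ m) ->
  N1 (\sum_(m < L.+1) c m *: comb chi (Q m)) <= 2 - 2^-1 ^+ L.
Proof.
move=> hN hc.
have L1 p : L2w (fun=> 1%:M) (comb chi p) by apply: trigs_L2w => //; exists p.
have LZ m : L2w (fun=> 1%:M) (c m *: comb chi (Q m)) by apply: (phZ ph1); exact: L1.
have LS K : L2w (fun=> 1%:M) (\sum_(m < K) c m *: comb chi (Q m)).
  by apply: (ph_sum ph1); [exact: L2w0|move=> m _; exact: LZ].
have hT m : N1 (c m *: comb chi (Q m)) <= 2^-1 ^+ m.
  rewrite (n2Z ph1 _ (L1 _)); apply: le_trans (hc m).
  by rewrite ler_piMr ?nsq_ge0.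
have E m n : ip1 (c m *: comb chi (Q m)) (c n *: comb chi (Q n)) =
    c m * (Num.conj (c n) * ip1 (comb chi (Q m)) (comb chi (Q n))).
  by rewrite (ipZl ph1 (c m) (L1 (Q m)) (LZ n)) (ipZr ph1 (c n) (L1 (Q n)) (L1 (Q m))).
elim: L => [|L ih].
  by rewrite big_ord1; apply: (le_trans (hT 0%N)); rewrite expr0; lra.
have Z : ip1 (\sum_(m < L.+1) c m *: comb chi (Q m)) (c L.+1 *: comb chi (Q L.+1)) = 0.
  rewrite (ip_suml ph1 _ (LZ _) (fun (m : 'I_L.+1) _ => LZ m)) big1// => m _.
  by apply: (eq_trans (E _ _)); rewrite ip1_QQ ?mulr0// ltn_eqF.
rewrite big_ord_recr (n2D ph1 (LS _) (LZ _)) [X in Re X]Z mulr0 addr0.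
have := hT L.+1; move: ih; move: (N1 _) (N1 _) => u v.
by rewrite exprS; move: (2^-1 ^+ L) => w; lra.
Qed.

Lemma glue_l2 (U : set int) : (forall n : nat, U n%:Z) ->
  (forall m, N1 (comb chi (Q m)) <= 1) -> (forall m, nsq (c m) <= 2^-1 ^+ m) ->
  l2 U glue.
Proof.
move=> hU hN hc; apply: (@l2_bound _ _ _ _ 2); first exact: glue_vanish.
move=> L; exists (b L) => //; rewrite Tz_glue; apply: (le_trans (n2_glue L hN hc)).
by rewrite lerBlDr lerDl exprn_ge0// invr_ge0.
Qed.

End Glue.
End GlidingHump.

(** * Two-sided norm bounds from the Toeplitz operator *)

Section ToeplitzBounds.
Context {R : realType} {T : nat}.
Implicit Types (z x y : int -> 'cV[R[i]]_T) (p q : seq (R[i] * (int * 'I_T))).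
Local Notation chi := (@chi R T).
Local Notation ip1 := (ipw (fun=> 1%:M : 'M[R[i]]_T)).
Local Notation N1 := (n2 ip1).

Let h1 := @weight1 R T.
Let i1 := @integrable_mx1 R T.
Let ph1 := ph_w h1.

Variable U : set int.
Hypothesis hU : forall n : nat, U n%:Z.
Variable W : R -> 'M[R[i]]_T.
Hypothesis hW : weight W.
Hypothesis iW : integrable_mx W.
Hypothesis hB : defined_on_l2 U (toep W).
Let ph := ph_w hW.
Local Notation ipW := (ipw W).
Local Notation NW := (n2 (ipw W)).

Let LW q : L2w W (comb chi q). Proof. by apply: trigs_L2w => //; exists q. Qed.
Let L1 q : L2w (fun=> 1%:M) (comb chi q). Proof. by apply: trigs_L2w => //; exists q. Qed.

Lemma nsq_ccvg_le (u : nat -> R[i]) l (M : R) : ccvg u l ->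
  (forall n, nsq (u n) <= M) -> nsq l <= M.
Proof.
move=> /ccvgP[h h'] uM; have c : (fun n => nsq (u n)) @ \oo --> nsq l.
  have -> : (fun n => nsq (u n)) = (fun n => Re (u n) * Re (u n) +
      Im (u n) * Im (u n)) by apply/funext => n; rewrite nsqE !expr2.
  by rewrite nsqE !expr2; apply: cvgD; apply: cvgM.
rewrite -(cvg_lim _ c)//; apply: limr_le; first by apply/cvg_ex; exists (nsq l).
by near=> n; exact: uM.
Unshelve. all: by end_near. Qed.

Lemma Re_ccvg_ge (u : nat -> R[i]) l (A : R) (k : nat -> nat) : ccvg u l ->
  (forall L, (L <= k L)%N) -> (exists n, forall L, (n <= L)%N -> A <= Re (u (k L))) ->
  A <= Re l.
Proof.
move=> /cvg0P h kL [n hn]; rewrite leNgt; apply/negP => lA.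
have e0 : 0 < (A - Re l) ^+ 2 by rewrite exprn_gt0// subr_gt0.
have [n0 hn0] := h _ e0; pose L := maxn n n0.
have := hn0 (k L) (leq_trans (leq_maxr _ _) (kL L)).
rewrite ger0_norm ?nsq_ge0//; apply/negP; rewrite -leNgt.
apply: le_trans (Re_sqr_le _); rewrite cReB ler_pXn2r// ?nnegrE ?subr_ge0//; last 2 first.
- exact: ltW.
- by apply: (le_trans (ltW lA)); apply: hn; exact: leq_maxl.
by rewrite lerD2r; apply: hn; exact: leq_maxl.
Qed.

Lemma increment_cvg0 (g v : nat -> R) : (forall n, 0 <= v n) ->
  (forall n, g n + v n <= g n.+1) -> cvgn g -> v @ \oo --> (0 : R).
Proof.
move=> v0 gv cg; have c1 : (fun n => g n.+1) @ \oo --> limn g by rewrite (cvg_shiftS g).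
apply: (@cvg0_le _ _ (fun n => g n.+1 - g n)).
  by move=> n; rewrite v0 lerBrDl gv.
by rewrite -(subrr (limn g)); apply: (cvgB c1 cg).
Qed.

(** Each term is at most an increment of the bounded increasing sequence of partial norms. *)
Lemma l2_decay z i : l2 U z -> (fun n : nat => nsq (z n%:Z i 0)) @ \oo --> (0 : R).
Proof.
move=> hz; pose g n := N1 (Tz z n).
have gS n : g n + nsq (z n.+1%:Z i 0) <= g n.+1.
  pose f (j : int) := \sum_i nsq (z j i 0).
  have f0 j : 0 <= f j by apply: sumr_ge0 => k _; exact: nsq_ge0.
  rewrite /g !n2_Tz.
  apply: (@le_trans _ _ (\sum_(j <- n.+1%:Z :: zrange n) f j)).
    rewrite addrC [X in _ <= X]big_cons; apply: lerD => //.
    by rewrite /f (bigD1 i)//= lerDl; apply: sumr_ge0 => k _; exact: nsq_ge0.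
  apply: sum_subseq.
  - by rewrite cons_uniq zrange_uniq mem_zrange; lia.
  - exact: zrange_uniq.
  - by move=> j; rewrite inE => /orP[/eqP ->|]; rewrite !mem_zrange; lia.
  - by move=> j _; exact: f0.
have cg : cvgn g.
  apply: nondecreasing_is_cvgn.
    by apply/nondecreasing_seqP => n; apply: le_trans (gS n); rewrite lerDl nsq_ge0.
  by exists (l2norm U z) => _ [n _ <-]; exact: n2_Tz_le.
rewrite -(cvg_shiftS (fun n => nsq (z n%:Z i 0))).
apply: (increment_cvg0 _ gS cg) => n; exact: nsq_ge0.
Qed.

Lemma Tz_chi l L : Tz (fun k => if k == 0 then delta l else 0) L = chi (0, l).
Proof.
apply/funext => t; rewrite TzE (bigD1_seq 0) ?mem_zrange ?zrange_uniq//= big1 ?addr0//.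
by move=> j /negbTE ->; rewrite scaler0.
Qed.

(** The Riemann-Lebesgue lemma for W, obtained from the operator: these products are the entries of
    the image of a unit sequence at frequency 0, and that image lies in l2(U). *)
Lemma ip_chi_decay l m : ccvg (fun s : nat => ipW (chi (0, l)) (chi (s%:Z, m))) 0.
Proof.
pose z : int -> 'cV[R[i]]_T := fun k => if k == 0 then delta l else 0.
have z0 : vanish U z by move=> k; rewrite /z; case: eqP => // -> /(_ (hU 0)).
have hz : l2 U z.
  by apply: (l2_bound z0 (M := N1 (chi (0, l)))) => L; exists L; rewrite ?Tz_chi.
have hd := l2_decay m (hB hz).2.
rewrite /ccvg; have -> : (fun n => nsq (ipW (chi (0, l)) (chi (n%:Z, m)) - 0)) =
  (fun n : nat => nsq (block_op U (toep W) z n%:Z m 0)) => //.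
apply/funext => n; rewrite subr0; congr nsq.
apply: (@ccvg_unique _ (fun=> ipW (chi (0, l)) (chi (n%:Z, m)))).
  by rewrite /ccvg; under eq_fun do rewrite subrr nsq0; exact: cvg_cst.
have E : (fun L => ipW (Tz z L) (chi (n%:Z, m))) = (fun=> ipW (chi (0, l)) (chi (n%:Z, m))).
  by apply/funext => L; rewrite /z (Tz_chi l L).
by rewrite -E; exact: (ip_Tz_cvg hW iW hB m hz (hU n)).
Qed.

(** Only the difference of the frequencies matters, and it is positive for large s, which reduces
    the claim to frequency 0. *)
Lemma ip_chi_decay2 (i j : int * 'I_T) : ccvg (fun s : nat => ipW (chi i) (chi (j.1 + s%:Z, j.2))) 0.
Proof.
case: i j => [n l] [m k] /=.
have E (s : nat) : (absz n + absz m <= s)%N ->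
    ipW (chi (n, l)) (chi (m + s%:Z, k)) = ipW (chi (0, l)) (chi ((absz (m + s%:Z - n)%R)%:Z, k)).
  move=> hs; rewrite !ip_chi /toep; congr (mean_mx _ k l).
  by apply/funext => t; rewrite subr0 gez0_abs//; lia.
have /cvg0P h := ip_chi_decay l k; apply/cvg0P => e /h[n0 hn].
exists (n0 + absz n + absz m)%N => s hs; rewrite E; last lia.
by apply: hn; lia.
Qed.

Lemma ip_comb_decay p q :
  ccvg (fun s : nat => ipW (comb chi p) (comb chi (shiftl s q))) 0.
Proof.
have -> : (fun s : nat => ipW (comb chi p) (comb chi (shiftl s q))) =
  (fun s : nat => \sum_(r <- q) Num.conj r.1 * ipW (comb chi p) (chi (r.2.1 + s%:Z, r.2.2))).
  by apply/funext => s; rewrite (ip_comb_r _ hW iW (LW p)) /shiftl big_map.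
rewrite -[X in ccvg _ X](_ : \sum_(r <- q) Num.conj r.1 * 0 = 0); last first.
  by rewrite big1// => r _; rewrite mulr0.
apply: ccvg_sum; apply/allP => r _; apply/asboolP.
have hc i : L2w W (chi i) by exact: L2w_chi.
have -> : (fun s : nat => ipW (comb chi p) (chi (r.2.1 + s%:Z, r.2.2))) =
  (fun s : nat => \sum_(u <- p) u.1 * ipW (chi u.2) (chi (r.2.1 + s%:Z, r.2.2))).
  apply/funext => s; rewrite /comb (ip_suml ph _ (hc _)).
    by apply: eq_bigr => u _; exact: (ipZl ph _ (hc _) (hc _)).
  by move=> u _; apply: (phZ ph); exact: hc.
rewrite -[X in ccvg _ X](_ : \sum_(u <- p) u.1 * 0 = 0); last first.
  by rewrite big1// => u _; rewrite mulr0.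
apply: ccvg_sum; apply/allP => u _; apply/asboolP.
exact: ip_chi_decay2.
Qed.

Lemma geom_half_le L : \sum_(m < L) (2^-1 : R) ^+ m <= 2.
Proof.
suff -> : \sum_(m < L) (2^-1 : R) ^+ m = 2 - 2 * 2^-1 ^+ L.
  by rewrite lerBlDr lerDl mulr_ge0// exprn_ge0// invr_ge0.
elim: L => [|L ih]; first by rewrite big_ord0 expr0 mulr1 subrr.
by rewrite big_ord_recr /= ih exprS; field.
Qed.

Lemma half_sqr_le m : nsq ((2^-1 ^+ m : R)%:C) <= 2^-1 ^+ m.
Proof.
rewrite nsqZ expr2 ler_piMl// ?exprn_ge0 ?invr_ge0//.
by rewrite exprn_ile1 ?invr_ge0// invf_le1// ler1n.
Qed.

Lemma nat_le_exp2 (n : nat) : n%:R <= (2 ^+ n : R).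
Proof. by rewrite -natrX ler_nat ltnW// ltn_expl. Qed.

Lemma normalize_above (k A B : R) : 0 <= A -> 0 < k -> k * A < B ->
  exists2 t, 0 <= t & t * A <= 1 /\ k <= t * B.
Proof.
move=> A0 k0 AB; have B0 : 0 < B by apply: le_lt_trans AB; rewrite mulr_ge0// ltW.
exists (k / B); first by rewrite divr_ge0 ?ltW.
by rewrite mulrAC ler_pdivrMr// mul1r ltW// divfK ?gt_eqF.
Qed.

Lemma normalize_below (k A B : R) : 0 <= B -> 0 < k -> k * B < A ->
  exists2 t, 0 <= t & t * A = 1 /\ k * (t * B) <= 1.
Proof.
move=> B0 k0 AB; have A0 : 0 < A by apply: le_lt_trans AB; rewrite mulr_ge0// ltW.
exists A^-1; first by rewrite invr_ge0 ltW.
by rewrite mulVf ?gt_eqF// mulrCA mulrC ler_pdivrMr// mul1r ltW.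
Qed.

Lemma scale_comb (N : (R -> 'cV[R[i]]_T) -> R) :
  (forall (c : R) q, N (comb chi (scaleseq c%:C q)) = c ^+ 2 * N (comb chi q)) ->
  forall (t : R) q, 0 <= t -> N (comb chi (scaleseq (Num.sqrt t)%:C q)) = t * N (comb chi q).
Proof. by move=> h t q t0; rewrite h sqr_sqrtr. Qed.

Lemma NW_scale (c : R) q : NW (comb chi (scaleseq c%:C q)) = c ^+ 2 * NW (comb chi q).
Proof. by rewrite comb_scale (n2Z ph _ (LW q)) nsqZ. Qed.
Lemma N1_scale (c : R) q : N1 (comb chi (scaleseq c%:C q)) = c ^+ 2 * N1 (comb chi q).
Proof. by rewrite comb_scale (n2Z ph1 _ (L1 q)) nsqZ. Qed.

Lemma inblock_U q a b : inblock q a b -> all (fun r => `[< U r.2.1 >]) q.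
Proof.
move=> h; apply: sub_all h => r /= /andP[h _]; apply/asboolP.
by have -> : r.2.1 = (absz r.2.1)%:Z by lia.
Qed.

Lemma pair_le z q L : l2 U z -> fbound q L ->
  nsq (pair z q) <= l2norm U z * N1 (comb chi q).
Proof.
move=> hz hq; rewrite -(pair_ip1 z hq).
apply: (le_trans (ip_CS ph1 (L2w_Tz z L h1 i1) (L1 q))).
by rewrite ler_wpM2r ?(n2_ge0 ph1)//; exact: n2_Tz_le.
Qed.

Lemma n2_shiftl (W' : R -> 'M[R[i]]_T) s q : n2 (ipw W') (comb chi (shiftl s q)) = n2 (ipw W') (comb chi q).
Proof. by rewrite /n2 ip_shiftl. Qed.

Lemma half_ge0 m : 0 <= (2^-1 : R) ^+ m.
Proof. by rewrite exprn_ge0// invr_ge0. Qed.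

Lemma Re_ipE (W' : R -> 'M[R[i]]_T) f : Re (ipw W' f f) = n2 (ipw W') f. Proof. by []. Qed.

Lemma l2norm_ge0 z : 0 <= l2norm U z.
Proof.
apply: fine_ge0; apply: esum_ge0 => k _; rewrite lee_fin.
by apply: sumr_ge0 => i _; exact: nsq_ge0.
Qed.

(* Gliding hump: if W-norms of normalized polynomials p n exceeded 4^n, shifted copies
   Q n with disjoint frequencies and small W-correlations would give x = sum 2^-m Q m in
   l2(U) whose image under the Toeplitz operator has unbounded pairings with the Q n. *)
Lemma toep_upper : exists2 K : R, 0 <= K &
  forall q, NW (comb chi q) <= K * N1 (comb chi q).
Proof.
apply: contrapT => h.
have /choice[p /all_and2[hp1 hpW]] n : exists p, N1 (comb chi p) <= 1 /\ 4 ^+ n <= NW (comb chi p).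
  have [q hq] : exists q, 4 ^+ n * N1 (comb chi q) < NW (comb chi q).
    apply: contrapT => hn; apply: h; exists (4 ^+ n); first exact: exprn_ge0.
    by move=> q; rewrite leNgt; apply/negP => hq; apply: hn; exists q.
  have [t t0 [tA tB]] := normalize_above (n2_ge0 ph1 (L1 q)) (exprn_gt0 n (ltr0n R 4)) hq.
  exists (scaleseq (Num.sqrt t)%:C q).
  split; first by rewrite (scale_comb N1_scale q t0); exact: tA.
  by rewrite (scale_comb NW_scale q t0); exact: tB.
have /choice[d hd] n := fbound_exists (p n).
(* A shift beyond [r] makes the W-correlation of two of the polynomials at most 1 in modulus;
   [spread] then provides such shifts. *)
have /choice[r hr] (mn : nat * nat) : exists r0, forall s, (r0 <= s)%N ->
    nsq (ipW (comb chi (p mn.1)) (comb chi (shiftl s (p mn.2)))) <= 1.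
  have /cvg0P/(_ 1 ltr01)[r0 hr0] := ip_comb_decay (p mn.1) (p mn.2).
  by exists r0 => s /hr0; rewrite subr0 ger0_norm ?nsq_ge0// => /ltW.
have [s [sd sr]] := spread d (fun m n => r (m, n)).
pose Q n := shiftl (s n) (p n); pose a n := (s n - d n)%N; pose b n := (s n + d n)%N.
have hQ n : inblock (Q n) (a n) (b n).
  by apply: inblock_shift => //; have := sd n; lia.
have a_ge n : (n <= a n)%N by have := sd n; rewrite /a; lia.
have b_ge n : (n <= b n)%N by have := sd n; rewrite /b; lia.
have aleb n : (a n <= b n)%N by rewrite /a /b; lia.
have ab m n : (m < n)%N -> (b m < a n)%N by move=> /sr[_]; rewrite /a /b; lia.
have N1Q n : N1 (comb chi (Q n)) <= 1 by rewrite n2_shiftl; exact: hp1.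
have NWQ n : 4 ^+ n <= NW (comb chi (Q n)) by rewrite n2_shiftl; exact: hpW.
have cross m n : m != n -> nsq (ipW (comb chi (Q m)) (comb chi (Q n))) <= 1.
  (* Removing the common shift s k leaves p k against p l shifted by s l - s k. *)
  have lt k l : (k < l)%N -> nsq (ipW (comb chi (Q k)) (comb chi (Q l))) <= 1.
    move=> kl; have [h' h''] := sr k l kl.
    have -> : Q l = shiftl (s k) (shiftl (s l - s k) (p l)) by rewrite shiftl_comp subnK//; lia.
    by rewrite ip_shiftl; exact: (hr (k, l)).
  rewrite neq_ltn => /orP[mn|nm]; first exact: lt.
  by rewrite (ph_ipC ph (LW _) (LW _)) nsqJ; exact: lt.
pose c m : R[i] := (2^-1 ^+ m : R)%:C.
pose x := glue Q c.
have hx : l2 U x by apply: (glue_l2 hQ a_ge b_ge aleb ab hU N1Q) => m; exact: half_sqr_le.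
pose z := block_op U (toep W) x; have hz : l2 U z := (hB hx).2.
have Re_ge n : 2 ^+ n - 2 <= Re (pair z (Q n)).
  apply: (Re_ccvg_ge (pair_cvg hW iW hB hx (inblock_U (hQ n))) b_ge).
  exists n => L nL; rewrite (Tz_glue c hQ a_ge aleb ab).
  have LZ m : L2w W (c m *: comb chi (Q m)) by apply: (phZ ph); exact: LW.
  rewrite (ip_suml ph _ (LW _) (fun (m : 'I_L.+1) _ => LZ m)) cRe_sum.
  pose g m : R := Re (ipW (comb chi (Q m)) (comb chi (Q n))).
  have E m : Re (ipW (c m *: comb chi (Q m)) (comb chi (Q n))) = 2^-1 ^+ m * g m.
    by rewrite (ipZl ph (c m) (LW _) (LW _)) cReZ.
  under eq_bigr do rewrite E.
  (* The diagonal term contributes at least 2^-n 4^n = 2^n; the others have modulus at most 2^-m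
     each, hence at most 2 together. *)
  rewrite (bigD1 (Ordinal (nL : (n < L.+1)%N)))//=; apply: lerD.
    apply: (@le_trans _ _ (2^-1 ^+ n * 4 ^+ n)).
      by rewrite -exprMn (_ : 2^-1 * 4 = 2 :> R)//; field.
    by rewrite /g Re_ipE; exact: (ler_wpM2l (half_ge0 n) (NWQ n)).
  pose o := Ordinal (nL : (n < L.+1)%N).
  rewrite lerNl -sumrN; apply: (@le_trans _ _ (\sum_(m < L.+1 | m != o) 2^-1 ^+ m)); last first.
    apply: le_trans (geom_half_le L.+1).
    by rewrite [leRHS](bigD1 o)//= lerDr half_ge0.
  apply: ler_sum => m mn; rewrite -mulrN; apply: (ler_piMr (half_ge0 m)).
  rewrite lerNl; have : `|g m| <= 1.
    rewrite -(ler_pXn2r (n:=2)) ?nnegrE// expr1n real_normK ?num_real//.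
    apply: (le_trans (Re_sqr_le _)); apply: cross.
    by move: mn; rewrite -val_eqE.
  by rewrite ler_norml => /andP[].
(* With this n one has 2^n - 2 >= n - 2 > M + 1, while the square of the real part of the pairing is
   at most M. *)
pose M := l2norm U z; pose n := (Num.truncn M).+4.
have nM : M < n%:R - 3.
  have := truncnS_gt M; rewrite /n -!natr1; lra.
have := pair_le hz (inblock_fbound (hQ n) (leqnn _)); rewrite -/M => h2.
have M0 : 0 <= M by exact: l2norm_ge0.
have h3 : nsq (pair z (Q n)) <= M.
  by apply: (le_trans h2); rewrite ler_piMr.
have := Re_ge n; have := nat_le_exp2 n; have := le_trans (Re_sqr_le (pair z (Q n))) h3.
move: (Re _) (2 ^+ n) => u v; rewrite expr2; nra.
Qed.

(* If W-norms of normalized p n were below 8^-n, solve B x = y = sum 2^-m Q m: the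
   pairing of y with Q n is 2^-n, that of B x is at most (K |x|^2 8^-n)^(1/2). *)
Lemma toep_lower : (forall y, l2 U y -> exists2 x, l2 U x & block_op U (toep W) x = y) ->
  exists2 K : R, 0 <= K & forall q, N1 (comb chi q) <= K * NW (comb chi q).
Proof.
move=> surj; have [K K0 hK] := toep_upper.
apply: contrapT => h.
have /choice[p /all_and2[hp1 hpW]] n : exists p, N1 (comb chi p) = 1 /\
    8 ^+ n * NW (comb chi p) <= 1.
  have [q hq] : exists q, 8 ^+ n * NW (comb chi q) < N1 (comb chi q).
    apply: contrapT => hn; apply: h; exists (8 ^+ n); first exact: exprn_ge0.
    by move=> q; rewrite leNgt; apply/negP => hq; apply: hn; exists q.
  have [t t0 [tA tB]] := normalize_below (n2_ge0 ph (LW q)) (exprn_gt0 n (ltr0n R 8)) hq.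
  exists (scaleseq (Num.sqrt t)%:C q).
  split; first by rewrite (scale_comb N1_scale q t0); exact: tA.
  by rewrite (scale_comb NW_scale q t0); exact: tB.
have /choice[d hd] n := fbound_exists (p n).
(* Only disjoint blocks are needed here: the pairings are taken in the unweighted product, where
   they are orthogonal. *)
have [s [sd sr]] := spread d (fun m n => 0%N).
pose Q n := shiftl (s n) (p n); pose a n := (s n - d n)%N; pose b n := (s n + d n)%N.
have hQ n : inblock (Q n) (a n) (b n).
  by apply: inblock_shift => //; have := sd n; lia.
have a_ge n : (n <= a n)%N by have := sd n; rewrite /a; lia.
have b_ge n : (n <= b n)%N by have := sd n; rewrite /b; lia.
have aleb n : (a n <= b n)%N by rewrite /a /b; lia.
have ab m n : (m < n)%N -> (b m < a n)%N by move=> /sr[_]; rewrite /a /b; lia.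
have N1Q n : N1 (comb chi (Q n)) = 1 by rewrite n2_shiftl; exact: hp1.
have NWQ n : 8 ^+ n * NW (comb chi (Q n)) <= 1 by rewrite n2_shiftl; exact: hpW.
pose c m : R[i] := (2^-1 ^+ m : R)%:C.
pose y := glue Q c.
have hy : l2 U y.
  apply: (glue_l2 hQ a_ge b_ge aleb ab hU) => m; last exact: half_sqr_le.
  by rewrite N1Q.
have [x hx xy] := surj y hy.
have pairE n : pair y (Q n) = (2^-1 ^+ n : R)%:C.
  rewrite -(pair_ip1 y (inblock_fbound (hQ n) (leqnn _))) (Tz_glue c hQ a_ge aleb ab).
  have LZ m : L2w (fun=> 1%:M) (c m *: comb chi (Q m)) by apply: (phZ ph1); exact: L1.
  rewrite (ip_suml ph1 _ (L1 _) (fun (m : 'I_n.+1) _ => LZ m)).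
  have E m : ip1 (c m *: comb chi (Q m)) (comb chi (Q n)) =
      c m * ip1 (comb chi (Q m)) (comb chi (Q n)) by exact: (ipZl ph1 (c m) (L1 _) (L1 _)).
  under eq_bigr do rewrite E.
  rewrite (bigD1 ord_max)//= big1 ?addr0.
    by rewrite (n2E ph1 (L1 _)) N1Q mulr1.
  by move=> m mn; rewrite (ip1_QQ hQ ab) ?mulr0//; move: mn; rewrite -val_eqE.
pose M := l2norm U x.
(* Since y is the image of x, the pairing is a limit of W-products; Cauchy-Schwarz applies, and the
   upper bound controls the W-norms of the partial sums of x. *)
have bnd n : nsq (pair y (Q n)) <= K * M * NW (comb chi (Q n)).
  rewrite -xy; apply: (nsq_ccvg_le (pair_cvg hW iW hB hx (inblock_U (hQ n)))) => L.
  apply: (le_trans (ip_CS ph (L2w_Tz x L hW iW) (LW _))).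
  have le1 : NW (Tz x L) <= K * N1 (Tz x L).
    by have [q hq] := Tz_comb x L; rewrite hq; exact: hK.
  have le2 := le_trans le1 (ler_wpM2l K0 (n2_Tz_le L hx)).
  exact: (ler_wpM2r (n2_ge0 ph (LW (Q n))) le2).
(* The base 8 beats the squared pairing 4^-n by a factor 2^n. *)
have key n : 2 ^+ n <= K * M.
  have := bnd n; rewrite pairE nsqZ -exprM mulnC exprM => h1'.
  have h2' : 8 ^+ n * (2^-1 ^+ 2) ^+ n <= K * M.
    apply: (@le_trans _ _ (8 ^+ n * (K * M * NW (comb chi (Q n))))).
      by rewrite ler_wpM2l// exprn_ge0.
    rewrite mulrCA -[leRHS]mulr1; apply: ler_wpM2l; last exact: NWQ.
    by rewrite mulr_ge0//; exact: l2norm_ge0.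
  apply: le_trans h2'; rewrite -exprMn (_ : 8 * 2^-1 ^+ 2 = 2 :> R)//.
  by field.
have h2 := le_trans (nat_le_exp2 _) (key (Num.truncn (K * M)).+1).
by have := lt_le_trans (truncnS_gt (K * M)) h2; rewrite ltxx.
Qed.

End ToeplitzBounds.

(** * Essential bounds for the densities *)

Section PointwiseBounds.
Context {R : realType} {T : nat}.
Implicit Types (f g : R -> 'cV[R[i]]_T) (W : R -> 'M[R[i]]_T) (q : seq (R[i] * (int * 'I_T))).
Local Notation chi := (@chi R T).
Local Notation leb := (@lebesgue_measure R).
Local Notation circ := (@circ R).

Lemma qformD (W1 W2 : 'M[R[i]]_T) x : qform (W1 + W2) x = qform W1 x + qform W2 x.
Proof. exact: bform_add. Qed.

Lemma L2wD W1 W2 f : weight W1 -> weight W2 -> L2w W1 f -> L2w W2 f ->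
  L2w (fun t => W1 t + W2 t) f.
Proof.
move=> h1 h2 f1 f2; apply/(L2wP (weightD h1 h2) f1.1).
have := integrableD measurable_circ (L2w_integrable h1 f1) (L2w_integrable h2 f2).
by apply: eq_integrable => // t _; rewrite qformD cReD.
Qed.

(** Functions as well as weights may differ on the two sides: in the applications f1 is often the
    image of f2 under a matrix function. *)
Lemma L2w_dom W1 W2 f1 f2 (c : R) : weight W1 -> weight W2 -> measurable_vec f1 ->
  circ_ae (fun t => Re (qform (W1 t) (f1 t)) <= c * Re (qform (W2 t) (f2 t))) ->
  L2w W2 f2 -> L2w W1 f1.
Proof.
move=> h1 h2 mf hle hf; split; first exact: mf.
pose u t := (Re (qform (W1 t) (f1 t)))%:E.
pose v t := (c * Re (qform (W2 t) (f2 t)))%:E.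
have mu : measurable_fun (circ : set (measurableTypeR R)) u.
  by apply/measurable_EFinP; rewrite -measurable_fun_lebE; exact: measurable_qform h1 mf.
have iv : leb.-integrable circ v.
  by have := integrableZl measurable_circ c (L2w_integrable h2 hf).
have : (\int[leb]_(t in circ) u t <= \int[leb]_(t in circ) `|v t|)%E.
  apply: ae_ge0_le_integral => //.
  - by move=> t ct; rewrite lee_fin qform_Re_ge0.
  - apply: measurableT_comp => //; exact: (measurable_int _ iv).
  - apply: (@filterS _ _ (ae_filter_ringOfSetsType leb) _ _ _ hle) => t h ct.
    by rewrite lee_fin; apply: le_trans (ler_norm _); exact: h.
move=> /le_lt_trans; apply.
by move/integrableP : iv => [].
Qed.

Lemma n2_dom W1 W2 f1 f2 (c : R) : 0 <= c -> weight W1 -> weight W2 -> measurable_vec f1 ->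
  circ_ae (fun t => Re (qform (W1 t) (f1 t)) <= c * Re (qform (W2 t) (f2 t))) ->
  L2w W2 f2 -> n2 (ipw W1) f1 <= c * n2 (ipw W2) f2.
Proof.
move=> c0 h1 h2 mf hle hf; have hf1 := L2w_dom h1 h2 mf hle hf.
have i1 := L2w_integrable h1 hf1; have i2 := L2w_integrable h2 hf.
have AB : Rintegral leb circ (fun t => Re (qform (W1 t) (f1 t))) <=
    c * Rintegral leb circ (fun t => Re (qform (W2 t) (f2 t))).
  rewrite -(RintegralZl c measurable_circ i2); apply: fine_le.
  - exact: (integrable_fin_num measurable_circ i1).
  - exact: (integrable_fin_num measurable_circ (integrableZl measurable_circ c i2)).
  - apply: ae_ge0_le_integral.
    + exact: measurable_circ.
    + by move=> t ct; rewrite lee_fin qform_Re_ge0.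
    + exact: (measurable_int _ i1).
    + by move=> t ct; rewrite lee_fin mulr_ge0// qform_Re_ge0.
    + exact: (measurable_int _ (integrableZl measurable_circ c i2)).
    + apply: (@filterS _ _ (ae_filter_ringOfSetsType leb) _ _ _ hle) => t h ct.
      by rewrite lee_fin; exact: h.
rewrite (n2_ipwE W1 f1) (n2_ipwE W2 f2) [leRHS]mulrCA; apply: ler_wpM2l AB.
by rewrite invr_ge0 ltW// two_pi_gt0.
Qed.

Lemma L2w_le W1 W2 f (c : R) : weight W1 -> weight W2 ->
  circ_ae (fun t => forall x, Re (qform (W1 t) x) <= c * Re (qform (W2 t) x)) ->
  L2w W2 f -> L2w W1 f.
Proof.
by move=> h1 h2 hle hf; apply: (L2w_dom h1 h2 hf.1 _ hf); apply: circ_aeS hle.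
Qed.

Lemma n2_le W1 W2 f (c : R) : 0 <= c -> weight W1 -> weight W2 ->
  circ_ae (fun t => forall x, Re (qform (W1 t) x) <= c * Re (qform (W2 t) x)) ->
  L2w W2 f -> n2 (ipw W1) f <= c * n2 (ipw W2) f.
Proof.
by move=> c0 h1 h2 hle hf; apply: (n2_dom c0 h1 h2 hf.1 _ hf); apply: circ_aeS hle.
Qed.

Lemma n2D_weight W1 W2 f : weight W1 -> weight W2 -> L2w W1 f -> L2w W2 f ->
  n2 (ipw (fun t => W1 t + W2 t)) f = n2 (ipw W1) f + n2 (ipw W2) f.
Proof.
move=> h1 h2 f1 f2; rewrite (n2_ipwE W1 f) (n2_ipwE W2 f) (n2_ipwE _ f) -mulrDr; congr (_ * _).
rewrite -(RintegralD measurable_circ (L2w_integrable h1 f1) (L2w_integrable h2 f2)).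
by apply: eq_Rintegral => t _; rewrite qformD cReD.
Qed.

Lemma integrable_mxD W1 W2 : integrable_mx W1 -> integrable_mx W2 ->
  integrable_mx (fun t => W1 t + W2 t).
Proof.
move=> h1 h2 k l; have := cintegrableD measurable_circ (h1 k l) (h2 k l).
by apply: (eq_cintegrable measurable_circ) => t _; rewrite mxE.
Qed.

(* Approximation in L2(W1 + W2) is approximation in both spaces at once. *)
Lemma n2_le_trigs W1 W2 (K : R) f : weight W1 -> integrable_mx W1 ->
  weight W2 -> integrable_mx W2 ->
  (forall q, n2 (ipw W1) (comb chi q) <= K * n2 (ipw W2) (comb chi q)) ->
  L2w W1 f -> L2w W2 f -> n2 (ipw W1) f <= K * n2 (ipw W2) f.
Proof.
move=> h1 i1 h2 i2 hK f1 f2.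
have hV := weightD h1 h2; have iV := integrable_mxD i1 i2.
have fV := L2wD h1 h2 f1 f2.
have Lq W q : weight W -> integrable_mx W -> L2w W (comb chi q).
  by move=> hW iW; apply: trigs_L2w => //; exists q.
have /choice[q hq] (n : nat) : exists q,
    n2 (ipw (fun t => W1 t + W2 t)) (f - comb chi q) < n.+1%:R^-1.
  by apply: trigs_dense => //; rewrite invr_gt0.
have c0 : (fun n : nat => n.+1%:R^-1 : R) @ \oo --> (0 : R).
  by have := @cvg_harmonic R.
have hsum n : n2 (ipw W1) (comb chi (q n) - f) + n2 (ipw W2) (comb chi (q n) - f) <= n.+1%:R^-1.
  have B1 := phB (ph_w h1) (Lq W1 (q n) h1 i1) f1.
  have B2 := phB (ph_w h2) (Lq W2 (q n) h2 i2) f2.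
  rewrite -(n2D_weight h1 h2 B1 B2) (n2C (ph_w hV) (Lq _ (q n) hV iV) fV).
  exact: ltW (hq n).
have P1 n : 0 <= n2 (ipw W1) (comb chi (q n) - f).
  exact: (n2_ge0 (ph_w h1) (phB (ph_w h1) (Lq W1 (q n) h1 i1) f1)).
have P2 n : 0 <= n2 (ipw W2) (comb chi (q n) - f).
  exact: (n2_ge0 (ph_w h2) (phB (ph_w h2) (Lq W2 (q n) h2 i2) f2)).
have v1 : ncvg (ipw W1) (fun n => comb chi (q n)) f.
  apply: (cvg0_le _ c0) => n; rewrite P1 /=; apply: le_trans (hsum n).
  by rewrite lerDl.
have v2 : ncvg (ipw W2) (fun n => comb chi (q n)) f.
  apply: (cvg0_le _ c0) => n; rewrite P2 /=; apply: le_trans (hsum n).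
  by rewrite lerDr.
have l1 := ncvg_n2 (ph_w h1) f1 (fun n => Lq W1 (q n) h1 i1) v1.
have l2' := ncvg_n2 (ph_w h2) f2 (fun n => Lq W2 (q n) h2 i2) v2.
have l3 : (fun n => K * n2 (ipw W2) (comb chi (q n))) @ \oo --> K * n2 (ipw W2) f.
  by apply: cvgM => //; exact: cvg_cst.
rewrite -(cvg_lim _ l1)// -(cvg_lim _ l3)//; apply: ler_lim.
- by apply/cvg_ex; exists (n2 (ipw W1) f).
- by apply/cvg_ex; exists (K * n2 (ipw W2) f).
- by near=> n; exact: hK.
Unshelve. all: by end_near. Qed.

Lemma null_of_Rintegral_le0 (E : set R) (u : R -> R) :
  leb.-integrable circ (fun t => (\1_E t * u t)%:E) ->
  (forall t, circ t -> E t -> 0 < u t) ->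
  Rintegral leb circ (fun t => \1_E t * u t) <= 0 -> circ_ae (fun t => ~ E t).
Proof.
move=> iu u0 h.
have p0 t : circ t -> 0 <= \1_E t * u t.
  move=> ct; rewrite indicE; have [Et|Et] := pselect (E t).
    by rewrite mem_set// mul1r ltW// u0.
  by rewrite memNset// mul0r.
have e0 : (\int[leb]_(t in circ) (\1_E t * u t)%:E = 0)%E.
  apply/eqP; rewrite eq_le integral_ge0 ?andbT; last by move=> t /p0; rewrite lee_fin.
  by rewrite -(fineK (integrable_fin_num measurable_circ iu)) lee_fin.
have e1 : (\int[leb]_(t in circ) `|(\1_E t * u t)%:E| = 0)%E.
  by rewrite -[RHS]e0; apply: eq_integral => t /set_mem /p0 h0; rewrite gee0_abs.
have /ae_eq_integral_abs h2 := e1.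
apply: (@filterS _ _ (ae_filter_ringOfSetsType leb) _ _ _
  (h2 measurable_circ (measurable_int _ iu))) => t ht ct Et.
have := ht ct; rewrite indicE mem_set//= mul1r => -[] ut.
by have := u0 t ct Et; rewrite ut ltxx.
Qed.

Lemma circ_ae_forall (I : finType) (Q : I -> R -> Prop) :
  (forall k, circ_ae (Q k)) -> circ_ae (fun t => forall k, Q k t).
Proof.
move=> hQ; suff h (r : seq I) : circ_ae (fun t => forall k, k \in r -> Q k t).
  by apply: circ_aeS (h (enum I)) => t _ ht k; apply: ht; rewrite mem_enum.
elim: r => [|k r ih]; first by apply: circ_aeT.
apply: circ_aeS (circ_aeI (hQ k) ih) => t _ [h1 h2] l.
by rewrite inE => /orP[/eqP ->|/h2].
Qed.

Lemma measurable_preim (g : R -> R) (Y : set R) : measurable_fun circ g -> measurable Y ->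
  measurable (circ `&` g @^-1` Y).
Proof. by move=> mg mY; exact: (mg measurable_circ Y mY). Qed.

Lemma bmeas_indic (E : set R) : measurable E -> bmeas (fun t => \1_E t) (1 : R).
Proof.
split; last by move=> t _; rewrite indicE; case: (_ \in _); rewrite ?normr1 ?normr0.
by apply: measurable_funTS; exact: measurable_indic.
Qed.

Lemma indic_sqr (E : set R) t : (\1_E t : R) ^+ 2 = \1_E t.
Proof. by rewrite indicE; case: (_ \in _); rewrite ?expr1n ?expr0n. Qed.

Lemma nsq_delta (k l : 'I_T) : nsq ((delta k : 'cV[R[i]]_T) l 0) <= 1.
Proof.
by rewrite mxE eqxx andbT; case: (_ == _); rewrite /= ?nsq0// nsqE /= expr1n expr0n addr0.
Qed.

Lemma qform_delta (W : 'M[R[i]]_T) k : qform W (delta k) = W k k.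
Proof.
have := bform_delta W k k 1 1; rewrite !scale1r conj1 mul1r mulr1; exact.
Qed.

Lemma n2_mulv_indic W (E : set R) f : n2 (ipw W) (mulv (fun t => \1_E t) f) =
  (2 * pi)^-1 * Rintegral leb circ (fun t => \1_E t * Re (qform (W t) (f t))).
Proof.
rewrite n2_ipwE; congr (_ * _); apply: eq_Rintegral => t _.
by rewrite qform_mulv indic_sqr.
Qed.

Lemma integrable_mulv_indic W (E : set R) f : weight W ->
  L2w W (mulv (fun t => \1_E t) f) ->
  leb.-integrable circ (fun t => (\1_E t * Re (qform (W t) (f t)))%:E).
Proof.
move=> hW hf; have := L2w_integrable hW hf.
by apply: eq_integrable => // t _; rewrite qform_mulv indic_sqr.
Qed.

(** The inequality passes by density from trigonometric polynomials to f cut off to E, where the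
    strict reverse inequality holds pointwise; so E must be negligible. *)
Lemma null_of_n2 W1 W2 (K : R) (E : set R) f : weight W1 -> integrable_mx W1 ->
  weight W2 -> integrable_mx W2 ->
  (forall q, n2 (ipw W1) (comb chi q) <= K * n2 (ipw W2) (comb chi q)) ->
  L2w W1 (mulv (fun t => \1_E t) f) -> L2w W2 (mulv (fun t => \1_E t) f) ->
  (forall t, circ t -> E t ->
     K * Re (qform (W2 t) (f t)) < Re (qform (W1 t) (f t))) ->
  circ_ae (fun t => ~ E t).
Proof.
move=> h1 i1 h2 i2 hK f1 f2 hE.
have := n2_le_trigs h1 i1 h2 i2 hK f1 f2; rewrite !n2_mulv_indic mulrCA.
rewrite ler_pM2l ?invr_gt0 ?two_pi_gt0// => hle.
have I1 := integrable_mulv_indic h1 f1; have I2 := integrable_mulv_indic h2 f2.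
pose u t := Re (qform (W1 t) (f t)) - K * Re (qform (W2 t) (f t)).
have uE t : \1_E t * u t = 1 * (\1_E t * Re (qform (W1 t) (f t))) +
    (- K) * (\1_E t * Re (qform (W2 t) (f t))) by rewrite /u; ring.
apply: (@null_of_Rintegral_le0 E u).
- have := integrable_real_lin measurable_circ 1 (- K) I1 I2.
  by apply: eq_integrable => // t _; rewrite uE.
- by move=> t ct Et; rewrite subr_gt0 hE.
- under eq_Rintegral do rewrite uE.
  by rewrite (Rintegral_lin measurable_circ 1 (- K) I1 I2) mul1r mulNr subr_le0.
Qed.

(** The test function is the k-th basis vector on the set where the diagonal entry exceeds K. *)
Lemma diag_bound W (K : R) : weight W -> integrable_mx W ->
  (forall q, n2 (ipw W) (comb chi q) <= K * n2 (ipw (fun=> 1%:M)) (comb chi q)) ->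
  circ_ae (fun t => forall k, Re (W t k k) <= K).
Proof.
move=> hW iW hK; apply: circ_ae_forall => k.
have h1 := @weight1 R T; have i1 := @integrable_mx1 R T.
pose E := circ `&` (fun t => Re (W t k k)) @^-1` `]K, +oo[.
have mE : measurable E.
  by apply: measurable_preim; [exact: (hW.1 k k).1|exact: measurable_itv].
have md : measurable_vec (fun=> delta k : 'cV[R[i]]_T) by move=> l; exact: cmeasurable_cst.
have Lb W' : weight W' -> integrable_mx W' ->
    L2w W' (mulv (fun t => \1_E t) (fun=> delta k)).
  move=> hW' iW'; apply: (L2w_mulv hW' (bmeas_indic mE)).
  by apply: (L2w_bounded hW' iW' md) => t _ l; exact: nsq_delta.
have h := null_of_n2 hW iW h1 i1 hK (Lb W hW iW) (Lb _ h1 i1).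
apply: circ_aeS (h _) => [t ct Et|t ct [_ /=]].
  by rewrite leNgt; apply/negP => Kt; apply: Et; split => //=; rewrite in_itv /= Kt.
by rewrite in_itv/= andbT !qform_delta mxE eqxx /= mulr1.
Qed.

(* The test function is the k-th row v of H, on the set where H k k > K: there
   v^T H^-1 conj v = H k k whereas |v|^2 >= (H k k)^2. *)
Lemma diag_bound_inv H (K : R) : 0 <= K -> weight H ->
  circ_ae (fun t => H t \in unitmx) -> integrable_mx (fun t => invmx (H t)) ->
  (forall q, n2 (ipw (fun=> 1%:M)) (comb chi q) <=
     K * n2 (ipw (fun t => invmx (H t))) (comb chi q)) ->
  circ_ae (fun t => forall k, Re (H t k k) <= K).
Proof.
move=> K0 hH uH iP hK; apply: circ_ae_forall => k.
have h1 := @weight1 R T; have i1 := @integrable_mx1 R T.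
have hP : weight (fun t => invmx (H t)).
  split; last by move=> t ct; apply: nonneg_hermitian_inv; exact: hH.2.
  by move=> a b; rewrite cmeasurable_lebE; exact: cintegrable_meas (iP a b).
pose v t : 'cV[R[i]]_T := \col_l H t k l.
have mv : measurable_vec v.
  by move=> l; apply: eq_cmeasurable (hH.1 k l) => t _; rewrite mxE.
have q1 t : Re (qform 1%:M (v t)) = \sum_l nsq (H t k l).
  by rewrite qform1; apply: eq_bigr => l _; rewrite mxE.
have qP t : circ t -> H t \in unitmx ->
    Re (qform (invmx (H t)) (v t)) = Re (H t k k).
  move=> ct ut; rewrite /qform (_ : (v t)^T = row k (H t)).
    rewrite -row_mul mulmxV// row1 -rowE !mxE; exact: cReJ.
  by apply/rowP => l; rewrite !mxE.
pose g1 t := Re (H t k k).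
pose g2 t := Re (qform 1%:M (v t)).
pose g3 t := Re (qform (invmx (H t)) (v t)) - Re (H t k k).
have m1 : measurable_fun circ g1 by exact: (hH.1 k k).1.
have m2 : measurable_fun circ g2 by exact: measurable_qform h1 mv.
have m3 : measurable_fun circ g3.
  by apply: measurable_funB => //; exact: measurable_qform hP mv.
(* The second condition makes the test function bounded. The third builds the identity v^T P conj v
   = H k k, known only almost everywhere, into the set in a measurable way. *)
pose E n := (circ `&` g1 @^-1` `]K, +oo[) `&` (circ `&` g2 @^-1` `]-oo, n%:R]) `&`
   (circ `&` g3 @^-1` [set 0]).
have mE n : measurable (E n).
  apply: measurableI; first by apply: measurableI; apply: measurable_preim => //;
    exact: measurable_itv.
  by apply: measurable_preim => //; exact: measurable_set1.
have fb n t : circ t -> forall l, nsq (mulv (fun t => \1_(E n) t) v t l 0) <= n%:R.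
  move=> ct l; rewrite /mulv mxE nsqM nsqZ indic_sqr indicE.
  have [hE|h] := pselect (E n t); last by rewrite memNset// mul0r.
  rewrite (mem_set hE) /= mul1r; have [[_ [_ h2]] _] := hE.
  move: h2; rewrite /= in_itv /= /g2 q1; apply: le_trans.
  by rewrite mxE (bigD1 l)//= lerDl; apply: sumr_ge0 => j _; exact: nsq_ge0.
have Lb W' n : weight W' -> integrable_mx W' -> L2w W' (mulv (fun t => \1_(E n) t) v).
  move=> hW' iW'; apply: (L2w_bounded hW' iW' _ (fb n)).
  exact: measurable_mulv (bmeas_indic (mE n)).1 mv.
have hn n : circ_ae (fun t => ~ E n t).
  apply: (null_of_n2 h1 i1 hP iP hK (Lb _ n h1 i1) (Lb _ n hP iP)) => t ct.
  move=> [[[_ /= h2] _] [_ /= h3]].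
  have -> : Re (qform (invmx (H t)) (v t)) = Re (H t k k).
    by apply/eqP; rewrite -subr_eq0; apply/eqP.
  rewrite q1; apply: (@lt_le_trans _ _ (nsq (H t k k))); last first.
    by rewrite (bigD1 k)//= lerDl; apply: sumr_ge0 => j _; exact: nsq_ge0.
  apply: lt_le_trans (Re_sqr_le _); rewrite expr2 ltr_pM2r.
    by move: h2; rewrite in_itv /= andbT.
  by apply: (le_lt_trans K0); move: h2; rewrite in_itv /= andbT.
have hall : circ_ae (fun t => forall n, ~ E n t).
  have := (ae_foralln (mu := leb) (P := fun n t => circ t -> ~ E n t)) hn.
  by apply: (@filterS _ _ (ae_filter_ringOfSetsType leb)) => t h ct n; exact: h.
apply: circ_aeS (circ_aeI hall uH) => t ct [h ut].
rewrite leNgt; apply/negP => Kt; apply: (h (Num.truncn (g2 t)).+1); split; first split.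
- by split => //=; rewrite in_itv /= andbT.
- by split => //=; rewrite in_itv /=; apply: ltW; exact: truncnS_gt.
- by split => //=; rewrite /g3 qP// subrr.
Qed.

End PointwiseBounds.

(** * Matrix inequalities for H and its inverse *)

Section MatrixBounds.
Context {R : realType} {T : nat}.
Implicit Types (x y : 'cV[R[i]]_T) (W M F G H : 'M[R[i]]_T).

Lemma bform_mull W M x y : bform W (M *m x) y = bform (M^T *m W) x y.
Proof. by rewrite /bform trmx_mul !mulmxA. Qed.

Lemma bform_mulr W M x y : bform W x (M *m y) = bform (W *m conj_mx M) x y.
Proof. by rewrite /bform conj_mxM !mulmxA. Qed.

Lemma hermT W : (conj_mx W)^T = W -> conj_mx W^T = W.
Proof. by move=> {2}<-; rewrite conj_mxT. Qed.

Lemma nonneg_hermitian_le W1 W2 : nonneg_hermitian W2 ->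
  forall x, Re (qform W1 x) <= Re (qform (W1 + W2) x).
Proof. by move=> h x; rewrite qformD cReD lerDl; apply: ge0_Re; exact: h.2. Qed.

Lemma qform_diag_le W x (K : R) : nonneg_hermitian W ->
  (forall k, Re (W k k) <= K) ->
  Re (qform W x) <= 2 ^+ T * K * Re (qform 1%:M x).
Proof.
move=> hW hK; apply: (le_trans (qform_le_diag x hW)); rewrite -mulrA ler_wpM2l ?exprn_ge0//.
rewrite qform1 mulr_sumr; apply: ler_sum => k _; rewrite mulrC ler_wpM2r// ?nsq_ge0//.
Qed.

Section Inverse.
Variable H : 'M[R[i]]_T.
Hypothesis hH : nonneg_hermitian H.
Hypothesis uH : H \in unitmx.

Lemma bform_inv x y : bform H ((invmx H)^T *m x) y = bform 1%:M x y.
Proof. by rewrite bform_mull trmxK mulVmx. Qed.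

Lemma qform_inv x : qform H ((invmx H)^T *m x) = qform (invmx H) x.
Proof.
rewrite qform_entry bform_inv bform_mulr mul1mx hermT//.
exact: (nonneg_hermitian_inv hH).1.
Qed.

(* For v = P^T F^T x one has v^T H conj v = x^T F conj v: apply Cauchy-Schwarz for F. *)
Lemma qform_inv_mul_le F x : nonneg_hermitian F ->
  (forall y, Re (qform F y) <= Re (qform H y)) ->
  Re (qform H ((invmx H)^T *m (F^T *m x))) <= Re (qform F x).
Proof.
move=> hF FH; set v := (_ *m (F^T *m x)).
have e : qform H v = bform F x v.
  by rewrite qform_entry /v bform_inv bform_mull trmxK mulmx1.
have := ip_CS (ph_bform hF) (I : [set: 'cV[R[i]]_T] x) (I : [set: 'cV[R[i]]_T] v).
rewrite -e => cs.
have h0 : 0 <= Re (qform H v) by apply: ge0_Re; exact: hH.2.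
have f0 : 0 <= Re (qform F x) by apply: ge0_Re; exact: hF.2.
move: cs; have [/ge0_complexP[-> _] _] : 0 <= qform H v /\ True by split => //; exact: hH.2.
rewrite nsqZ /= /n2 -!qform_entry => cs.
have [->//|hn] := eqVneq (Re (qform H v)) 0.
rewrite -(ler_pM2r (x := Re (qform H v))) ?lt_neqAle ?h0 1?eq_sym ?hn//.
rewrite -expr2; apply: (le_trans cs); apply: ler_wpM2l => //.
Qed.

(** With v = P^T x one has v^T H conj x = |x|^2 and v^T H conj v = x^T P conj x. Cauchy-Schwarz for
    H then gives |x|^4 <= K |x|^2 times the form of H at x, without eigenvalues. *)
Lemma qform_inv_lower (K : R) : (forall y, Re (qform (invmx H) y) <=
    K * Re (qform 1%:M y)) ->
  forall x, Re (qform 1%:M x) <= K * Re (qform H x).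
Proof.
move=> hK x; set n := Re (qform 1%:M x).
set v := (invmx H)^T *m x.
have e : bform H v x = n%:C.
  by rewrite bform_inv -qform_entry; apply: (ge0_complexP (nonneg_hermitian1.2 x)).1.
have := ip_CS (ph_bform hH) (I : [set: 'cV[R[i]]_T] v) (I : [set: 'cV[R[i]]_T] x).
rewrite e nsqZ /n2 -!qform_entry qform_inv => cs.
have n0 : 0 <= n by apply: ge0_Re; exact: nonneg_hermitian1.2.
have q0 : 0 <= Re (qform H x) by apply: ge0_Re; exact: hH.2.
have P0 : 0 <= Re (qform (invmx H) x).
  by apply: ge0_Re; exact: (nonneg_hermitian_inv hH).2.
have [nz|nn] := eqVneq n 0; last first.
  have np : 0 < n by rewrite lt_neqAle eq_sym nn.
  rewrite -(ler_pM2l np) -expr2; apply: (le_trans cs).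
  by rewrite mulrCA mulrA; apply: ler_wpM2r => //; exact: hK.
have xz : x = 0.
  apply/colP => k; rewrite mxE; apply: nsq_eq0.
  apply/eqP; rewrite eq_le nsq_ge0 andbT -nz /n qform1 (bigD1 k)//= lerDl.
  by apply: sumr_ge0 => j _; exact: nsq_ge0.
by rewrite nz xz /qform trmx0 !mul0mx mxE mulr0.
Qed.

End Inverse.
End MatrixBounds.

(** * Matrix functions acting between the weighted spaces *)

Section SpectralWeights.
Context {R : realType} {T : nat}.
Implicit Types (f g : R -> 'cV[R[i]]_T) (W M : R -> 'M[R[i]]_T) (q : seq (R[i] * (int * 'I_T))).
Local Notation chi := (@chi R T).
Local Notation leb := (@lebesgue_measure R).
Local Notation circ := (@circ R).
Local Notation one := (fun=> 1%:M : 'M[R[i]]_T).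

Definition mulmv M f : R -> 'cV[R[i]]_T := fun t => M t *m f t.

Definition measurable_mx M : Prop := forall k l, cmeasurable circ (fun t => M t k l).

Lemma measurable_mulmv M f : measurable_mx M -> measurable_vec f -> measurable_vec (mulmv M f).
Proof.
move=> mM mf k; apply: (@eq_cmeasurable _ _ _ _ (fun t => \sum_l M t k l * f t l 0)).
  by move=> t _; rewrite /mulmv mxE.
by apply: cmeasurable_sum => l; exact: cmeasurableM (mM k l) (mf l).
Qed.

Lemma measurable_trmx M : measurable_mx M -> measurable_mx (fun t => (M t)^T).
Proof.
by move=> mM k l; apply: eq_cmeasurable (mM l k) => t _; rewrite mxE.
Qed.

Lemma mulmv_lin M c f g : mulmv M (c *: f + g) = c *: mulmv M f + mulmv M g.
Proof. by apply/funext => t; rewrite /mulmv mulmxDr -scalemxAr. Qed.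

Lemma ncvg_dom W1 W2 (u1 u2 : nat -> R -> 'cV[R[i]]_T) f1 f2 (c : R) :
  0 <= c -> weight W1 -> weight W2 ->
  measurable_vec f1 -> (forall n, measurable_vec (u1 n)) ->
  (forall n, circ_ae (fun t => Re (qform (W1 t) (u1 n t - f1 t)) <=
     c * Re (qform (W2 t) (u2 n t - f2 t)))) ->
  L2w W2 f2 -> (forall n, L2w W2 (u2 n)) -> ncvg (ipw W2) u2 f2 -> ncvg (ipw W1) u1 f1.
Proof.
move=> c0 h1 h2 mf mu hle Lf Lu h.
have m n : measurable_vec (u1 n - f1).
  have := measurable_vec_lin (-1) mf (mu n); rewrite scaleN1r addrC; exact.
have h3 : (fun n => c * n2 (ipw W2) (u2 n - f2)) @ \oo --> (0 : R).
  by rewrite -(mulr0 c); apply: cvgM => //; exact: cvg_cst.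
apply: (cvg0_le _ h3) => n; apply/andP; split.
  have L2 := phB (ph_w h2) (Lu n) Lf.
  exact: (n2_ge0 (ph_w h1) (L2w_dom h1 h2 (m n) (hle n) L2)).
exact: (n2_dom c0 h1 h2 (m n) (hle n) (phB (ph_w h2) (Lu n) Lf)).
Qed.

Lemma eq_cmean (u v : R -> R[i]) : (forall t, circ t -> u t = v t) -> cmean u = cmean v.
Proof. by move=> h; rewrite /cmean (eq_cintegral leb h). Qed.

Section Fixed.
Variables F G : R -> 'M[R[i]]_T.
Hypothesis hF : spectral_density F.
Hypothesis hG : spectral_density G.
Hypothesis hmin : minimality (fun t => F t + G t).
Local Notation H := (fun t => F t + G t).
Local Notation P := (fun t => invmx (F t + G t)).
Local Notation PT := (fun t => (invmx (F t + G t))^T).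

Lemma weight_density W : spectral_density W -> weight W.
Proof.
move=> hW; split; last exact: hW.2.
by move=> k l; rewrite cmeasurable_lebE; exact: cintegrable_meas (hW.1 k l).
Qed.

Let wF := weight_density hF.
Let wG := weight_density hG.
Let wH := weightD wF wG.
Let w1 := @weight1 R T.
Let uH := hmin.1.
Let iP := hmin.2.
Let iF := hF.1.
Let iG := hG.1.

Lemma weight_inv : weight P.
Proof.
split; last by move=> t ct; apply: nonneg_hermitian_inv; exact: wH.2.
by move=> k l; rewrite cmeasurable_lebE; exact: cintegrable_meas (iP k l).
Qed.
Let wP := weight_inv.

Lemma measurable_PT : measurable_mx PT.
Proof. exact: measurable_trmx wP.1. Qed.

Lemma qform_F_le t x : circ t ->
  Re (qform (F t) x) <= Re (qform (F t + G t) x).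
Proof. by move=> ct; apply: nonneg_hermitian_le; exact: hG.2. Qed.

Lemma qform_G_le t x : circ t ->
  Re (qform (G t) x) <= Re (qform (F t + G t) x).
Proof. by move=> ct; rewrite addrC; apply: nonneg_hermitian_le; exact: hF.2. Qed.

Lemma L2w_HF f : L2w H f -> L2w F f.
Proof.
apply: (L2w_le (c := 1) wF wH); apply: circ_aeT => t ct x; rewrite mul1r; exact: qform_F_le.
Qed.

Lemma L2w_HG f : L2w H f -> L2w G f.
Proof.
apply: (L2w_le (c := 1) wG wH); apply: circ_aeT => t ct x; rewrite mul1r; exact: qform_G_le.
Qed.

(** Multiplication by P^T is isometric from L2(P) to L2(H), pointwise wherever H is invertible. *)
Lemma L2w_PT f : L2w P f -> L2w H (mulmv PT f).
Proof.
move=> hf; apply: (L2w_dom (c := 1) wH wP (measurable_mulmv measurable_PT hf.1) _ hf).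
apply: circ_aeS uH => t ct ut; rewrite mul1r /mulmv qform_inv//; exact: wH.2.
Qed.

(** For W <= H, multiplication by P^T W^T is a contraction from L2(W) to L2(H). It is applied with W
    = F and W = G, and needs no essential bound. *)
Lemma L2w_PTW W f : weight W ->
  (forall t x, circ t -> Re (qform (W t) x) <= Re (qform (F t + G t) x)) ->
  L2w W f -> L2w H (mulmv PT (mulmv (fun t => (W t)^T) f)).
Proof.
move=> wW WH hf; apply: (L2w_dom (c := 1) wH wW _ _ hf).
  apply: measurable_mulmv; first exact: measurable_PT.
  by apply: measurable_mulmv hf.1; exact: measurable_trmx wW.1.
apply: circ_aeS uH => t ct ut; rewrite mul1r /mulmv; apply: qform_inv_mul_le => //.
- exact: wH.2.
- exact: wW.2.
- by move=> y; exact: WH.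
Qed.

Lemma ipw_PT W f g : ipw W f (mulmv PT g) = ipw (fun t => W t *m P t) f g.
Proof.
rewrite (ipwE W) (ipwE (fun t => W t *m P t)); apply: eq_cmean => t ct.
by rewrite /mulmv bform_mulr (hermT (wP.2 t ct).1).
Qed.

Lemma ipw_inv f g : measurable_vec f -> measurable_vec g ->
  ipw H (mulmv PT f) g = ipw one f g.
Proof.
move=> mf mg; rewrite !ipwE; apply: cmean_ae.
- by apply: cmeasurable_bform => //; [exact: wH.1|exact: measurable_mulmv measurable_PT mf].
- by apply: cmeasurable_bform => //; exact: w1.1.
- by apply: circ_aeS uH => t ct ut; rewrite /mulmv bform_inv.
Qed.

Section Bounded.
Variable U : set int.
Hypothesis hU : forall n : nat, U n%:Z.
Hypothesis hB : defined_on_l2 U (Bblock F G).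
Variable Binv : (int -> 'cV[R[i]]_T) -> int -> 'cV[R[i]]_T.
Hypothesis hBinv : inverse_on_l2 U (Bblock F G) Binv.

Lemma P_le_1 : exists2 K : R, 0 <= K & circ_ae (fun t => forall x,
  Re (qform (invmx (F t + G t)) x) <= K * Re (qform 1%:M x)).
Proof.
have [K K0 hK] := toep_upper hU wP iP hB.
exists (2 ^+ T * K); first by rewrite mulr_ge0// exprn_ge0.
apply: circ_aeS (diag_bound wP iP hK) => t ct h x.
exact: (qform_diag_le x (wP.2 _ ct) h).
Qed.

(** Surjectivity of B bounds P from below on polynomials, which becomes a bound on the diagonal of
    H; 2^T is the price of passing from the diagonal to the form. *)
Lemma H_le_1 : exists2 K : R, 0 <= K & circ_ae (fun t => forall x,
  Re (qform (F t + G t) x) <= K * Re (qform 1%:M x)).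
Proof.
have [|K K0 hK] := toep_lower hU wP iP hB.
  by move=> y /hBinv.2[h1 h2]; exists (Binv y).
exists (2 ^+ T * K); first by rewrite mulr_ge0// exprn_ge0.
apply: circ_aeS (diag_bound_inv K0 wH uH iP hK) => t ct h x.
exact: (qform_diag_le x (wH.2 _ ct) h).
Qed.

Lemma one_le_H : exists2 K : R, 0 <= K & circ_ae (fun t => forall x,
  Re (qform 1%:M x) <= K * Re (qform (F t + G t) x)).
Proof.
have [K K0 hK] := P_le_1; exists K; first exact: K0.
apply: circ_aeS (circ_aeI hK uH) => t ct [h ut] x.
exact: (qform_inv_lower (wH.2 _ ct) ut h).
Qed.

Lemma L2w_H1 f : L2w H f -> L2w one f.
Proof. by have [K _ hK] := one_le_H; exact: L2w_le w1 wH hK. Qed.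

Lemma L2w_1P f : L2w one f -> L2w P f.
Proof. by have [K _ hK] := P_le_1; exact: L2w_le wP w1 hK. Qed.

End Bounded.
End Fixed.
End SpectralWeights.

(** * The optimal characteristic in the spectral domain *)

Section SummableCoefficients.
Context {R : realType} {T : nat}.
Implicit Types (W : R -> 'M[R[i]]_T).
Local Notation chi := (@chi R T).
Local Notation leb := (@lebesgue_measure R).
Local Notation circ := (@circ R).
Variables (D : set int) (a : int -> 'cV[R[i]]_T).
Hypothesis ha : (\esum_(j in D) (\sum_(k < T) normc (a j k 0))%R%:E < +oo)%E.

Lemma subcE (x y : 'cV[R[i]]_T) k : (x - y) k 0 = x k 0 - y k 0.
Proof. by rewrite !mxE. Qed.

Lemma zrange_opp n : perm_eq [seq - j | j <- zrange n] (zrange n).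
Proof.
apply: uniq_perm; first by rewrite map_inj_uniq ?zrange_uniq//; exact: oppr_inj.
  exact: zrange_uniq.
move=> j; rewrite -{1}(opprK j) (mem_map oppr_inj) !mem_zrange abszN//.
Qed.

Lemma sum_zrange_opp (V : nmodType) (f : int -> V) n :
  \sum_(j <- zrange n) f (- j) = \sum_(j <- zrange n) f j.
Proof.
by rewrite -[RHS](perm_big _ (zrange_opp n)) [RHS]big_map. Qed.

(* The Fourier coefficients of A(e^{it}). *)
Definition reflect_coef : int -> 'cV[R[i]]_T := fun j => ext0 D a (- j).
Local Notation alpha := reflect_coef.

Lemma Tz_reflect n t k : Tz alpha n t k 0 = psum D (fun j => a j k 0 * cis (- (j%:~R * t))) n.
Proof.
rewrite TzE summxE -sum_zrange_opp /psum [RHS]big_mkcond; apply: eq_bigr => j _.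
rewrite /alpha opprK !mxE /ext0 mulrNz mulNr mulrC; case: ifP => // _.
by rewrite mxE mul0r.
Qed.

Let w j : R := \sum_(k < T) normc (a j k 0).
Let w0 j : D j -> 0 <= w j.
Proof. by move=> _; apply: sumr_ge0 => k _; exact: normc_ge0. Qed.

Definition coef_mass : R := fine (\esum_(j in D) (\sum_(k < T) normc (a j k 0))%R%:E)%E.
Local Notation S := coef_mass.

Lemma psum_mass n : psum D w n <= S.
Proof. exact: psum_le_esum. Qed.

Lemma mass_ge0 : 0 <= S.
Proof. exact: le_trans (psum_ge0 0 w0) (psum_mass 0). Qed.

Lemma coef_le_mass j : D j -> w j <= S.
Proof.
move=> Dj; apply: le_trans (psum_mass `|j|%N); rewrite psum_filter.
have jr : j \in [seq j <- zrange `|j|%N | j \in D].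
  by rewrite mem_filter mem_zrange leqnn andbT; exact: mem_set.
rewrite (bigD1_seq j jr (filter_uniq _ (zrange_uniq _))) /=.
by rewrite lerDl; apply: sumr_ge0 => i _; apply: sumr_ge0 => k _; exact: normc_ge0.
Qed.

Lemma cvg_sum0 (I : Type) (r : seq I) (u : I -> nat -> R) :
  (forall i, u i @ \oo --> (0 : R)) -> (fun n => \sum_(i <- r) u i n) @ \oo --> (0 : R).
Proof.
move=> h; elim: r => [|i r ih].
  by under eq_fun do rewrite big_nil; exact: cvg_cst.
under eq_fun do rewrite big_cons.
by have := cvgD (h i) ih; rewrite addr0; exact.
Qed.

Lemma normc_sum_le (I : Type) (r : seq I) (Q : pred I) (f : I -> R[i]) :
  normc (\sum_(i <- r | Q i) f i) <= \sum_(i <- r | Q i) normc (f i).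
Proof.
elim/big_rec2 : _ => [|i y1 y2 _ h]; first by rewrite normc0.
by apply: le_trans (lerD (lexx _) h); exact: le_normcD.
Qed.

Lemma normc_cis x : normc (cis x : R[i]) = 1.
Proof. by rewrite /cis /= cos2Dsin2 sqrtr1. Qed.

Lemma normc_entry j k : normc (a j k 0) <= w j.
Proof. by rewrite /w (bigD1 k)//= lerDl; apply: sumr_ge0 => l _; exact: normc_ge0. Qed.

Lemma normc_term j k t : normc (a j k 0 * cis (- (j%:~R * t))) <= w j.
Proof. by rewrite normcM normc_cis mulr1; exact: normc_entry. Qed.

Lemma nsq_Tz_reflect n t k : nsq (Tz alpha n t k 0) <= S ^+ 2.
Proof.
rewrite /nsq lerXn2r ?nnegrE ?normc_ge0 ?mass_ge0//.
rewrite Tz_reflect; apply: le_trans (psum_mass n); apply: (le_trans (normc_sum_le _ _ _)).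
by apply: ler_sum => j _; exact: normc_term.
Qed.

Lemma abs_summable_le (E : set int) (f : int -> R[i]) (M : R) :
  (forall L, psum E (fun j => normc (f j)) L <= M) -> abs_summable E f.
Proof.
move=> h; apply: le_lt_trans (ltry M); apply: esum_le_psum => // j _; exact: normc_ge0.
Qed.

Lemma Tz_reflect_cvg t k : ccvg (fun n => Tz alpha n t k 0) (Afun D a t k 0).
Proof.
rewrite /Afun mxE; have -> : (fun n => Tz alpha n t k 0) =
    psum D (fun j => a j k 0 * cis (- (j%:~R * t))) by apply/funext => n; exact: Tz_reflect.
apply: csum_cvg; apply: (@abs_summable_le _ _ S) => L.
apply: le_trans (psum_mass L); apply: ler_sum => j _; exact: normc_term.
Qed.

Lemma nsq_Afun t k : nsq (Afun D a t k 0) <= S ^+ 2.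
Proof. exact: nsq_ccvg_le (Tz_reflect_cvg t k) (fun n => nsq_Tz_reflect n t k). Qed.

Lemma measurable_Tz z n : measurable_vec (@Tz R T z n).
Proof. exact: (L2w_Tz z n (@weight1 R T) (@integrable_mx1 R T)).1. Qed.

Lemma measurable_Afun : measurable_vec (Afun D a).
Proof.
move=> k; have h t := (ccvgP _ _).1 (Tz_reflect_cvg t k).
split.
- apply: (measurable_fun_cvg (fun n => (measurable_Tz alpha n k).1)) => t _.
  exact: (h t).1.
- apply: (measurable_fun_cvg (fun n => (measurable_Tz alpha n k).2)) => t _.
  exact: (h t).2.
Qed.

Lemma L2w_Afun W : weight W -> integrable_mx W -> L2w W (Afun D a).
Proof.
by move=> hW iW; apply: (L2w_bounded hW iW measurable_Afun (M := S ^+ 2)) => t _ k; exact: nsq_Afun.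
Qed.

Lemma ncvg_Afun W : weight W -> integrable_mx W -> ncvg (ipw W) (Tz alpha) (Afun D a).
Proof.
move=> hW iW.
(* Partial sums and limit are bounded entrywise by S, so squared differences are at most 2 S^2 + 2
   S^2. *)
pose B t := 2 ^+ T * (\sum_k (4 * S ^+ 2) * Re (W t k k)).
apply: (ncvg_w (G := B) hW measurable_Afun (measurable_Tz alpha)).
- have e t : (\sum_k ((4 * S ^+ 2)%:E * (Re (W t k k))%:E) =
      (\sum_k (4 * S ^+ 2) * Re (W t k k))%R%:E)%E.
    by rewrite -sumEFin; apply: eq_bigr => k _; rewrite EFinM.
  have h : leb.-integrable circ (fun t => \sum_k ((4 * S ^+ 2)%:E * (Re (W t k k))%:E))%E.
    apply: integrable_sum => // k _.
    by have := integrableZl measurable_circ (4 * S ^+ 2) (iW k k).1.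
  have := integrableZl measurable_circ (2 ^+ T) h.
  by apply: eq_integrable => // t _; rewrite e -EFinM.
- move=> n t ct; apply: (le_trans (qform_le_diag _ (hW.2 t ct))); apply: ler_wpM2l.
    by rewrite exprn_ge0.
  apply: ler_sum => k _; apply: ler_wpM2r.
    by rewrite -qform_delta; exact: qform_Re_ge0.
  rewrite subcE; apply: (le_trans (nsqD_le _ _)); rewrite nsqN.
  have := nsq_Tz_reflect n t k; have := nsq_Afun t k; lra.
- apply: circ_aeT => t ct.
  pose v n := 2 ^+ T * \sum_k nsq (Tz alpha n t k 0 - Afun D a t k 0) * Re (W t k k).
  apply: (@cvg0_le _ _ v) => [n|].
    apply/andP; split; first exact: qform_Re_ge0.
    apply: (le_trans (qform_le_diag _ (hW.2 t ct))); rewrite /v; apply: ler_wpM2l.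
      by rewrite exprn_ge0.
    by apply: ler_sum => k _; rewrite subcE.
  rewrite -(mulr0 (2 ^+ T)); apply: cvgM; first exact: cvg_cst.
  apply: cvg_sum0 => k; rewrite -(mul0r (Re (W t k k))); apply: cvgM; last exact: cvg_cst.
  exact: Tz_reflect_cvg.
Qed.

Variable U : set int.
Hypothesis DU : D `<=` U.

Lemma ext0_vanish : vanish U (ext0 D a).
Proof.
move=> k nU; rewrite /ext0; case: ifP => // /set_mem /DU; contradiction.
Qed.

(** Summability gives square summability: each entry is at most the total mass S, so its square is
    at most S times the entry. *)
Lemma ext0_l2 : l2 U (ext0 D a).
Proof.
split=> [k nU|].
  by apply/funext => i; apply/funext => j; rewrite (ext0_vanish nU) mxE.
apply: le_lt_trans (ltry (S * S)); apply: esum_le_psum.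
  by move=> j _; apply: sumr_ge0 => k _; exact: nsq_ge0.
move=> L; apply: (@le_trans _ _ (psum D (fun j => S * w j) L)); last first.
  by rewrite /psum -mulr_sumr; apply: ler_wpM2l (psum_mass L); exact: mass_ge0.
rewrite /psum big_mkcond [leRHS]big_mkcond; apply: ler_sum => j _.
rewrite /ext0; case: ifP => [/set_mem Uj|nU]; last first.
  by case: ifP => // /set_mem Dj; rewrite mulr_ge0 ?mass_ge0 ?w0.
case: ifP => [/set_mem Dj|_]; last by rewrite big1// => k _; rewrite mxE nsq0.
rewrite /w mulr_sumr; apply: ler_sum => k _; rewrite /nsq expr2 ler_wpM2r ?normc_ge0//.
exact: le_trans (normc_entry j k) (coef_le_mass Dj).
Qed.

End SummableCoefficients.

Section OptimalCharacteristic.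
Context {R : realType} {T : nat}.
Implicit Types (f g : R -> 'cV[R[i]]_T) (W M : R -> 'M[R[i]]_T) (q : seq (R[i] * (int * 'I_T))).
Local Notation chi := (@chi R T).
Local Notation circ := (@circ R).
Local Notation one := (fun=> 1%:M : 'M[R[i]]_T).

Lemma realCD (x y : R) : (x + y)%:C = x%:C + y%:C.
Proof. by apply: complex_eqP; rewrite ?cReD ?cImD /= ?addr0. Qed.

Lemma ccvg_ipr (V : lmodType R[i]) (L : set V) ip (ph : prehilbert L ip)
    (u : nat -> V) x y : L x -> L y -> (forall n, L (u n)) -> ncvg ip u x ->
  ccvg (fun n => ip y (u n)) (ip y x).
Proof.
move=> Lx Ly Lu h; have := ncvg_ip ph Lx Ly Lu h; rewrite /ccvg.
rewrite (_ : (fun n => nsq (ip y (u n) - ip y x)) = (fun n => nsq (ip (u n) y - ip x y)))//.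
apply/funext => n; rewrite (ph_ipC ph Ly (Lu n)) (ph_ipC ph Ly Lx) -conjB nsqJ //.
Qed.

Lemma mulmv_sum M I (r : seq I) (f : I -> R -> 'cV[R[i]]_T) :
  mulmv M (\sum_(i <- r) f i) = \sum_(i <- r) mulmv M (f i).
Proof.
elim: r => [|i r ih]; last first.
  by rewrite !big_cons -ih -{1}(scale1r (f i)) mulmv_lin scale1r.
by rewrite !big_nil; apply/funext => t; rewrite /mulmv mulmx0.
Qed.

Lemma mulmvZ M c f : mulmv M (c *: f) = c *: mulmv M f.
Proof. by apply/funext => t; rewrite /mulmv -scalemxAr. Qed.

Lemma ip_mulmv_Tz W M f z L : weight W -> L2w W f ->
  (forall i, L2w W (mulmv M (chi i))) ->
  ipw W f (mulmv M (Tz z L)) =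
  \sum_(j <- zrange L) \sum_i Num.conj (z j i 0) * ipw W f (mulmv M (chi (j, i))).
Proof.
move=> hW hf hM.
have L0 : L2w W (0 : R -> 'cV[R[i]]_T) := ph0 (ph_w hW) hf.
have hz j i : L2w W (z j i 0 *: mulmv M (chi (j, i))) := phZ (ph_w hW) _ (hM _).
have e : mulmv M (Tz z L) =
    \sum_(j <- zrange L) \sum_i z j i 0 *: mulmv M (chi (j, i)).
  rewrite /Tz mulmv_sum; apply: eq_bigr => j _; rewrite mulmv_sum; apply: eq_bigr => i _.
  exact: mulmvZ.
have hs j : L2w W (\sum_i z j i 0 *: mulmv M (chi (j, i))).
  exact: (ph_sum (ph_w hW) (index_enum 'I_T) L0 (fun i (_ : xpredT i) => hz j i)).
rewrite e (ip_sumr (ph_w hW) (zrange L) hf (fun j (_ : xpredT j) => hs j)).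
apply: eq_bigr => j _.
rewrite (ip_sumr (ph_w hW) (index_enum 'I_T) hf (fun i (_ : xpredT i) => hz j i)).
by apply: eq_bigr => i _; rewrite (ipZr (ph_w hW) _ (hM _) hf).
Qed.

Lemma ipwD W1 W2 f g : weight W1 -> weight W2 -> L2w W1 f -> L2w W1 g ->
  L2w W2 f -> L2w W2 g ->
  ipw (fun t => W1 t + W2 t) f g = ipw W1 f g + ipw W2 f g.
Proof.
move=> h1 h2 f1 g1 f2 g2; rewrite (ipwE W1) (ipwE W2) ipwE /cmean -mulrDr; congr (_ * _).
rewrite -(cintegralD measurable_circ (L2w_bform h1 f1 g1) (L2w_bform h2 f2 g2)).
by apply: eq_cintegral => t _; rewrite bform_add.
Qed.

Lemma comb_filter (V : lmodType R[i]) I (x : I -> V) (p : seq (R[i] * I)) (Q : pred (R[i] * I)) :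
  comb x p = comb x [seq r <- p | Q r] + comb x [seq r <- p | ~~ Q r].
Proof. by rewrite /comb !big_filter (bigID Q). Qed.

Section OnU.
Variables F G : R -> 'M[R[i]]_T.
Hypothesis hF : spectral_density F.
Hypothesis hG : spectral_density G.
Hypothesis hmin : minimality (fun t => F t + G t).
Local Notation H := (fun t => F t + G t).
Local Notation P := (fun t => invmx (F t + G t)).
Local Notation PT := (fun t => (invmx (F t + G t))^T).
Local Notation FT := (fun t => (F t)^T).
Local Notation GT := (fun t => (G t)^T).
Let wF := weight_density hF.
Let wG := weight_density hG.
Let wH := weightD wF wG.
Let w1 := @weight1 R T.
Let i1 := @integrable_mx1 R T.
Let uH := hmin.1.
Let iP := hmin.2.
Let wP := weight_inv hF hG hmin.
Let iF := hF.1.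
Let iG := hG.1.
Let iH := integrable_mxD iF iG.
Variable U : set int.
Hypothesis hU : forall n : nat, U n%:Z.
Hypothesis hB : defined_on_l2 U (Bblock F G).
Hypothesis hR : defined_on_l2 U (Rblock F G).
Hypothesis hQ : defined_on_l2 U (Qblock F G).
Variable Binv : (int -> 'cV[R[i]]_T) -> int -> 'cV[R[i]]_T.
Hypothesis hBinv : inverse_on_l2 U (Bblock F G) Binv.
Variables (D : set int) (a : int -> 'cV[R[i]]_T).
Hypothesis ha : (\esum_(j in D) (\sum_(k < T) normc (a j k 0))%R%:E < +oo)%E.
Hypothesis DU : D `<=` U.
Local Notation av := (ext0 D a).
Local Notation A := (Afun D a).
Local Notation alpha := (reflect_coef D a).
Local Notation Ra := (block_op U (Rblock F G) (ext0 D a)).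
Local Notation Qa := (block_op U (Qblock F G) (ext0 D a)).
Local Notation c := (Binv (block_op U (Rblock F G) (ext0 D a))).
Variable C : R -> 'cV[R[i]]_T.
Hypothesis hC : is_fourier_series U c C.

(** Common to R and Q. The partial sums of A have coefficient a(j) at frequency -j, so the Toeplitz
    matrix of X is read at (k, -j): for X = F P this is R, and for X = F P G with k reflected as
    well it is Q. *)
Lemma ip_Tz_reflect M (X : R -> 'M[R[i]]_T) (Y : int -> 'M[R[i]]_T) (k : int) l :
  L2w F (mulmv M (chi (k, l))) ->
  (forall f g, ipw F f (mulmv M g) = ipw X f g) ->
  (forall j, toep X k (- j) = Y j) ->
  (fun n => ipw F (Tz alpha n) (mulmv M (chi (k, l)))) =
  psum U (fun j => (Y j *m av j) l 0).
Proof.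
move=> hM hX hY; apply/funext => n.
rewrite (ip_TzE _ _ wF iF hM) -sum_zrange_opp /psum [RHS]big_mkcond; apply: eq_bigr => j _.
case: ifPn => [_|]; last first.
  rewrite notin_setE => nU; rewrite big1// => i _.
  by rewrite /reflect_coef opprK (ext0_vanish a DU nU) mxE mul0r.
rewrite mxE; apply: eq_bigr => m _.
by rewrite hX ip_chi mulrC /reflect_coef opprK -hY.
Qed.

Lemma L2w_PT_chi i : L2w H (mulmv PT (chi i)).
Proof. by apply: (L2w_PT hF hG hmin); exact: L2w_chi i wP iP. Qed.

Lemma L2w_A W : weight W -> integrable_mx W -> L2w W A.
Proof. exact: L2w_Afun. Qed.

Lemma toep_R k j : toep (fun t => F t *m invmx (F t + G t)) k (- j) = Rblock F G k j.
Proof. by rewrite /toep /Rblock opprK. Qed.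

Lemma toep_Q k j :
  toep (fun t => F t *m invmx (F t + G t) *m G t) (- k) (- j) = Qblock F G k j.
Proof.
rewrite /toep /Qblock; congr mean_mx; apply/funext => t; congr (cis _ *: _).
by rewrite -opprD mulrNz mulNr opprK.
Qed.

(** The symbol F P of R is in general not Hermitian and gives no inner product. Moving P^T to the
    second factor keeps the weight F, where limits of products are available. *)
Lemma ip_A_PT k l : U k -> ipw F A (mulmv PT (chi (k, l))) = Ra k l 0.
Proof.
move=> Uk; have hM : L2w F (mulmv PT (chi (k, l))) := L2w_HF hF hG (L2w_PT_chi (k, l)).
have h1 := ncvg_ip (ph_w wF) (L2w_A wF iF) hM (fun n => L2w_Tz alpha n wF iF)
   (ncvg_Afun ha wF iF).
apply: (ccvg_unique h1).
rewrite (ip_Tz_reflect hM (ipw_PT hF hG hmin F) (toep_R k)) /block_op mem_set// mxE.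
exact: csum_cvg ((hR (ext0_l2 ha DU)).1 k Uk l).
Qed.

Lemma L2w_PTGT f : L2w G f -> L2w H (mulmv PT (mulmv GT f)).
Proof. by move=> hf; apply: (L2w_PTW hF hG hmin wG _ hf) => t x ct; exact: qform_G_le hF t x ct. Qed.

Lemma L2w_PTFT f : L2w F f -> L2w H (mulmv PT (mulmv FT f)).
Proof. by move=> hf; apply: (L2w_PTW hF hG hmin wF _ hf) => t x ct; exact: qform_F_le hG t x ct. Qed.

(** The same device for the symbol F P G; the frequency is -k because A enters Q on both sides and
    is reflected in both. *)
Lemma ip_A_PTGT k l : U k -> ipw F A (mulmv PT (mulmv GT (chi (- k, l)))) = Qa k l 0.
Proof.
move=> Uk; have hM : L2w F (mulmv PT (mulmv GT (chi (- k, l)))).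
  apply: (L2w_HF hF hG); apply: L2w_PTGT; exact: (L2w_chi (- k, l) wG iG).
have h1 := ncvg_ip (ph_w wF) (L2w_A wF iF) hM (fun n => L2w_Tz alpha n wF iF)
   (ncvg_Afun ha wF iF).
apply: (ccvg_unique h1).
have e g : mulmv PT (mulmv GT g) = mulmv (fun t => (invmx (F t + G t))^T *m (G t)^T) g.
  by apply/funext => t; rewrite /mulmv mulmxA.
rewrite e in hM *.
rewrite (ip_Tz_reflect hM _ (toep_Q k)) => [|f g]; last first.
  rewrite -e (ipw_PT hF hG hmin F) (ipwE (fun t => F t *m _)) (ipwE (fun t => F t *m _ *m _)).
  apply: eq_cmean => t ct; rewrite /mulmv bform_mulr (hermT (wG.2 t ct).1)//.
rewrite /block_op mem_set// mxE.
exact: csum_cvg ((hQ (ext0_l2 ha DU)).1 k Uk l).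
Qed.

Lemma l2_Ra : l2 U Ra.
Proof. exact: (hR (ext0_l2 ha DU)).2. Qed.

Lemma l2_c : l2 U c. Proof. exact: (hBinv.2 _ l2_Ra).1. Qed.

Lemma Bc : block_op U (Bblock F G) c = Ra. Proof. exact: (hBinv.2 _ l2_Ra).2. Qed.

Lemma fourier_partial n : (fun t => C t - psum U (fun k => cis (k%:~R * t) *: c k) n) =
  C - Tz c n.
Proof. by apply/funext => t; rewrite (psum_Tz _ _ (l2_vanish l2_c)). Qed.

Lemma wnorm_partial_cvg : (fun n => wnorm one (C - Tz c n)) @ \oo --> 0%E.
Proof.
have e : (fun n => wnorm one (fun t => C t - psum U (fun k => cis (k%:~R * t) *: c k) n)) =
    (fun n => wnorm one (C - Tz c n)).
  by apply/funext => n; rewrite (fourier_partial n).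
by rewrite -e; exact: hC.2.
Qed.

(** C is only assumed measurable with partial sums converging to it; some partial sum is at finite
    distance, and partial sums are in L2. *)
Lemma L2w_C : L2w one C.
Proof.
have [n hn] : exists n, (wnorm one (C - Tz c n)%R < 1)%E.
  have [n _ h] := wnorm_partial_cvg (open_ereal_lt' (lte01 : (0 < 1 :> \bar R)%E)).
  by exists n; exact: h n (leqnn n).
have L1 : L2w one (C - Tz c n).
  split; last exact: lt_trans hn (ltry 1).
  have := measurable_vec_lin (-1) (measurable_Tz c n) hC.1; rewrite scaleN1r addrC; exact.
by rewrite -(subrK (Tz c n) C); exact: (phD (ph_w w1) L1 (L2w_Tz c n w1 i1)).
Qed.

Lemma ncvg_C1 : ncvg (ipw one) (Tz c) C.
Proof.
rewrite /ncvg.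
have L1 n : L2w one (C - Tz c n) := phB (ph_w w1) L2w_C (L2w_Tz c n w1 i1).
have e n : n2 (ipw one) (Tz c n - C) = (2 * pi)^-1 * fine (wnorm one (C - Tz c n)).
  rewrite (wnormE w1 (L1 n)) /= mulrA mulVf ?mul1r; last by rewrite gt_eqF// two_pi_gt0.
  exact: (n2C (ph_w w1) (L2w_Tz c n w1 i1) L2w_C).
rewrite (_ : (fun n => _) = (fun n => (2 * pi)^-1 * fine (wnorm one (C - Tz c n)))); last first.
  by apply/funext => n; rewrite e.
rewrite -(mulr0 (2 * pi)^-1); apply: cvgM; first exact: cvg_cst.
exact: (fine_cvg wnorm_partial_cvg).
Qed.

Lemma ncvg_CP : ncvg (ipw P) (Tz c) C.
Proof.
have [K K0 hK] := P_le_1 hF hG hmin hU hB.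
apply: (ncvg_dom K0 wP w1 L2w_C.1 (measurable_Tz c) _ L2w_C (fun n => L2w_Tz c n w1 i1) ncvg_C1).
by move=> n; apply: circ_aeS hK => t ct; exact.
Qed.

Lemma L2w_CP : L2w P C.
Proof. exact: L2w_1P hF hG hmin _ hU hB _ L2w_C. Qed.

Lemma ip_P_C k l : U k -> ipw P C (chi (k, l)) = Ra k l 0.
Proof.
move=> Uk; rewrite -Bc.
have h1 := ncvg_ip (ph_w wP) L2w_CP (L2w_chi (k, l) wP iP) (fun n => L2w_Tz c n wP iP) ncvg_CP.
have h2 := ip_Tz_cvg wP iP hB l l2_c Uk.
exact: (ccvg_unique h1 h2).
Qed.

Definition opt_char : R -> 'cV[R[i]]_T := mulmv PT (mulmv FT A) - mulmv PT C.
Local Notation h0 := opt_char.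

Lemma opt_charE t : h0 t = (hT F G A C t)^T.
Proof.
by rewrite /hT linearB /= !trmx_mul !trmxK.
Qed.

Lemma L2w_opt : L2w H h0.
Proof.
apply: (phB (ph_w wH)); first exact: L2w_PTFT (L2w_A wF iF).
exact: L2w_PT hF hG hmin _ L2w_CP.
Qed.

Lemma ip_H_opt g : L2w H g -> ipw H h0 g = ipw F A g - ipw one C g.
Proof.
move=> hg; have LA := L2w_A wF iF.
have L1 := L2w_PTFT LA; have L2' := L2w_PT hF hG hmin L2w_CP.
rewrite (ipBl (ph_w wH) L1 L2' hg) (ipw_inv hF hG hmin L2w_C.1 hg.1); congr (_ - _).
rewrite (ipw_inv hF hG hmin _ hg.1); last first.
  by apply: measurable_mulmv LA.1; exact: measurable_trmx wF.1.
rewrite (ipwE F) (ipwE one); apply: eq_cmean => t ct.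
by rewrite /mulmv bform_mull trmxK mulmx1.
Qed.

(** Both parts of h0 have coefficient (R a)(k): the first by [ip_A_PT], the second because it equals
    (B c)(k). The lower bound on H places both parts in unweighted L2. *)
Lemma ip1_opt k l : U k -> ipw one h0 (chi (k, l)) = 0.
Proof.
move=> Uk; have LA := L2w_A wF iF.
have toL1 f : L2w H f -> L2w one f := @L2w_H1 _ _ _ _ hF hG hmin _ hU hB f.
have L1 := toL1 _ (L2w_PTFT LA); have L2' := toL1 _ (L2w_PT hF hG hmin L2w_CP).
rewrite (ipBl (ph_w w1) L1 L2' (L2w_chi (k, l) w1 i1)).
have -> : ipw one (mulmv PT (mulmv FT A)) (chi (k, l)) = Ra k l 0.
  rewrite -(ip_A_PT l Uk) (ipwE F) (ipwE one); apply: eq_cmean => t ct.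
  by rewrite /mulmv !bform_mull !trmxK mulmx1 bform_mulr (hermT (wP.2 t ct).1).
have -> : ipw one (mulmv PT C) (chi (k, l)) = Ra k l 0; last exact: subrr.
rewrite -(ip_P_C l Uk) (ipwE P) (ipwE one); apply: eq_cmean => t ct.
by rewrite /mulmv bform_mull trmxK mulmx1.
Qed.

Definition avoids q : bool := all (fun r => `[< ~ U r.2.1 >]) q.

Lemma ip1_chi_avoids i q : U i.1 -> avoids q -> ipw one (chi i) (comb chi q) = 0.
Proof.
move=> Ui hq; rewrite (ip_comb_r q w1 i1 (L2w_chi i w1 i1)).
rewrite big_seq big1// => r rq; rewrite ip1_chi.
case: eqP => [e|_]; last by rewrite mulr0.
by have /asboolP := allP hq _ rq; rewrite -e.
Qed.

Lemma comb_chi_L2w W q : weight W -> integrable_mx W -> L2w W (comb chi q).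
Proof. by move=> hW iW; apply: trigs_L2w => //; exists q. Qed.

Lemma L2w_opt1 : L2w one h0.
Proof. exact: L2w_H1 hF hG hmin _ hU hB _ L2w_opt. Qed.

(** Approximate in unweighted L2 and drop the frequencies in U. The dropped part is orthogonal to
    the remaining error, so the distance does not grow; the upper bound on H then transfers it to
    L2(H). *)
Lemma opt_approx (e : R) : 0 < e ->
  exists q, avoids q /\ n2 (ipw H) (h0 - comb chi q) < e.
Proof.
move=> e0; have [K K0 hK] := H_le_1 hF hG hmin hU hB hBinv.
(* K may be 0. *)
have e1 : 0 < e / (K + 1) by rewrite divr_gt0// ltr_wpDl.
have [p hp] := trigs_dense w1 i1 L2w_opt1 e1.
pose Q (r : R[i] * (int * 'I_T)) := `[< U r.2.1 >].
pose pU := [seq r <- p | Q r]; pose pO := [seq r <- p | ~~ Q r].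
have aO : avoids pO.
  by apply/allP => r; rewrite mem_filter => /andP[/asboolPn h _]; apply/asboolP.
have LO := comb_chi_L2w pO w1 i1; have LU := comb_chi_L2w pU w1 i1.
have uU r : r \in pU -> U r.2.1 by rewrite mem_filter => /andP[/asboolP].
exists pO; split; first exact: aO.
have LD := phB (ph_w w1) L2w_opt1 LO.
have z : ipw one (h0 - comb chi pO) (comb chi pU) = 0.
  rewrite (ip_comb_r pU w1 i1 LD) big_seq big1// => r /uU Ur.
  rewrite (ipBl (ph_w w1) L2w_opt1 LO (L2w_chi r.2 w1 i1)).
  rewrite (ph_ipC (ph_w w1) LO (L2w_chi r.2 w1 i1)) ip1_chi_avoids// conj0 subr0.
  by rewrite [r.2]surjective_pairing ip1_opt// mulr0.
have hle : n2 (ipw one) (h0 - comb chi pO) < e / (K + 1).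
  have e3 : h0 - comb chi p = h0 - comb chi pO - comb chi pU.
    by rewrite (comb_filter chi p Q) -/pU -/pO (addrC (comb chi pU)) opprD addrA.
  apply: le_lt_trans hp; rewrite e3 (n2B (ph_w w1) LD LU) z /= mulr0 subr0 lerDl.
  exact: (n2_ge0 (ph_w w1) LU).
have LH := phB (ph_w w1) L2w_opt1 LO.
apply: (le_lt_trans (n2_le K0 wH w1 hK LH)).
have n0 := n2_ge0 (ph_w w1) LH.
apply: (@le_lt_trans _ _ ((K + 1) * n2 (ipw one) (h0 - comb chi pO))).
  by rewrite ler_wpM2r// lerDl.
by rewrite -ltr_pdivlMl ?ltr_wpDl// mulrC.
Qed.

(** C is a limit of polynomials with frequencies in U. The lemma serves both h0 and the polynomials
    that avoid U. *)
Lemma ip1_C_eq0 f : L2w one f -> (forall k i, U k -> ipw one (chi (k, i)) f = 0) ->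
  ipw one C f = 0.
Proof.
move=> hf h.
have h1 := ncvg_ip (ph_w w1) L2w_C hf (fun n => L2w_Tz c n w1 i1) ncvg_C1.
apply: (ccvg_unique h1).
have -> : (fun n => ipw one (Tz c n) f) = fun=> 0.
  apply/funext => n; rewrite (ip_TzE _ _ w1 i1 hf) big1// => j _; rewrite big1// => i _.
  have [Uj|nU] := pselect (U j); first by rewrite h// mulr0.
  by rewrite (col_eq0 i (l2_vanish l2_c nU)) mul0r.
by rewrite /ccvg; under eq_fun do rewrite subrr nsq0; exact: cvg_cst.
Qed.

Lemma ip1_C_opt : ipw one C h0 = 0.
Proof.
apply: (ip1_C_eq0 L2w_opt1) => k i Uk.
by rewrite (ph_ipC (ph_w w1) (L2w_chi _ w1 i1) L2w_opt1) ip1_opt// conj0.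
Qed.

Lemma ip1_C_avoids q : avoids q -> ipw one C (comb chi q) = 0.
Proof.
move=> hq; apply: (ip1_C_eq0 (comb_chi_L2w q w1 i1)) => k i Uk.
exact: (ip1_chi_avoids (i := (k, i)) Uk hq).
Qed.

Definition opt_error : R := n2 (ipw F) (A - h0) + n2 (ipw G) h0.

Lemma error_split q : avoids q ->
  n2 (ipw F) (A - comb chi q) + n2 (ipw G) (comb chi q) =
  opt_error + n2 (ipw H) (h0 - comb chi q).
Proof.
move=> hq; set y := comb chi q; set g := h0 - y.
have LA := L2w_A wF iF.
have yH : L2w H y := comb_chi_L2w q wH iH.
have gH : L2w H g := phB (ph_w wH) L2w_opt yH.
have hF0 := L2w_HF hF hG L2w_opt; have hG0 := L2w_HG hF hG L2w_opt.
have gF := L2w_HF hF hG gH; have gG := L2w_HG hF hG gH.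
have yG := L2w_HG hF hG yH.
have e1 : A - y = (A - h0) + g by rewrite /g addrA subrK.
have e2 : y = h0 - g by rewrite /g opprB addrC subrK.
have eG : n2 (ipw G) y = n2 (ipw G) (h0 - g) by rewrite -e2.
rewrite eG e1 (n2D (ph_w wF) (phB (ph_w wF) LA hF0) gF) (n2B (ph_w wG) hG0 gG).
rewrite (n2D_weight wF wG gF gG) /opt_error.
(* The cross terms of the two expansions cancel: <C, g>_1 = 0 leaves <A, g>_F = <h0, g>_H = <h0,
   g>_F + <h0, g>_G. *)
have z : ipw F (A - h0) g = ipw G h0 g.
  rewrite (ipBl (ph_w wF) LA hF0 gF).
  have := ip_H_opt gH; rewrite (ipwD wF wG hF0 gF hG0 gG).
  rewrite (ipBr (ph_w w1) L2w_opt1 (comb_chi_L2w q w1 i1) L2w_C) ip1_C_opt ip1_C_avoids//.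
  by rewrite subrr subr0 => <-; rewrite addrC addKr.
rewrite z; ring.
Qed.

(** Since <h0, h0>_H = <A, h0>_F, the quadratic expression becomes additive in h0, so that its two
    parts can be evaluated separately in l2(U). *)
Lemma opt_error_ip : opt_error%:C = ipw F A (A - h0).
Proof.
have LA := L2w_A wF iF.
have hF0 := L2w_HF hF hG L2w_opt; have hG0 := L2w_HG hF hG L2w_opt.
have e := ip_H_opt L2w_opt; rewrite ip1_C_opt subr0 (n2E (ph_w wH) L2w_opt) in e.
rewrite (ipBr (ph_w wF) LA hF0 LA) -e (n2E (ph_w wF) LA) /opt_error.
rewrite (n2B (ph_w wF) LA hF0) -e /= (n2D_weight wF wG hF0 hG0).
by rewrite -rmorphB; congr (_%:C); ring.
Qed.

(** A = P^T (F^T + G^T) A where H is invertible, so A - h0 is the function r_G. *)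
Lemma opt_residual t : H t \in unitmx ->
  (A - h0) t = mulmv PT (mulmv GT A) t + mulmv PT C t.
Proof.
move=> ut; rewrite [LHS](_ : _ = A t - (mulmv PT (mulmv FT A) t - mulmv PT C t))//.
rewrite opprB addrA addrAC /mulmv; congr (_ + _).
have e : A t = (invmx (F t + G t))^T *m ((F t)^T *m A t + (G t)^T *m A t).
  by rewrite -mulmxDl mulmxA -linearD /= -trmx_mul mulmxV// trmx1 mul1mx.
by rewrite {1}e mulmxDr addrAC subrr add0r.
Qed.

Lemma opt_error_spectral : opt_error%:C =
  cmean (fun t => qform (F t) (rG F G A C t)) + cmean (fun t => qform (G t) (rF F G A C t)).
Proof.
have LA := L2w_A wF iF.
have hF0 := L2w_HF hF hG L2w_opt; have hG0 := L2w_HG hF hG L2w_opt.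
rewrite /opt_error realCD -(n2E (ph_w wF) (phB (ph_w wF) LA hF0)) -(n2E (ph_w wG) hG0).
have mC := measurable_mulmv (measurable_PT hF hG hmin) L2w_C.1.
have mG := (L2w_PTGT (L2w_A wG iG)).1.
have mr : measurable_vec (mulmv PT (mulmv GT A) + mulmv PT C).
  by have := measurable_vec_lin 1 mG mC; rewrite scale1r.
have er t : rG F G A C t = (mulmv PT (mulmv GT A) + mulmv PT C) t.
  by rewrite /rG trmx_mul linearD /= trmx_mul !trmxK mulmxDr.
congr (_ + _).
- rewrite (ipw_ae wF.1 (phB (ph_w wF) LA hF0).1 mr (phB (ph_w wF) LA hF0).1 mr).
  + by rewrite ipwE; apply: eq_cmean => t ct; rewrite er.
  + by apply: circ_aeS uH => t ct ut; rewrite (opt_residual ut).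
  + by apply: circ_aeS uH => t ct ut; rewrite (opt_residual ut).
- rewrite ipwE; apply: eq_cmean => t ct; rewrite (_ : rF F G A C t = h0 t)//.
  by rewrite opt_charE /rF /hT mulmxBl.
Qed.

Lemma ncvg_PT (z : int -> 'cV[R[i]]_T) f : L2w P f ->
  ncvg (ipw P) (Tz z) f -> ncvg (ipw F) (fun n => mulmv PT (Tz z n)) (mulmv PT f).
Proof.
move=> hf h.
have mP := measurable_PT hF hG hmin.
apply: (ncvg_dom (c := 1) ler01 wF wP (measurable_mulmv mP hf.1)
  (fun n => measurable_mulmv mP (measurable_Tz z n)) _ hf (fun n => L2w_Tz z n wP iP) h) => n.
apply: circ_aeS uH => t ct ut; rewrite mul1r /mulmv -mulmxBr -(qform_inv (wH.2 t ct) ut).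
exact: qform_F_le.
Qed.

(** Replace C by its partial sums: each frequency k contributes (R a)(k) against c(k), and P^T is
    continuous from L2(P) to L2(F). *)
Lemma ip_A_PTC : ipw F A (mulmv PT C) = l2_inner U Ra c.
Proof.
have LA := L2w_A wF iF.
have hM i : L2w F (mulmv PT (chi i)) := L2w_HF hF hG (L2w_PT_chi i).
have hn n : L2w F (mulmv PT (Tz c n)).
  by apply: (L2w_HF hF hG); apply: (L2w_PT hF hG hmin); exact: (L2w_Tz c n wP iP).
have LC : L2w F (mulmv PT C).
  by apply: (L2w_HF hF hG); exact: (L2w_PT hF hG hmin L2w_CP).
have h1 := ccvg_ipr (ph_w wF) LC LA hn (ncvg_PT L2w_CP ncvg_CP).
rewrite /l2_inner; apply/esym; apply: csum_lim.
rewrite (_ : psum _ _ = fun n => ipw F A (mulmv PT (Tz c n))); first exact: h1.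
apply/funext => n; rewrite (ip_mulmv_Tz c n wF LA hM) /psum big_mkcond.
apply: eq_bigr => k _; case: ifPn => [/set_mem Uk|].
  rewrite mxE; apply: eq_bigr => l _; rewrite ip_A_PT// !mxE mulrC; congr (_ * _).
rewrite notin_setE => nU; rewrite big1// => l _.
by rewrite (col_eq0 l (l2_vanish l2_c nU)) conj0 mul0r.
Qed.

(** Here the second A is replaced by its partial sums; P^T G^T is continuous from L2(G) to L2(F). *)
Lemma ip_A_PTGTA : ipw F A (mulmv PT (mulmv GT A)) = l2_inner U Qa av.
Proof.
have LA := L2w_A wF iF; have LG := L2w_A wG iG.
pose M t := (invmx (F t + G t))^T *m (G t)^T.
have e g : mulmv PT (mulmv GT g) = mulmv M g.
  by apply/funext => t; rewrite /mulmv mulmxA.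
have hM i : L2w F (mulmv M (chi i)).
  by rewrite -e; apply: (L2w_HF hF hG); apply: L2w_PTGT; exact: (L2w_chi i wG iG).
have LM g : L2w G g -> L2w F (mulmv M g).
  by move=> hg; rewrite -e; apply: (L2w_HF hF hG); exact: L2w_PTGT.
have Ln n := L2w_Tz alpha n wG iG.
have v : ncvg (ipw F) (fun n => mulmv M (Tz alpha n)) (mulmv M A).
  apply: (ncvg_dom (c := 1) ler01 wF wG (LM _ LG).1 (fun n => (LM _ (Ln n)).1) _ LG Ln
    (ncvg_Afun ha wG iG)) => n.
  apply: circ_aeS uH => t ct ut; rewrite mul1r /mulmv -mulmxBr /M -mulmxA.
  apply: (le_trans (qform_F_le F hG _ ct)); apply: qform_inv_mul_le => //.
  - exact: wH.2.
  - exact: wG.2.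
  - by move=> y; exact: qform_G_le.
have h1 := ccvg_ipr (ph_w wF) (LM _ LG) LA (fun n => LM _ (Ln n)) v.
rewrite e /l2_inner; apply/esym; apply: csum_lim.
rewrite (_ : psum _ _ = fun n => ipw F A (mulmv M (Tz alpha n))); first exact: h1.
apply/funext => n; rewrite (ip_mulmv_Tz alpha n wF LA hM) -sum_zrange_opp /psum big_mkcond.
apply: eq_bigr => k _; rewrite /reflect_coef opprK; case: ifPn => [/set_mem Uk|].
  rewrite mxE; apply: eq_bigr => l _; rewrite -e ip_A_PTGT// !mxE mulrC; congr (_ * _).
rewrite notin_setE => nU; rewrite big1// => l _.
by rewrite (ext0_vanish a DU nU) mxE conj0 mul0r.
Qed.

Lemma opt_error_l2 : opt_error%:C = l2_inner U Ra c + l2_inner U Qa av.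
Proof.
have LA := L2w_A wF iF.
have hF0 := L2w_HF hF hG L2w_opt.
have LC : L2w F (mulmv PT C).
  by apply: (L2w_HF hF hG); exact: (L2w_PT hF hG hmin L2w_CP).
have LG : L2w F (mulmv PT (mulmv GT A)).
  by apply: (L2w_HF hF hG); apply: L2w_PTGT; exact: L2w_A.
have LS := phD (ph_w wF) LG LC.
have e : ipw F A (A - h0) = ipw F A (mulmv PT (mulmv GT A)) + ipw F A (mulmv PT C).
  rewrite -(ipDr (ph_w wF) LG LC LA).
  apply: (ipw_ae wF.1 LA.1 LA.1 (phB (ph_w wF) LA hF0).1 LS.1); first exact: circ_aeT.
  by apply: circ_aeS uH => t ct ut; rewrite (opt_residual ut).
rewrite opt_error_ip e; rewrite addrC.
exact: (congr2 +%R ip_A_PTC ip_A_PTGTA).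
Qed.

End OnU.
End OptimalCharacteristic.

(** * Stochastic integrals and projection *)

Section LimitConversions.
Context {R : realType}.

Lemma cvg_fineE (u : nat -> \bar R) (v : nat -> R) (k : R) : k != 0 ->
  (forall n, u n = (k * v n)%:E) -> u @ \oo --> 0%E <-> v @ \oo --> (0 : R).
Proof.
move=> k0 h; have -> : u = fun n => (k * v n)%:E by apply/funext.
split=> [hu|hv].
  have h1 : (fun n => k * v n) @ \oo --> (0 : R).
    exact: (fine_cvg hu).
  have h2 : (fun n => k^-1 * (k * v n)) @ \oo --> (0 : R).
    by rewrite -(mulr0 k^-1); apply: cvgM => //; exact: cvg_cst.
  by rewrite (_ : v = fun n => k^-1 * (k * v n))//; apply/funext => n; rewrite mulKf.
apply: cvg_EFin; first by near=> n.
rewrite -(mulr0 k); apply: (cvgM (f := fun=> k)) => //; exact: cvg_cst.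
Unshelve. all: by end_near. Qed.

End LimitConversions.

Section IsometricFamilies.
Context {R : realType} {V V' : lmodType R[i]} {L : set V} {L' : set V'}.
Context {ip : V -> V -> R[i]} {ip' : V' -> V' -> R[i]} {I : Type}.
Hypothesis ph : prehilbert L ip.
Hypothesis ph' : prehilbert L' ip'.

Lemma ip_comb_left (U : lmodType R[i]) (K : set U) (jp : U -> U -> R[i])
    (pj : prehilbert K jp) (x : I -> U) X q : K X -> (forall i, K (x i)) ->
  jp X (comb x q) = \sum_(r <- q) Num.conj r.1 * jp X (x r.2).
Proof.
move=> hX hx; rewrite /comb.
rewrite (ip_sumr pj q hX (fun r (_ : xpredT r) => phZ pj r.1 (hx r.2))).
by apply: eq_bigr => r _; exact: (ipZr pj).
Qed.

(** X need not be a combination of the family: its norm and its products with the family determine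
    all these distances. *)
Lemma n2_iso_sub (x : I -> V) (x' : I -> V') X X' q :
  L X -> L' X' -> (forall i, L (x i)) -> (forall i, L' (x' i)) ->
  (forall i j, ip (x i) (x j) = ip' (x' i) (x' j)) ->
  ip X X = ip' X' X' -> (forall i, ip X (x i) = ip' X' (x' i)) ->
  n2 ip (X - comb x q) = n2 ip' (X' - comb x' q).
Proof.
move=> hX hX' hx hx' e eX eXx.
have L0 := ph0 ph hX; have L0' := ph0 ph' hX'.
have hq := comb_L ph q L0 hx; have hq' := comb_L ph' q L0' hx'.
rewrite (n2B ph hX hq) (n2B ph' hX' hq').
rewrite (ip_comb_left ph q hX hx) (ip_comb_left ph' q hX' hx').
rewrite /n2 eX (ip_comb ph ph' q q L0 L0' hx hx hx' hx' e).
by congr (_ - 2 * Re _ + _); apply: eq_bigr => r _; rewrite eXx.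
Qed.

End IsometricFamilies.

Section StochasticIntegrals.
Context {R : realType} {d : measure_display} {Omega : measurableType d}.
Variable P : probability Omega R.
Context {T : nat}.
Implicit Types (f g : R -> 'cV[R[i]]_T) (X Y : Omega -> R[i]^o).
Implicit Types (p : seq (set R * 'cV[R[i]]_T)).
Local Notation LP := (L2rv P : set (Omega -> R[i]^o)).
Local Notation ipr := (rv_inner P : (Omega -> R[i]^o) -> (Omega -> R[i]^o) -> R[i]).
Local Notation circ := (@circ R).
Local Notation phr := (ph_rv P).
Local Notation chi := (@chi R T).

Lemma L2rv0 : LP 0.
Proof.
split; first exact: cmeasurable_cst.
- by rewrite /msq; under eq_integral do rewrite nsq0; rewrite integral0.
- by rewrite /cE /cintegral /Rintegral !integral0.
Qed.

Lemma ms_cvgP (u : nat -> Omega -> R[i]^o) X : LP X -> (forall n, LP (u n)) ->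
  ms_cvg P u X <-> ncvg ipr u X.
Proof.
move=> hX hu; apply: (@cvg_fineE _ _ _ 1); first exact: oner_neq0.
by move=> n; rewrite mul1r; exact: (msqE (phB phr (hu n) hX)).
Qed.

Lemma wnorm_cvgP W (u : nat -> R -> 'cV[R[i]]_T) f : weight W -> L2w W f ->
  (forall n, L2w W (u n)) ->
  (fun n => wnorm W (fun t => u n t - f t)) @ \oo --> 0%E <-> ncvg (ipw W) u f.
Proof.
move=> hW hf hu; apply: (@cvg_fineE _ _ _ (2 * pi)); first by rewrite gt_eqF// two_pi_gt0.
by move=> n; exact: (wnormE hW (phB (ph_w hW) (hu n) hf)).
Qed.

Definition borel_circ (A : set R) : Prop := measurable A /\ A `<=` circ.

Definition valid p : Prop := forall q, List.In q p -> borel_circ q.1.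

Lemma valid_nth p : (forall i, (i < size p)%N ->
    measurable (nth (set0, 0) p i).1 /\ (nth (set0, 0) p i).1 `<=` circ) <-> valid p.
Proof.
split=> h.
- move=> q; elim: p h => //= q' p ih h [<-|]; first exact: (h 0%N).
  by apply: ih => i hi; exact: (h i.+1).
- elim: p h => // q' p ih h [|i] hi /=; first by apply: h; left.
  by apply: ih => // q hq; apply: h; right.
Qed.

(* [indv] and [zrv] vanish at the sets on which the stochastic measure is not defined. *)
Definition indv (i : set R * 'I_T) : R -> 'cV[R[i]]_T :=
  if `[< borel_circ i.1 >] then fun t => (\1_(i.1) t)%:C *: delta i.2 else 0.

Definition flat p : seq (R[i] * (set R * 'I_T)) :=
  flatten [seq [seq (q.2 k 0, (q.1, k)) | k <- enum 'I_T] | q : set R * 'cV[R[i]]_T <- p].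

Lemma comb_flat (V : lmodType R[i]) (x : set R * 'I_T -> V) p :
  comb x (flat p) = \sum_(q <- p) \sum_k q.2 k 0 *: x (q.1, k).
Proof.
rewrite /comb /flat big_flatten big_map; apply: eq_bigr => q _.
by rewrite big_map big_enum.
Qed.

Lemma simple_fun_comb p : valid p -> simple_fun p = comb indv (flat p).
Proof.
move=> hp; rewrite comb_flat; apply/funext => t; rewrite /simple_fun.
elim: p hp => [|q p ih] hp; first by rewrite !big_nil.
rewrite !big_cons ih; last by move=> q' h; apply: hp; right.
congr (_ + _); have hq : borel_circ q.1 by apply: hp; left.
rewrite fct_sumE {1}[q.2](matrix_sum_delta) scaler_sumr; apply: eq_bigr => k _.
rewrite big_ord1 /indv asboolT//.
by rewrite scalerA mulrC -scalerA.
Qed.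

Lemma L2w_indv W i : weight W -> integrable_mx W -> L2w W (indv i).
Proof.
move=> hW iW; rewrite /indv; case: asboolP => [[mA _]|_]; last first.
  exact: L2w0 hW iW.
apply: (L2w_mulv hW (bmeas_indic mA)).
by apply: (L2w_bounded hW iW (M := 1)) => [l|t _ l]; [exact: cmeasurable_cst|exact: nsq_delta].
Qed.

Lemma L2w_simple W p : weight W -> integrable_mx W -> valid p -> L2w W (simple_fun p).
Proof.
move=> hW iW hp; rewrite simple_fun_comb//.
by apply: (comb_L (ph_w hW)); [exact: L2w0|move=> i; exact: L2w_indv].
Qed.

Section OneMeasure.
Variable F : R -> 'M[R[i]]_T.
Hypothesis wF : weight F.
Hypothesis iF : integrable_mx F.
Variable Z : set R -> Omega -> 'cV[R[i]]_T.
Hypothesis hZ : orthogonal_stochastic_measure P Z F.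
Local Notation phF := (ph_w wF).

Definition zrv (i : set R * 'I_T) : Omega -> R[i]^o :=
  if `[< borel_circ i.1 >] then comp (Z i.1) i.2 else 0.

Lemma simple_int_comb p : valid p -> simple_int Z p = comb zrv (flat p).
Proof.
move=> hp; rewrite comb_flat; apply/funext => w; rewrite /simple_int.
elim: p hp => [|q p ih] hp; first by rewrite !big_nil.
rewrite !big_cons ih; last by move=> q' h; apply: hp; right.
congr (_ + _); have hq : borel_circ q.1 by apply: hp; left.
rewrite fct_sumE mxE; apply: eq_bigr => k _.
by rewrite /zrv asboolT// mxE.
Qed.

Lemma L2rv_zrv i : LP (zrv i).
Proof.
rewrite /zrv; case: asboolP => [[mA Ac]|_]; last exact: L2rv0.
by have [h _ _] := hZ; exact: h.
Qed.

Lemma zrv_iso i j : ipr (zrv i) (zrv j) = ipw F (indv i) (indv j).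
Proof.
rewrite /zrv /indv; case: asboolP => [[mA Ac]|nA]; last first.
  rewrite (ip0l phr) ?(ip0l phF)//; last exact: L2rv_zrv j.
  exact: L2w_indv j wF iF.
case: asboolP => [[mB Bc]|nB]; last first.
  rewrite (ip0r phr) ?(ip0r phF)//.
    by have := L2w_indv i wF iF; rewrite /indv asboolT.
  by have := L2rv_zrv i; rewrite /zrv asboolT.
have [_ _ /(_ _ _ mA mB Ac Bc) h] := hZ.
have := congr1 (fun M : 'M[R[i]]_T => M i.2 j.2) h; rewrite !mxE => ->.
rewrite ipwE; apply: eq_cmean => t ct; rewrite bform_delta mxE conjR indicI /=.
by rewrite mulrAC -!rmorphM.
Qed.

Lemma L2rv_simple p : valid p -> LP (simple_int Z p).
Proof.
move=> hp; rewrite simple_int_comb//.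
by apply: (comb_L phr); [exact: L2rv0|exact: L2rv_zrv].
Qed.

Lemma simple_iso p p' : valid p -> valid p' ->
  ipr (simple_int Z p) (simple_int Z p') = ipw F (simple_fun p) (simple_fun p').
Proof.
move=> hp hp'; rewrite !simple_int_comb// !simple_fun_comb//.
apply: (ip_comb phr phF) => [||||i|i|]; [exact: L2rv0|exact: L2w0|exact: L2rv_zrv|exact: L2rv_zrv|exact: L2w_indv|exact: L2w_indv|exact: zrv_iso].
Qed.

Lemma SI_P f X : is_stochastic_integral P Z F f X <-> [/\ L2w F f, LP X &
  exists p : nat -> seq (set R * 'cV[R[i]]_T), [/\ forall n, valid (p n),
    ncvg (ipw F) (fun n => simple_fun (p n)) f &
    ncvg ipr (fun n => simple_int Z (p n) : Omega -> R[i]^o) X]].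
Proof.
split=> -[hf hX [p [hp h1 h2]]]; split; [exact: hf|exact: hX| |exact: hf|exact: hX|].
- have hp' n : valid (p n) := (valid_nth (p n)).1 (hp n).
  exists p; split; first exact: hp'.
  + exact: ((wnorm_cvgP wF hf (fun n => L2w_simple wF iF (hp' n))).1 h1).
  + exact: ((ms_cvgP hX (fun n => L2rv_simple (hp' n))).1 h2).
- exists p; split; first by move=> n; apply/valid_nth; exact: hp.
  + exact: ((wnorm_cvgP wF hf (fun n => L2w_simple wF iF (hp n))).2 h1).
  + exact: ((ms_cvgP hX (fun n => L2rv_simple (hp n))).2 h2).
Qed.

(** The isometry on simple functions is extended one factor at a time, first with a simple second
    factor. *)
Lemma SI_iso f g X Y : is_stochastic_integral P Z F f X ->
  is_stochastic_integral P Z F g Y -> ipr X Y = ipw F f g.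
Proof.
move=> /SI_P[hf hX [p [hp p1 p2]]] /SI_P[hg hY [q [hq q1 q2]]].
have Lp n := L2w_simple wF iF (hp n); have Lq n := L2w_simple wF iF (hq n).
have Rp n := L2rv_simple (hp n); have Rq n := L2rv_simple (hq n).
have e m : ipr X (simple_int Z (q m)) = ipw F f (simple_fun (q m)).
  apply: (ccvg_unique (ncvg_ip phr hX (Rq m) Rp p2)).
  rewrite (_ : (fun n => _) = (fun n => ipw F (simple_fun (p n)) (simple_fun (q m)))).
    exact: (ncvg_ip phF hf (Lq m) Lp p1).
  by apply/funext => n; exact: simple_iso.
apply: (ccvg_unique (ccvg_ipr phr hY hX Rq q2)).
rewrite (_ : (fun n => _) = (fun n => ipw F f (simple_fun (q n)))).
  exact: (ccvg_ipr phF hg hf Lq q1).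
by apply/funext => n; exact: e.
Qed.

Lemma SI_simple p : valid p -> is_stochastic_integral P Z F (simple_fun p) (simple_int Z p).
Proof.
move=> hp; have Lp := L2w_simple wF iF hp; have Rp := L2rv_simple hp.
apply/SI_P; split => //; exists (fun=> p); split => //.
- by rewrite /ncvg subrr (n2_0 phF Lp); exact: cvg_cst.
- by rewrite /ncvg subrr (n2_0 phr Rp); exact: cvg_cst.
Qed.

Lemma SI_zrv i : is_stochastic_integral P Z F (indv i) (zrv i).
Proof.
rewrite /indv /zrv; case: asboolP => [hi|_].
- have hp : valid [:: (i.1, delta i.2)] by move=> q /= [<-|].
  have e1 : simple_fun [:: (i.1, delta i.2)] =
      fun t => (\1_(i.1) t)%:C *: (delta i.2 : 'cV[R[i]]_T).
    by apply/funext => t; rewrite /simple_fun big_seq1.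
  have e2 : simple_int Z [:: (i.1, delta i.2)] = comp (Z i.1) i.2.
    apply/funext => w; rewrite /simple_int big_seq1 /= mxE (bigD1 i.2)//= !mxE !eqxx mul1r.
    by rewrite big1 ?addr0// => k ki; rewrite !mxE (negbTE ki) mul0r.
  by have := SI_simple hp; rewrite e1 e2.
- have hp : valid [::] by [].
  have e1 : simple_fun [::] = (0 : R -> 'cV[R[i]]_T).
    by apply/funext => t; rewrite /simple_fun big_nil.
  have e2 : simple_int Z [::] = 0.
    by apply/funext => w; rewrite /simple_int big_nil.
  by have := SI_simple hp; rewrite e1 e2.
Qed.

End OneMeasure.
End StochasticIntegrals.

(** * Observations of signal plus noise *)

Section SignalPlusNoise.
Context {R : realType} {d : measure_display} {Omega : measurableType d}.
Variable P : probability Omega R.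
Context {T : nat}.
Implicit Types (f g : R -> 'cV[R[i]]_T) (X Y : Omega -> R[i]^o).
Implicit Types (p : seq (set R * 'cV[R[i]]_T)) (q r : seq (R[i] * (int * 'I_T))).
Local Notation LP := (L2rv P : set (Omega -> R[i]^o)).
Local Notation ipr := (rv_inner P : (Omega -> R[i]^o) -> (Omega -> R[i]^o) -> R[i]).
Local Notation circ := (@circ R).
Local Notation phr := (ph_rv P).
Local Notation chi := (@chi R T).

Lemma ncvg_subr (V : lmodType R[i]) (ip : V -> V -> R[i]) (u : nat -> V) x y :
  ncvg ip u x -> ncvg ip (fun n => u n - y) (x - y).
Proof.
rewrite /ncvg; rewrite (_ : (fun n => n2 ip (u n - y - (x - y))) = (fun n => n2 ip (u n - x)))//.
by apply/funext => n; congr (n2 ip _); rewrite opprB addrA subrK.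
Qed.

Lemma comb_orth (V : lmodType R[i]) (L : set V) ip (ph : prehilbert L ip) I J
    (x : I -> V) (y : J -> V) (s : seq (R[i] * I)) (t : seq (R[i] * J)) :
  L 0 -> (forall i, L (x i)) -> (forall j, L (y j)) -> (forall i j, ip (x i) (y j) = 0) ->
  ip (comb x s) (comb y t) = 0.
Proof.
move=> L0 hx hy h; have hs := comb_L ph s L0 hx.
rewrite (ip_comb_left ph t hs hy) big1// => w _.
rewrite (ph_ipC ph hs (hy _)) (ip_comb_left ph s (hy _) hx) big1 ?conj0 ?mulr0// => v _.
by rewrite (ph_ipC ph (hy _) (hx _)) h conj0 mulr0.
Qed.

Lemma comb_map (V : lmodType R[i]) I J (g : I -> J) (x : J -> V) (s : seq (R[i] * I)) :
  comb x [seq (v.1, g v.2) | v <- s] = comb (fun i => x (g i)) s.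
Proof. by rewrite /comb big_map. Qed.

Definition seqrv (xi : int -> Omega -> 'cV[R[i]]_T) (i : int * 'I_T) : Omega -> R[i]^o :=
  comp (xi i.1) i.2.

(** Exponentials and indicators form one family, as do the corresponding values of the sequence and
    of the stochastic measure. A simple integral minus an observation is then a single [comb]. *)
Definition famf (i : (int * 'I_T) + (set R * 'I_T)) : R -> 'cV[R[i]]_T :=
  match i with inl i => chi i | inr i => indv i end.

Definition famX (xi : int -> Omega -> 'cV[R[i]]_T) (Z : set R -> Omega -> 'cV[R[i]]_T)
    (i : (int * 'I_T) + (set R * 'I_T)) : Omega -> R[i]^o :=
  match i with inl i => seqrv xi i | inr i => zrv Z i end.

Section OneSequence.
Variables (F : R -> 'M[R[i]]_T) (xi : int -> Omega -> 'cV[R[i]]_T).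
Variable Z : set R -> Omega -> 'cV[R[i]]_T.
Hypothesis wF : weight F.
Hypothesis iF : integrable_mx F.
Hypothesis hZ : spectral_representation P xi Z F.

Lemma fam_SI i : is_stochastic_integral P Z F (famf i) (famX xi Z i).
Proof.
case: i => i /=; first exact: (hZ.2 i.1 i.2).
exact: (SI_zrv wF iF hZ.1 i).
Qed.

Lemma L2rv_famX i : LP (famX xi Z i).
Proof. by have [_ h _] := fam_SI i. Qed.

Lemma L2rv_seqrv i : LP (seqrv xi i).
Proof. exact: (L2rv_famX (inl i)). Qed.

Lemma fam_iso i j : ipr (famX xi Z i) (famX xi Z j) = ipw F (famf i) (famf j).
Proof. exact: (SI_iso wF iF hZ.1 (fam_SI i) (fam_SI j)). Qed.

Lemma seqrv_iso i j : ipr (seqrv xi i) (seqrv xi j) = ipw F (chi i) (chi j).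
Proof. exact: (fam_iso (inl i) (inl j)). Qed.

Lemma L2rv_comb q : LP (comb (seqrv xi) q).
Proof. exact: (comb_L phr q (L2rv0 P) L2rv_seqrv). Qed.

Lemma n2_comb_seqrv q : n2 ipr (comb (seqrv xi) q) = n2 (ipw F) (comb chi q).
Proof.
rewrite /n2 (ip_comb phr (ph_w wF) q q (L2rv0 P) (L2w0 wF iF) L2rv_seqrv L2rv_seqrv
  (x' := chi) (y' := chi) (fun i => L2w_chi i wF iF) (fun i => L2w_chi i wF iF))//.
exact: seqrv_iso.
Qed.

(** Uncorrelatedness is assumed of the sequences only. By density of trigonometric polynomials every
    stochastic integral is a limit of combinations of the sequence, so orthogonality carries over to
    the measures. *)
Lemma SI_orth f X Y : is_stochastic_integral P Z F f X -> LP Y ->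
  (forall i, ipr (seqrv xi i) Y = 0) -> ipr X Y = 0.
Proof.
move=> hX LY h; have [Lf LX _] := hX.
have /choice[q hq] (n : nat) : exists q, n2 (ipw F) (f - comb chi q) < n.+1%:R^-1.
  by apply: trigs_dense => //; rewrite invr_gt0.
have c0 : (fun n : nat => n.+1%:R^-1 : R) @ \oo --> (0 : R) by have := @cvg_harmonic R.
have eX i : ipr X (seqrv xi i) = ipw F f (chi i).
  exact: (SI_iso wF iF hZ.1 hX (fam_SI (inl i))).
have v : ncvg ipr (fun n => comb (seqrv xi) (q n)) X.
  apply: (cvg0_le _ c0) => n; have Lq := L2rv_comb (q n).
  rewrite (n2_ge0 phr (phB phr Lq LX)) (n2C phr Lq LX) /=.
  rewrite (n2_iso_sub phr (ph_w wF) (q n) LX Lf L2rv_seqrv (fun i => L2w_chi i wF iF)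
    seqrv_iso (SI_iso wF iF hZ.1 hX hX) eX).
  exact: ltW (hq n).
apply: (ccvg_unique (ncvg_ip phr LX LY (fun n => L2rv_comb (q n)) v)).
rewrite (_ : (fun n => _) = fun=> 0).
  by rewrite /ccvg; under eq_fun do rewrite subrr nsq0; exact: cvg_cst.
apply/funext => n; rewrite (ph_ipC phr (L2rv_comb _) LY).
rewrite (ip_comb_left phr (q n) LY L2rv_seqrv) big1 ?conj0// => w _.
by rewrite (ph_ipC phr LY (L2rv_seqrv _)) h conj0 mulr0.
Qed.

End OneSequence.

Variables F G : R -> 'M[R[i]]_T.
Hypothesis wF : weight F.
Hypothesis wG : weight G.
Hypothesis iF : integrable_mx F.
Hypothesis iG : integrable_mx G.
Variables xi eta : int -> Omega -> 'cV[R[i]]_T.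
Hypothesis hunc : uncorrelated P xi eta.
Variables Zxi Zeta : set R -> Omega -> 'cV[R[i]]_T.
Hypothesis hZxi : spectral_representation P xi Zxi F.
Hypothesis hZeta : spectral_representation P eta Zeta G.
Local Notation H := (fun t => F t + G t).
Let wH := weightD wF wG.
Let iH := integrable_mxD iF iG.
Local Notation zeta := (fun j w => xi j w + eta j w).
Local Notation Z := (fun A w => Zxi A w + Zeta A w).

(** [SI_orth] is applied to the signal first and to the noise afterwards. *)
Lemma fam_cross i j : ipr (famX xi Zxi i) (famX eta Zeta j) = 0.
Proof.
have Lx := L2rv_famX wF iF hZxi; have Ly := L2rv_famX wG iG hZeta.
have h1 k l : ipr (seqrv xi k) (seqrv eta l) = 0.
  by have := congr1 (fun M : 'M[R[i]]_T => M k.2 l.2) (hunc k.1 l.1); rewrite !mxE.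
have h2 k : ipr (famX xi Zxi i) (seqrv eta k) = 0.
  exact: (SI_orth wF iF hZxi (fam_SI wF iF hZxi i) (Ly (inl k)) (fun l => h1 l k)).
rewrite (ph_ipC phr (Lx i) (Ly j)) (SI_orth wG iG hZeta (fam_SI wG iG hZeta j) (Lx i)) ?conj0//.
by move=> k; rewrite (ph_ipC phr (Ly (inl k)) (Lx i)) h2 conj0.
Qed.

Lemma L2w_famf W i : weight W -> integrable_mx W -> L2w W (famf i).
Proof. by case: i => i hW iW; [exact: L2w_chi|exact: L2w_indv]. Qed.

Lemma sum_iso i j : ipr (famX xi Zxi i + famX eta Zeta i) (famX xi Zxi j + famX eta Zeta j) =
  ipw H (famf i) (famf j).
Proof.
have Lx := L2rv_famX wF iF hZxi; have Ly := L2rv_famX wG iG hZeta.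
rewrite (ipDl phr (Lx i) (Ly i) (phD phr (Lx j) (Ly j))).
rewrite (ipDr phr (Lx j) (Ly j) (Lx i)) (ipDr phr (Lx j) (Ly j) (Ly i)).
rewrite fam_cross (ph_ipC phr (Ly i) (Lx j)) fam_cross conj0 addr0 add0r.
rewrite (fam_iso wF iF hZxi) (fam_iso wG iG hZeta).
by rewrite (ipwD wF wG (L2w_famf _ wF iF) (L2w_famf _ wF iF) (L2w_famf _ wG iG) (L2w_famf _ wG iG)).
Qed.

Lemma seqrv_sum : seqrv zeta = fun i => seqrv xi i + seqrv eta i.
Proof. by apply/funext => i; apply/funext => w; rewrite /seqrv /comp mxE. Qed.

Lemma simple_int_sum p : simple_int Z p = simple_int Zxi p + simple_int Zeta p :> (Omega -> R[i]^o).
Proof.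
apply/funext => w; rewrite [RHS](_ : _ = simple_int Zxi p w + simple_int Zeta p w)//.
rewrite /simple_int -big_split; apply: eq_bigr => v _.
by rewrite mulmxDr mxE.
Qed.

Lemma L2rv_sum i : LP (famX xi Zxi i + famX eta Zeta i).
Proof. exact: (phD phr (L2rv_famX wF iF hZxi i) (L2rv_famX wG iG hZeta i)). Qed.

Lemma simple_obs_dist p q : valid p ->
  n2 ipr ((simple_int Z p : Omega -> R[i]^o) - comb (seqrv zeta) q) =
  n2 (ipw H) (simple_fun p - comb chi q).
Proof.
move=> hp; pose J := ((int * 'I_T) + (set R * 'I_T))%type.
pose s : seq (R[i] * J) := [seq (v.1, inr v.2) | v <- flat p] ++
  scaleseq (-1) [seq (v.1, inl v.2) | v <- q].
have e1 : simple_fun p - comb chi q = comb famf s.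
  by rewrite /s comb_sub !comb_map simple_fun_comb.
have e2 : (simple_int Z p : Omega -> R[i]^o) - comb (seqrv zeta) q =
    comb (fun i => famX xi Zxi i + famX eta Zeta i) s.
  rewrite /s comb_sub !comb_map seqrv_sum simple_int_sum.
  by rewrite (simple_int_comb Zxi hp) (simple_int_comb Zeta hp) -comb_add.
rewrite e1 e2 /n2; congr Re.
exact: (ip_comb phr (ph_w wH) s s (L2rv0 P) (L2w0 wH iH) L2rv_sum L2rv_sum
  (fun i => L2w_famf i wH iH) (fun i => L2w_famf i wH iH) sum_iso).
Qed.

Variables (D : set int) (a : int -> 'cV[R[i]]_T) (Axi : Omega -> R[i]^o).
Hypothesis ha : (\esum_(j in D) (\sum_(k < T) normc (a j k 0))%R%:E < +oo)%E.
Hypothesis hAxi : is_functional P D a xi Axi.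

(** The list whose evaluation on exponentials is [Tz z L], and on the signal a partial sum of the
    functional. *)
Definition tz_seq (z : int -> 'cV[R[i]]_T) L : seq (R[i] * (int * 'I_T)) :=
  flatten [seq [seq (z j i 0, (j, i)) | i <- enum 'I_T] | j <- zrange L].

Lemma comb_tz_seq (V : lmodType R[i]) (x : int * 'I_T -> V) z L :
  comb x (tz_seq z L) = \sum_(j <- zrange L) \sum_i z j i 0 *: x (j, i).
Proof.
rewrite /comb /tz_seq big_flatten [LHS]big_map; apply: eq_bigr => j _.
by rewrite big_map big_enum.
Qed.

Lemma psum_functional n :
  (fun w => psum D (fun j => ((a j)^T *m xi (- j) w) 0 0) n) =
  comb (seqrv xi) (tz_seq (reflect_coef D a) n) :> (Omega -> R[i]^o).
Proof.
rewrite comb_tz_seq -sum_zrange_opp; apply/funext => w.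
rewrite fct_sumE /psum big_mkcond; apply: eq_bigr => j _.
rewrite fct_sumE /reflect_coef opprK /ext0; case: ifP => _; last first.
  by rewrite big1// => k _; rewrite mxE scale0r.
by rewrite mxE; apply: eq_bigr => k _; rewrite mxE.
Qed.

Lemma functional_dist q : n2 ipr (Axi - comb (seqrv zeta) q) =
  n2 (ipw F) (Afun D a - comb chi q) + n2 (ipw G) (comb chi q).
Proof.
have [LA hA] := hAxi; pose s n := tz_seq (reflect_coef D a) n.
have Lx := L2rv_comb wF iF hZxi; have Ly := L2rv_comb wG iG hZeta.
have Tzs n : Tz (reflect_coef D a) n = comb chi (s n) by rewrite comb_tz_seq.
have v : ncvg ipr (fun n => comb (seqrv xi) (s n)) Axi.
  apply/(ms_cvgP LA (fun n => Lx (s n))).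
  by rewrite (_ : (fun n => _) = (fun n w => psum D (fun j => ((a j)^T *m xi (- j) w) 0 0) n))//;
    apply/funext => n; rewrite psum_functional.
have Lz : LP (comb (seqrv zeta) q).
  by rewrite seqrv_sum comb_add; exact: (phD phr (Lx q) (Ly q)).
have l1 := ncvg_n2 phr (phB phr LA Lz) (fun n => phB phr (Lx (s n)) Lz) (ncvg_subr (comb (seqrv zeta) q) v).
have La := L2w_Afun ha wF iF.
have Lc : L2w F (comb chi q) := comb_chi_L2w q wF iF.
have LT n := L2w_Tz (reflect_coef D a) n wF iF.
have l2' := ncvg_n2 (ph_w wF) (phB (ph_w wF) La Lc) (fun n => phB (ph_w wF) (LT n) Lc)
  (ncvg_subr (comb chi q) (ncvg_Afun ha wF iF)).
have l3 : (fun n => n2 (ipw F) (Tz (reflect_coef D a) n - comb chi q) + n2 (ipw G) (comb chi q)) @ \oo -->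
    n2 (ipw F) (Afun D a - comb chi q) + n2 (ipw G) (comb chi q).
  by apply: cvgD; [exact: l2'|exact: cvg_cst].
rewrite -(cvg_lim _ l1)// -(cvg_lim _ l3)//; congr (lim _).
congr (_ @ \oo); apply/funext => n.
(* Sorted into a signal part and a noise part, which are orthogonal. *)
have e : comb (seqrv xi) (s n) - comb (seqrv zeta) q =
    comb (seqrv xi) (s n ++ scaleseq (-1) q) - comb (seqrv eta) q.
  by rewrite comb_sub seqrv_sum comb_add opprD addrA.
rewrite e (n2B phr (Lx _) (Ly q)) Tzs -comb_sub.
rewrite (comb_orth phr _ _ (L2rv0 P) (L2rv_seqrv wF iF hZxi) (L2rv_seqrv wG iG hZeta)); last first.
  by move=> i j; exact: (fam_cross (inl i) (inl j)).
by rewrite /= mulr0 subr0 (n2_comb_seqrv wF iF hZxi) (n2_comb_seqrv wG iG hZeta).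
Qed.

End SignalPlusNoise.

(** * Density of simple functions and null elements of L2 *)

Section SimpleDensity.
Context {R : realType} {T : nat}.
Implicit Types (f g : R -> 'cV[R[i]]_T) (W : R -> 'M[R[i]]_T).
Implicit Types (p : seq (set R * 'cV[R[i]]_T)).
Local Notation circ := (@circ R).

Lemma valid_cat p p' : valid p -> valid p' -> valid (p ++ p').
Proof.
move=> hp hp'; elim: p hp => // v p ih hp q /= [<-|]; first by apply: hp; left.
by apply: ih => r hr; apply: hp; right.
Qed.

Lemma valid_map (g : set R * 'cV[R[i]]_T -> set R * 'cV[R[i]]_T) p :
  (forall v, borel_circ v.1 -> borel_circ (g v).1) -> valid p -> valid [seq g v | v <- p].
Proof.
move=> hg; elim: p => // v p ih hp q /= [<-|]; first by apply/hg/hp; left.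
by apply: ih => r hr; apply: hp; right.
Qed.

Lemma simple_dense W f (e : R) : weight W -> integrable_mx W -> L2w W f -> 0 < e ->
  exists p, valid p /\ n2 (ipw W) (f - simple_fun p) < e.
Proof.
move=> hW iW hf e0.
pose S : set (R -> 'cV[R[i]]_T) := [set g | exists p, valid p /\ g = simple_fun p].
have SL g : S g -> L2w W g by move=> [p [hp ->]]; exact: L2w_simple.
have S0 : S 0.
  by exists [::]; split=> //; apply/funext => t; rewrite /simple_fun big_nil.
have Slin (c : R[i]) g h : S g -> S h -> S (c *: g + h).
  move=> [p [hp ->]] [p' [hp' ->]].
  exists ([seq (v.1, c *: v.2) | v <- p] ++ p'); split.
    exact: valid_cat (valid_map _ hp) hp'.
  apply/funext => t; rewrite /simple_fun big_cat big_map /=; congr (_ + _).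
  rewrite [LHS]scaler_sumr; apply: eq_bigr => v _.
  by rewrite !scalerA mulrC.
have hI A : measurable A -> multiplier W S (fun t => \1_A t).
  move=> mA; split; first by exists 1; exact: bmeas_indic.
  move=> _ [p [hp ->]]; apply: (subset_ncl (ph_w hW) SL).
  exists [seq (v.1 `&` A, v.2) | v <- p]; split.
    apply: valid_map hp => v [mv cv]; split => /=; first exact: measurableI.
    by apply: subset_trans cv => t [].
  apply/funext => t; rewrite /mulv /simple_fun big_map scaler_sumr; apply: eq_bigr => v _ /=.
  by rewrite scalerA indicI /= mulrC -rmorphM.
have hS k : ncl (L2w W) (ipw W) S (fun=> delta k).
  have Ld : L2w W (fun=> delta k).
    by apply: (L2w_bounded hW iW (M := 1)) => [l|t _ l]; [exact: cmeasurable_cst|exact: nsq_delta].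
  (* Off the circle the simple function differs from the constant; the two are only at distance
     zero. *)
  split=> // e' e'0; exists (simple_fun [:: (circ, delta k)]).
  have hp : valid [:: (circ, delta k : 'cV[R[i]]_T)].
    by move=> q /= [<-|//]; split => //; exact: measurable_circ.
  have Ls := L2w_simple hW iW hp; have LD := phB (ph_w hW) Ld Ls.
  split; first by exists [:: (circ, delta k)].
  have z : circ_ae (fun t => ((fun=> delta k) - simple_fun [:: (circ, delta k)]) t = (0 : R -> 'cV[R[i]]_T) t).
    apply: circ_aeT => t ct.
    have e1 : simple_fun [:: (circ, delta k : 'cV[R[i]]_T)] t = delta k.
      by rewrite /simple_fun big_seq1 /= indicE mem_set// scale1r.
    by rewrite [LHS](_ : _ = delta k - simple_fun [:: (circ, delta k)] t)// e1 subrr.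
  have L0 := L2w0 hW iW.
  by rewrite /n2 (ipw_ae hW.1 LD.1 L0.1 LD.1 L0.1 z z) (ip0l (ph_w hW) L0).
have [_ /(_ _ e0)[g [[p [hp ->]] h]]] := ncl_all hW S0 SL Slin hI hS hf.
by exists p.
Qed.

Lemma n2_eq0_ae f : L2w (fun=> 1%:M) f -> n2 (ipw (fun=> 1%:M)) f = 0 ->
  circ_ae (fun t => f t = 0).
Proof.
move=> hf; have w1 := @weight1 R T; rewrite n2_ipwE => h.
have i1 := L2w_integrable w1 hf.
pose u t := Re (qform 1%:M (f t)).
have eu t : \1_[set t | f t <> 0] t * u t = u t.
  rewrite indicE; have [h0|h0] := pselect (f t = 0).
    by rewrite memNset ?mul0r /u ?h0 /qform ?trmx0 ?mul0mx ?mxE// => /(_ h0).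
  by rewrite mem_set ?mul1r.
have : circ_ae (fun t => ~ [set t | f t <> 0] t).
  apply: (@null_of_Rintegral_le0 R [set t | f t <> 0] u).
  - by under eq_fun do rewrite eu.
  - move=> t ct ft; rewrite lt_neqAle (qform_Re_ge0 _ w1 ct) andbT; apply/eqP => /esym z.
    apply: ft; apply/colP => k; rewrite mxE; apply: nsq_eq0.
    apply/eqP; rewrite eq_le nsq_ge0 andbT; apply: (@le_trans _ _ (u t)); last by rewrite z.
    by rewrite /u qform1 (bigD1 k)//= lerDl; apply: sumr_ge0 => j _; exact: nsq_ge0.
  - under eq_Rintegral do rewrite eu.
    have/eqP := h; rewrite mulf_eq0 invr_eq0 gt_eqF ?two_pi_gt0//= => /eqP ->.
    exact: lexx.
by apply: circ_aeS => t _ /contrapT.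
Qed.

End SimpleDensity.

(** * Identification of the projection and of its spectral characteristic *)

Section Projection.
Context {R : realType} {d : measure_display} {Omega : measurableType d}.
Variable P : probability Omega R.
Context {T : nat}.
Implicit Types (f g h : R -> 'cV[R[i]]_T) (X Y : Omega -> R[i]^o).
Implicit Types (p : seq (set R * 'cV[R[i]]_T)) (q r : seq (R[i] * (int * 'I_T))).
Local Notation LP := (L2rv P : set (Omega -> R[i]^o)).
Local Notation ipr := (rv_inner P : (Omega -> R[i]^o) -> (Omega -> R[i]^o) -> R[i]).
Local Notation phr := (ph_rv P).
Local Notation chi := (@chi R T).
Variables (U O : set int).
Hypothesis hO : forall k, O k <-> ~ U k.
Variable zeta : int -> Omega -> 'cV[R[i]]_T.
Hypothesis Lzeta : forall i, LP (seqrv zeta i).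

Lemma L2rv_obs q : LP (comb (seqrv zeta) q).
Proof. exact: (comb_L phr q (L2rv0 P) Lzeta). Qed.

Lemma obs_spanP Y : obs_span P zeta O Y <-> LP Y /\ forall e : R, 0 < e ->
  exists q, avoids U q /\ n2 ipr (Y - comb (seqrv zeta) q) < e.
Proof.
have eS : [set X | exists j k, O j /\ X = comp (zeta j) k] =
    [set X : Omega -> R[i]^o | exists i : int * 'I_T, ~ U i.1 /\ X = seqrv zeta i].
  apply/seteqP; split => X.
    by move=> [j [k [/hO nU ->]]]; exists (j, k).
  by move=> [[j k] [/hO nU ->]]; exists j, k.
rewrite /obs_span /closed_span eS; split=> -[LY h]; split=> // e /h.
- move=> [y [/linspan_comb[q [hq ->]] hy]]; exists q; split; first exact: hq.
  by move: hy; rewrite (msqE (phB phr LY (L2rv_obs q))) lte_fin.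
- move=> [q [hq hy]]; exists (comb (seqrv zeta) q); split.
    exact: (comb_linspan (seqrv zeta) (D := fun i => ~ U i.1) hq).
  by rewrite (msqE (phB phr LY (L2rv_obs q))) lte_fin.
Qed.

Variables (H : R -> 'M[R[i]]_T) (h0 : R -> 'cV[R[i]]_T) (e0 : R).
Hypothesis wH : weight H.
Hypothesis iH : integrable_mx H.
Hypothesis L0 : L2w H h0.
Hypothesis happ : forall e : R, 0 < e ->
  exists q, avoids U q /\ n2 (ipw H) (h0 - comb chi q) < e.
Variables Axi Ahat : Omega -> R[i]^o.
Hypothesis LA : LP Axi.
Hypothesis hdist : forall q, avoids U q ->
  n2 ipr (Axi - comb (seqrv zeta) q) = e0 + n2 (ipw H) (h0 - comb chi q).
Hypothesis hproj : is_projection P (obs_span P zeta O) Axi Ahat.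

Lemma L2rv_Ahat : LP Ahat. Proof. exact: hproj.1.1. Qed.

Lemma pythagoras q : avoids U q -> n2 ipr (Axi - comb (seqrv zeta) q) =
  n2 ipr (Axi - Ahat) + n2 ipr (Ahat - comb (seqrv zeta) q).
Proof.
move=> hq; have LH := L2rv_Ahat; have Lq := L2rv_obs q.
have hqs : obs_span P zeta O (comb (seqrv zeta) q).
  apply/obs_spanP; split=> // e epos; exists q; split=> //.
  by rewrite subrr (n2_0 phr Lq).
have z1 : ipr (Axi - Ahat) Ahat = 0 := hproj.2 _ hproj.1.
have z2 : ipr (Axi - Ahat) (comb (seqrv zeta) q) = 0 := hproj.2 _ hqs.
have LD := phB phr LA LH; have LE := phB phr LH Lq.
rewrite (_ : Axi - comb (seqrv zeta) q = (Axi - Ahat) + (Ahat - comb (seqrv zeta) q)).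
  by rewrite (n2D phr LD LE) (ipBr phr LH Lq LD) z1 z2 subrr mulr0 addr0.
by rewrite addrA subrK.
Qed.

(** Both squared errors plus a nonnegative distance give the same sum. Combinations close to h0
    yield one inequality, combinations close to the estimate the other. *)
Lemma proj_error : n2 ipr (Axi - Ahat) = e0.
Proof.
have LH := L2rv_Ahat.
have E q : avoids U q -> n2 ipr (Axi - Ahat) + n2 ipr (Ahat - comb (seqrv zeta) q) =
    e0 + n2 (ipw H) (h0 - comb chi q).
  by move=> hq; rewrite -(pythagoras hq) hdist.
have P1 q : 0 <= n2 ipr (Ahat - comb (seqrv zeta) q).
  exact: (n2_ge0 phr (phB phr LH (L2rv_obs q))).
have P2 q : 0 <= n2 (ipw H) (h0 - comb chi q).
  exact: (n2_ge0 (ph_w wH) (phB (ph_w wH) L0 (comb_chi_L2w q wH iH))).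
apply/eqP; rewrite eq_le; apply/andP; split; apply/ler_addgt0Pr => e epos.
- have [q [hq lq]] := happ epos; have := E q hq; have := P1 q; lra.
- have [_ /(_ e epos)[q [hq lq]]] := (obs_spanP Ahat).1 hproj.1.
  have := E q hq; have := P2 q; lra.
Qed.

(** The errors cancel: relative to the observed combinations the estimate and h0 are placed
    alike. *)
Lemma proj_dist q : avoids U q ->
  n2 ipr (Ahat - comb (seqrv zeta) q) = n2 (ipw H) (h0 - comb chi q).
Proof.
move=> hq; have := pythagoras hq; rewrite (hdist hq) proj_error.
by move=> /addrI ->.
Qed.

Variable Z : set R -> Omega -> 'cV[R[i]]_T.
Hypothesis LZ : forall p, valid p -> LP (simple_int Z p).
Hypothesis hZ : forall p q, valid p ->
  n2 ipr ((simple_int Z p : Omega -> R[i]^o) - comb (seqrv zeta) q) =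
  n2 (ipw H) (simple_fun p - comb chi q).

Lemma SI_dist h q : is_stochastic_integral P Z H h Ahat ->
  n2 ipr (Ahat - comb (seqrv zeta) q) = n2 (ipw H) (h - comb chi q).
Proof.
move=> [Lh LH [p [hp p1 p2]]].
have hp' n : valid (p n) := (valid_nth (p n)).1 (hp n).
have Lp n := L2w_simple wH iH (hp' n); have Rp n := LZ (hp' n).
have Lc := comb_chi_L2w q wH iH; have Lo := L2rv_obs q.
have v1 := (wnorm_cvgP wH Lh Lp).1 p1; have v2 := (ms_cvgP LH Rp).1 p2.
have l1 := ncvg_n2 (ph_w wH) (phB (ph_w wH) Lh Lc) (fun n => phB (ph_w wH) (Lp n) Lc)
  (ncvg_subr (comb chi q) v1).
have l2' := ncvg_n2 phr (phB phr LH Lo) (fun n => phB phr (Rp n) Lo)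
  (ncvg_subr (comb (seqrv zeta) q) v2).
rewrite -(cvg_lim _ l1)// -(cvg_lim _ l2')//; congr (lim (_ @ \oo)).
by apply/funext => n; exact: hZ.
Qed.

(** h and h0 have the same distances, those of the estimate, to all polynomials that avoid U, and
    some of these come close to h0. *)
Lemma SI_unique h : is_stochastic_integral P Z H h Ahat -> n2 (ipw H) (h - h0) = 0.
Proof.
move=> hS; have [Lh _ _] := hS.
have LD := phB (ph_w wH) Lh L0.
apply/eqP; rewrite eq_le (n2_ge0 (ph_w wH) LD) andbT; apply/ler_addgt0Pr => e epos.
(* Both distances in [n2B_le3] are below e / 4 and each is doubled. *)
have e4 : 0 < e / 4 by rewrite divr_gt0.
have [q [hq lq]] := happ e4; have Lc := comb_chi_L2w q wH iH.
apply: (le_trans (n2B_le3 (ph_w wH) Lh Lc L0)).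
rewrite -(SI_dist q hS) (proj_dist hq) (n2C (ph_w wH) Lc L0).
lra.
Qed.

Lemma SI_exists h : L2w H h -> n2 (ipw H) (h - h0) = 0 ->
  is_stochastic_integral P Z H h Ahat.
Proof.
move=> Lh z; have LH := L2rv_Ahat.
have /choice[p hp] (n : nat) : exists p, valid p /\ n2 (ipw H) (h - simple_fun p) < n.+1%:R^-1.
  by apply: simple_dense => //; rewrite invr_gt0.
have Lp n := L2w_simple wH iH (hp n).1; have Rp n := LZ (hp n).1.
have c0 : (fun n : nat => n.+1%:R^-1 : R) @ \oo --> (0 : R) by have := @cvg_harmonic R.
(* With every approximation below d = 1/(n + 1): h is within 2 d of the polynomial, the simple
   function within 2 d + 4 d, and its integral within 12 d + 2 d of the estimate. *)
have b n : n2 ipr ((simple_int Z (p n) : Omega -> R[i]^o) - Ahat) <= 14 * n.+1%:R^-1.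
  have epos : 0 < n.+1%:R^-1 :> R by rewrite invr_gt0.
  have [q [hq lq]] := happ epos; have Lc := comb_chi_L2w q wH iH; have Lo := L2rv_obs q.
  apply: (le_trans (n2B_le3 phr (Rp n) Lo LH)).
  rewrite (hZ q (hp n).1) (n2C phr Lo LH) (proj_dist hq).
  have h1 := n2B_le3 (ph_w wH) (Lp n) Lh Lc.
  have h2 := n2B_le3 (ph_w wH) Lh L0 Lc.
  rewrite (n2C (ph_w wH) (Lp n) Lh) in h1; rewrite z in h2.
  move: h1 h2 (hp n).2 lq.
  move: (n2 _ (simple_fun (p n) - _)) (n2 _ (h - comb chi q)) (n2 _ (h - simple_fun _)).
  move: (n2 _ (h0 - _)) (n.+1%:R^-1) => u1 u2 u3 u4 u5; lra.
split=> //; exists p; split.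
- by move=> n; apply/valid_nth; exact: (hp n).1.
- apply/(wnorm_cvgP wH Lh Lp); apply: (cvg0_le _ c0) => n.
  rewrite (n2_ge0 (ph_w wH) (phB (ph_w wH) (Lp n) Lh)) (n2C (ph_w wH) (Lp n) Lh) /=.
  exact: ltW (hp n).2.
- apply/(ms_cvgP LH Rp).
  have c1 : (fun n : nat => 14 * n.+1%:R^-1 : R) @ \oo --> (0 : R).
    by rewrite -(mulr0 14); apply: cvgM => //; exact: cvg_cst.
  apply: (cvg0_le _ c1) => n.
  by rewrite (n2_ge0 phr (phB phr (Rp n) LH)) /=; exact: b.
Qed.

Lemma L2w_sub_opt h : L2w H h -> n2 (ipw H) (h - h0) = 0 -> L2w_sub H O h.
Proof.
move=> Lh z; split=> // e epos.
(* One factor 2 comes from [n2B_le3], the factor 2 pi from the normalization of [wnorm]. *)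
have e1 : 0 < e / (2 * (2 * pi)) by rewrite divr_gt0// mulr_gt0 ?two_pi_gt0.
have [q [hq lq]] := happ e1; have Lc := comb_chi_L2w q wH iH.
exists (comb chi q); split.
  have -> : [set b | exists n k, O n /\ b = char_fun n k] =
      [set b : R -> 'cV[R[i]]_T | exists i : int * 'I_T, ~ U i.1 /\ b = chi i].
    apply/seteqP; split => b; first by move=> [n [k [/hO nU ->]]]; exists (n, k).
    by move=> [[n k] [/hO nU ->]]; exists n, k.
  exact: (comb_linspan chi (D := fun i => ~ U i.1) hq).
rewrite (wnormE wH (phB (ph_w wH) Lh Lc)) lte_fin.
have h2 := n2B_le3 (ph_w wH) Lh L0 Lc; rewrite z mulr0 add0r in h2.
have p4 : 0 < 2 * (2 * pi) :> R by rewrite mulr_gt0// two_pi_gt0.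
move: lq; rewrite (ltr_pdivlMr _ _ p4); apply: le_lt_trans.
rewrite (_ : _ * (2 * (2 * pi)) = 2 * pi * (2 * n2 (ipw H) (h0 - comb chi q))); last by ring.
by apply: ler_wpM2l h2; rewrite ltW// two_pi_gt0.
Qed.

End Projection.

Theorem theorem1 (R : realType) (d : measure_display) (Omega : measurableType d)
  (P : probability Omega R) (T : nat) (hT0 : (0 < T)%N)
  (s : nat) (M N : nat -> nat) (hs : (1 <= s)%N)
  (hM : forall l, (1 <= l <= s)%N -> (1 <= M l)%N)
  (hMN : forall l, (1 <= l < s)%N -> (M l + N l < M l.+1)%N)
  (xi eta : int -> Omega -> 'cV[R[i]]_T)
  (F G : R -> 'M[R[i]]_T)
  (hF : spectral_density F) (hG : spectral_density G)
  (hxi : stationary_with_density P xi F)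
  (heta : stationary_with_density P eta G)
  (hunc : uncorrelated P xi eta)
  (Zxi Zeta : set R -> Omega -> 'cV[R[i]]_T)
  (hZxi : spectral_representation P xi Zxi F)
  (hZeta : spectral_representation P eta Zeta G)
  (hmin : minimality (fun t => F t + G t))
  (a : int -> 'cV[R[i]]_T)
  (ha : (\esum_(j in ZS s M N) (\sum_(k < T) normc (a j k 0))%R%:E < +oo)%E)
  (hB : defined_on_l2 (Uset s M N) (Bblock F G))
  (hR : defined_on_l2 (Uset s M N) (Rblock F G))
  (hQ : defined_on_l2 (Uset s M N) (Qblock F G))
  (Binv : (int -> 'cV[R[i]]_T) -> int -> 'cV[R[i]]_T)
  (hBinv : inverse_on_l2 (Uset s M N) (Bblock F G) Binv)
  (* A xi and its optimal linear estimate *)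
  (Axi Ahat : Omega -> R[i])
  (hAxi : is_functional P (ZS s M N) a xi Axi)
  (hAhat : is_projection P
     (obs_span P (fun j w => xi j w + eta j w) (observed s M N)) Axi Ahat)
  (* C(e^{it}) *)
  (C : R -> 'cV[R[i]]_T)
  (hC : is_fourier_series (Uset s M N)
     (Binv (block_op (Uset s M N) (Rblock F G) (ext0 (ZS s M N) a))) C) :
  let U := Uset s M N in
  let A := Afun (ZS s M N) a in
  let av := ext0 (ZS s M N) a in
  let Ra := block_op U (Rblock F G) av in
  let Qa := block_op U (Qblock F G) av in
  let Delta := fine (msq P (fun w => Axi w - Ahat w)) in
  [/\ (forall h : R -> 'cV[R[i]]_T,
         is_spectral_characteristic P (fun t => F t + G t) (observed s M N)
           Zxi Zeta h Ahat
         <-> measurable_vec h /\ circ_ae (fun t => (h t)^T = hT F G A C t)),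
      Delta%:C = cmean (fun t => qform (F t) (rG F G A C t))
               + cmean (fun t => qform (G t) (rF F G A C t))
    & Delta%:C = l2_inner U Ra (Binv Ra) + l2_inner U Qa av].
Proof.
move=> U A av Ra Qa Delta; pose D := ZS s M N.
have hU (n : nat) : U n%:Z by right.
have DU : D `<=` U by move=> j [j0 _]; right; exact: ltW.
have hO k : observed s M N k <-> ~ U k.
  split=> [[k0 nS] [//|]|nU]; first by rewrite /= leNgt k0.
  by split=> [|kS]; [rewrite /Zneg /= ltNge; apply/negP => k0; apply: nU; right|apply: nU; left].
have wF := weight_density hF; have wG := weight_density hG.
have wH := weightD wF wG.
have iF := hF.1; have iG := hG.1; have iH := integrable_mxD iF iG.
pose h0 := opt_char F G D a C.
have L0 : L2w (fun t => F t + G t) h0 := L2w_opt hF hG hmin hU hB hR hBinv ha DU hC.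
have happ := opt_approx hF hG hmin hU hB hR hBinv ha DU hC.
pose zeta j w := xi j w + eta j w.
have Lx := L2rv_seqrv wF iF hZxi; have Ly := L2rv_seqrv wG iG hZeta.
have Lzeta i : L2rv P (seqrv zeta i).
  by have := phD (ph_rv P) (Lx i) (Ly i); rewrite /zeta seqrv_sum.
have LA : L2rv P Axi := hAxi.1.
have hdist q : avoids U q -> n2 (rv_inner P) ((Axi : Omega -> R[i]^o) - comb (seqrv zeta) q) =
    opt_error F G D a C + n2 (ipw (fun t => F t + G t)) (h0 - comb (@chi R T) q).
  move=> hq; rewrite (functional_dist wF wG iF iG hunc hZxi hZeta ha hAxi).
  exact: (error_split hF hG hmin hU hB hR hBinv ha DU hC hq).
pose Z (A : set R) w := Zxi A w + Zeta A w.
have LZ p : valid p -> L2rv P (simple_int Z p).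
  move=> hp; rewrite /Z simple_int_sum.
  exact: (phD (ph_rv P) (L2rv_simple hZxi.1 hp) (L2rv_simple hZeta.1 hp)).
have hZ p q (hp : valid p) := simple_obs_dist wF wG iF iG hunc hZxi hZeta q hp.
have E : Delta = opt_error F G D a C.
  rewrite -(proj_error hO Lzeta wH iH L0 happ LA hdist hAhat) /Delta.
  by rewrite (msqE (phB (ph_rv P) LA (L2rv_Ahat hAhat))).
split.
- move=> h; split=> [[_ hS]|[mh hh]].
  + have [Lh _ _] := hS; split; first exact: Lh.1.
    have z := SI_unique hO Lzeta wH iH L0 happ LA hdist hAhat LZ hZ hS.
    have LD := phB (ph_w wH) Lh L0.
    (* The lower bound on H turns distance zero in L2(H) into equality almost everywhere. *)
    have [K K0 hK] := one_le_H hF hG hmin hU hB.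
    have L1 := L2w_H1 hF hG hmin hU hB LD.
    have z1 : n2 (ipw (fun=> 1%:M)) (h - h0) = 0.
      apply/eqP; rewrite eq_le (n2_ge0 (ph_w (@weight1 R T)) L1) andbT.
      by have := n2_le K0 (@weight1 R T) wH hK LD; rewrite z mulr0.
    apply: circ_aeS (n2_eq0_ae L1 z1) => t ct e.
    by rewrite -[RHS]trmxK -opt_charE -/h0; congr (_^T); apply/eqP; rewrite -subr_eq0; apply/eqP.
  + have eh : circ_ae (fun t => h t = h0 t).
      by apply: circ_aeS hh => t ct e; rewrite /h0 opt_charE -e trmxK.
    have Lh : L2w (fun t => F t + G t) h.
      (* h is only known to be measurable; it inherits its finite norm from h0, with which it agrees
         almost everywhere. *)
      apply: (L2w_dom (c := 1) wH wH mh _ L0).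
      by apply: circ_aeS eh => t ct ->; rewrite mul1r.
    have z : n2 (ipw (fun t => F t + G t)) (h - h0) = 0.
      have LD := phB (ph_w wH) Lh L0; have L00 := L2w0 wH iH.
      have e0 : circ_ae (fun t => (h - h0) t = (0 : R -> 'cV[R[i]]_T) t).
        apply: circ_aeS eh => t ct e.
        by rewrite [LHS](_ : _ = h t - h0 t)// e subrr.
      by rewrite /n2 (ipw_ae wH.1 LD.1 L00.1 LD.1 L00.1 e0 e0) (ip0l (ph_w wH) L00).
    split; first exact: (L2w_sub_opt hO wH iH L0 happ Lh z).
    exact: (SI_exists hO Lzeta wH iH L0 happ LA hdist hAhat LZ hZ Lh z).
- by rewrite E; exact: (opt_error_spectral hF hG hmin hU hB hR hBinv ha DU hC).
- by rewrite E; exact: (opt_error_l2 hF hG hmin hU hB hR hQ hBinv ha DU hC).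
Qed.
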